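(* Let $m\ge1$ and let $\xi$ be the canonical contact distribution on $\mathbb{CP}^{2m+1}$ given, in the affine chart $\mathbb{C}^{2m+1}$ with coordinates $(x_1,y_1,\dots,x_m,y_m,z)$, by the equation $$dz=(y_1dx_1-x_1dy_1)+\dots+(y_mdx_m-x_mdy_m).$$ Then $\xi$ supports a Legendrian $m$-dimensional holomorphic foliation whose generic leaf is dense in $\mathbb{CP}^{2m+1}$.
   Context: ''Holomorphic foliation'' means singular holomorphic foliation. A foliation is Legendrian for a distribution $\mathcal{D}$ if its leaves are tangent to $\mathcal{D}$. The distribution $\xi$ is the (unique) holomorphic extension to $\mathbb{CP}^{2m+1}$ of the distribution given by the displayed equation on the affine chart. ''The generic leaf is dense'' means that there is a proper closed analytic subset such that every leaf through a point outside this subset is dense. *)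

(* Defs.v *)
From HB Require Import structures.
From mathcomp Require Import all_boot all_order all_algebra.
From mathcomp Require Import generic_quotient complex.
From mathcomp Require Import all_classical all_reals all_analysis.
From mathcomp Require Import zify ring.

Set Implicit Arguments.
Unset Strict Implicit.
Unset Printing Implicit Defensive.

Import Order.TTheory GRing.Theory Num.Theory.
Import numFieldNormedType.Exports.

Local Open Scope classical_set_scope.
Local Open Scope ring_scope.

(* Typing the complex numbers as a numFieldType puts the sup-norm topology on *)
(* row vectors and makes [differentiable] mean complex-differentiable.        *)
Definition C (R : realType) : numFieldType := R[i]%C.

Section ProjectiveSpace.
Variables (R : realType) (n : nat).

Definition nonzero_vectors : set 'rV[C R]_n.+1 := [set v | v != 0].

Definition same_line (u v : nonzero_vectors) : bool :=
  (<[\val u]> == <[\val v]>)%VS.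

Lemma same_line_equiv : equiv_class_of same_line.
Proof.
split; first by move=> u; exact: eqxx.
- by move=> u v; rewrite /same_line eq_sym.
- by move=> v u w; rewrite /same_line => /eqP ->.
Qed.

Canonical same_line_equivrel := EquivRelPack same_line_equiv.

Definition CP : Type := quotient_topology {eq_quot same_line}%qT.
HB.instance Definition _ := Topological.on CP.
HB.instance Definition _ := Quotient.on CP.

Definition homog (p : CP) : 'rV[C R]_n.+1 := \val (repr p).

(* The row vector u with an additional entry c inserted at position i.        *)
Definition insert_entry (i : 'I_n.+1) (c : C R) (u : 'rV[C R]_n) :
    'rV[C R]_n.+1 :=
  \row_j (if unlift i j is Some k then u 0 k else c).

Lemma insert_entry1_neq0 i u : insert_entry i 1 u \in nonzero_vectors.
Proof.
apply/mem_set/eqP => /rowP /(_ i).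
by rewrite !mxE unlift_none => /eqP; rewrite oner_eq0.
Qed.

(* The inverse of the i-th affine chart.                                      *)
Definition chart (i : 'I_n.+1) (x : 'rV[C R]_n) : CP :=
  \pi_CP%qT (SigSub (insert_entry1_neq0 i x)).

(* Only meaningful for p in range (chart i).                                  *)
Definition affine_coord (i : 'I_n.+1) (p : CP) : 'rV[C R]_n :=
  \row_k (homog p 0 (lift i k) / homog p 0 i).

Definition holomorphic_on (d e : nat) (U : set 'rV[C R]_d)
    (f : 'rV[C R]_d -> 'rV[C R]_e) : Prop :=
  forall x, U x -> differentiable f x.

(* The condition is imposed at every point of CP, not only at points of A, so *)
(* an analytic subset is closed.                                              *)
Definition analytic_subset (A : set CP) : Prop :=
  forall (i : 'I_n.+1) (x : 'rV[C R]_n),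
  exists (U : set 'rV[C R]_n) (r : nat) (f : 'rV[C R]_n -> 'rV[C R]_r),
    [/\ open U, U x, holomorphic_on U f &
        forall y, U y -> (A (chart i y) <-> f y = 0)].

(* For the sup norm the unit ball is the open unit polydisc.                  *)
Definition polydisc (d : nat) : set 'rV[C R]_d := ball 0 1.

Definition immersed_polydisc (d : nat) (s : 'rV[C R]_d -> CP) : Prop :=
  forall t, polydisc t ->
    {for t, continuous s} /\
    forall i, range (chart i) (s t) ->
      differentiable (affine_coord i \o s) t /\
      injective ('d (affine_coord i \o s) t).

(* The dimension of an analytic set is the largest dimension of a complex     *)
(* submanifold that it contains.                                              *)
Definition codim_ge (c : nat) (A : set CP) : Prop :=
  forall (d : nat) (s : 'rV[C R]_d -> CP),
    immersed_polydisc s -> s @` @polydisc d `<=` A -> (d + c <= n)%N.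

(* A field of tangent subspaces.  The projection pi from the nonzero vectors  *)
(* to CP induces an isomorphism from C^(n+1)/p onto the tangent space at      *)
(* p = pi v, and replacing v by c v only rescales it.  So a tangent subspace  *)
(* at p is recorded by its inverse image under the differential of pi at v, a *)
(* subspace of C^(n+1) that contains the line p and does not depend on v.     *)
Definition tangent_distribution : Type := CP -> {vspace 'rV[C R]_n.+1}.

(* The distribution read in the i-th affine chart: the differential of        *)
(* insert_entry i 1 is insert_entry i 0.                                      *)
Definition chart_fiber (D : tangent_distribution) (i : 'I_n.+1)
    (x : 'rV[C R]_n) : {vspace 'rV[C R]_n} :=
  (linfun (insert_entry i 0) @^-1: D (chart i x))%VS.

Definition holomorphic_distribution (k : nat) (Om : set CP)
    (D : tangent_distribution) : Prop :=
  (forall p, Om p -> homog p \in D p) /\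
  forall (i : 'I_n.+1) (x : 'rV[C R]_n), Om (chart i x) ->
  exists (U : set 'rV[C R]_n) (X : 'I_k -> 'rV[C R]_n -> 'rV[C R]_n),
    [/\ open U, U x, (forall a, holomorphic_on U (X a)) &
        forall y, U y -> basis_of (chart_fiber D i y) [seq X a y | a : 'I_k]].

Definition lie_bracket (X Y : 'rV[C R]_n -> 'rV[C R]_n) (x : 'rV[C R]_n) :
    'rV[C R]_n :=
  'd Y x (X x) - 'd X x (Y x).

Definition involutive_distribution (Om : set CP)
    (D : tangent_distribution) : Prop :=
  forall (i : 'I_n.+1) (U : set 'rV[C R]_n) (X Y : 'rV[C R]_n -> 'rV[C R]_n),
    open U -> chart i @` U `<=` Om ->
    holomorphic_on U X -> holomorphic_on U Y ->
    (forall x, U x -> X x \in chart_fiber D i x) ->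
    (forall x, U x -> Y x \in chart_fiber D i x) ->
    forall x, U x -> lie_bracket X Y x \in chart_fiber D i x.

(* A singular holomorphic foliation of dimension k: an analytic subset of     *)
(* codimension at least 2 and an involutive holomorphic rank k subbundle of   *)
(* the tangent bundle of its complement.                                      *)
Record foliation (k : nat) := Foliation {
  sing : set CP;
  tangent : tangent_distribution;
  sing_analytic : analytic_subset sing;
  sing_codim : codim_ge 2 sing;
  tangent_holomorphic : holomorphic_distribution k (~` sing) tangent;
  tangent_involutive : involutive_distribution (~` sing) tangent
}.

Section Leaves.
Variables (k : nat) (F : foliation k).

Definition plaque (s : 'rV[C R]_k -> CP) : Prop :=
  [/\ immersed_polydisc s, s @` @polydisc k `<=` ~` sing F &
      forall t i, polydisc t -> range (chart i) (s t) ->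
      forall u, 'd (affine_coord i \o s) t u \in
        chart_fiber (tangent F) i (affine_coord i (s t))].

(* The leaf through p: the points joined to p by a finite chain of plaques.   *)
Inductive leaf (p : CP) : CP -> Prop :=
| leaf_refl : leaf p p
| leaf_step (s : 'rV[C R]_k -> CP) (t t' : 'rV[C R]_k) :
    plaque s -> polydisc t -> polydisc t' ->
    leaf p (s t) -> leaf p (s t').

Definition generic_leaf_dense : Prop :=
  exists A : set CP, [/\ analytic_subset A, A <> setT &
    forall p, ~ A p -> ~ sing F p -> dense (leaf p : set CP)].

Definition legendrian (D : tangent_distribution) : Prop :=
  forall p, ~ sing F p -> (tangent F p <= D p)%VS.

End Leaves.

End ProjectiveSpace.

Section Contact.
Variables (R : realType) (m : nat).

(* The coordinates (x_1, y_1, ..., x_m, y_m, z) of C^(2m+1), from index 0.    *)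
Definition coord_x (w : 'rV[C R]_(2 * m).+1) (j : 'I_m) : C R :=
  w 0 (inord (2 * j)).
Definition coord_y (w : 'rV[C R]_(2 * m).+1) (j : 'I_m) : C R :=
  w 0 (inord (2 * j).+1).
Definition coord_z (w : 'rV[C R]_(2 * m).+1) : C R := w 0 ord_max.

(* Holomorphic on all of CP and given by                                      *)
(*   dz = \sum_j (y_j dx_j - x_j dy_j)                                        *)
(* on the affine chart where the homogeneous coordinate of index 0 is 1; such *)
(* a distribution is unique because the chart is dense.                       *)
Definition canonical_contact (xi : tangent_distribution R (2 * m).+1) : Prop :=
  holomorphic_distribution (2 * m) setT xi /\
  forall w u : 'rV[C R]_(2 * m).+1,
    u \in chart_fiber xi ord0 w <->
    coord_z u = \sum_(j < m) (coord_y w j * coord_x u j - coord_x w j * coord_y u j).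

End Contact.

Section ChartTheory.
Variables (R : realType) (n : nat).
Implicit Types (i : 'I_n.+1) (x u : 'rV[C R]_n).

Lemma insert_entry0_is_linear i : linear (@insert_entry R n i 0).
Proof.
move=> a u v; apply/rowP => j; rewrite !mxE.
by case: unlift => [k|]; rewrite ?mxE // mulr0 addr0.
Qed.
HB.instance Definition _ i := GRing.isLinear.Build _ _ _ _ (@insert_entry R n i 0)
  (insert_entry0_is_linear i).

Lemma mem_chart_fiber (D : tangent_distribution R n) i x u :
  (u \in chart_fiber D i x) = (insert_entry i 0 u \in D (chart i x)).
Proof. by rewrite -memv_preim lfunE. Qed.

Lemma homog_neq0 (p : CP R n) : homog p != 0.
Proof. by rewrite /homog; case: (repr p) => v /= /set_mem. Qed.

Lemma homog_chart i x :
  exists2 a, a != 0 & homog (chart i x) = a *: insert_entry i 1 x.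
Proof.
have : same_line (repr (chart i x)) (SigSub (insert_entry1_neq0 i x)).
  apply/eqP; have := reprK (chart i x); rewrite {2}/chart => /eqmodP.
  by rewrite /= /same_line => /eqP.
rewrite /same_line /= -/(homog _) => /eqP h.
have : homog (chart i x) \in <[insert_entry i 1 x]>%VS by rewrite -h memv_line.
move=> /vlineP[a ha]; exists a => //.
apply: contra_neq (homog_neq0 (chart i x)) => a0; by rewrite ha a0 scale0r.
Qed.

Lemma chartK i : cancel (@chart R n i) (affine_coord i).
Proof.
move=> x; apply/rowP => k; rewrite mxE; have [a a0 ->] := homog_chart i x.
by rewrite !mxE liftK unlift_none mulr1 mulrAC divff // mul1r.
Qed.

End ChartTheory.

Lemma open_neq0 (K : numFieldType) : open [set z : K^o | z != 0].
Proof.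
rewrite openE => z /= z0; apply/nbhs_normP; exists `|z|; rewrite /= ?normr_gt0 // => w.
by apply: contraTneq => ->; rewrite /ball_ /= subr0 ltxx.
Qed.
Section HyperplaneFrame.
Variables (R : realType) (n : nat).
Variable al : 'rV[C R]_n.+1 -> {linear 'rV[C R]_n.+1 -> (C R)^o}.
Hypothesis al_diff :
  forall x k, differentiable (fun x => al x (delta_mx 0 k) : (C R)^o) x.

Lemma hyper_frame x : (exists u, al x u != 0) ->
  exists (U : set 'rV[C R]_n.+1) (X : 'I_n -> 'rV[C R]_n.+1 -> 'rV[C R]_n.+1),
    [/\ open U, U x, (forall a, holomorphic_on U (X a)) &
        forall y, U y -> basis_of (lker (linfun (al y))) [seq X a y | a : 'I_n]].
Proof.
move=> [u alu].
have [l hl] : exists l, al x (delta_mx 0 l) != 0.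
  apply: contrapT => H; move/negP: alu; apply.
  rewrite (row_sum_delta u) linear_sum big1 // => l _; rewrite linearZ /=.
  have [->|h] := eqVneq (al x (delta_mx 0 l)) 0; first by rewrite scaler0.
  by case: H; exists l.
pose e k : 'rV[C R]_n.+1 := delta_mx 0 k.
pose X (a : 'I_n) (y : 'rV[C R]_n.+1) : 'rV[C R]_n.+1 :=
  e (lift l a) - (al y (e (lift l a)) / al y (e l)) *: e l.
pose U := [set y | al y (e l) != 0].
have ct : continuous (fun y => al y (e l) : (C R)^o).
  by move=> y; apply: differentiable_continuous; exact: al_diff.
exists U, X; split.
- by move/continuousP: ct => ct; apply: (ct [set z | z != 0]) (@open_neq0 (C R)).
- exact: hl.
- move=> a y Uy; apply: differentiableB; first exact: differentiable_cst.
  apply: differentiableZl; apply: differentiableM; first exact: al_diff.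
  by apply: differentiableV => //; exact: al_diff.
move=> y Uy; rewrite basisEdim; apply/andP; split.
  apply/subvP => v; rewrite memv_ker lfunE /= => /eqP v0.
  have -> : v = \sum_(a < n) v 0 (lift l a) *: X a y.
    apply/rowP => j; rewrite summxE.
    have [<-|ljn] := eqVneq l j.
      have : al y v = v 0 l *: al y (e l) + \sum_(a < n) v 0 (lift l a) *: al y (e (lift l a)).
        rewrite {1}(row_sum_delta v) linear_sum (bigD1_ord l) //=.
        rewrite linearZ /=; congr (_ + _); apply: eq_bigr => a _; by rewrite linearZ.
      rewrite v0 => /esym/eqP; rewrite addr_eq0 => /eqP h.
      apply: (mulIf Uy); rewrite [LHS]h mulr_suml -sumrN; apply: eq_bigr => a _.
      rewrite !mxE !eqxx /= (negbTE (neq_lift l a)) /= mulr1 sub0r mulrN mulNr.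
      by congr (- _); rewrite -mulrA divfK.
    have := unlift_some ljn => -[b -> _].
    rewrite (bigD1 b) //= big1 ?addr0 => [|a ab]; rewrite !mxE eqxx /= (eq_sym _ l) (negbTE (neq_lift l b)) mulr0 subr0.
      by rewrite eqxx mulr1.
    by rewrite (inj_eq lift_inj) eq_sym (negbTE ab) mulr0.
  apply: memv_suml => a _; apply: memvZ; apply: memv_span.
  by apply: map_f; rewrite mem_enum.
rewrite size_map -cardE card_ord.
have := limg_ker_dim (linfun (al y)) fullv.
rewrite capfv.
have -> : \dim {: 'rV[C R]_n.+1} = n.+1 by rewrite dimvf /dim /= mul1n.
have : (\dim (limg (linfun (al y))) <= 1)%N.
  by have := dimvS (subvf (limg (linfun (al y)))); rewrite dimvf.
set p := \dim _ => p1; set q := \dim _ => h.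
by rewrite -(leq_add2r p) h (leq_trans (leq_add (leqnn n) p1)) // addn1.
Qed.
End HyperplaneFrame.


Section ContactExistence.
Variables (R : realType) (m : nat).
Notation V := 'rV[C R]_(2 * m).+2.
Local Definition tl (v : V) : 'rV[C R]_(2 * m).+1 := \row_k v 0 (lift ord0 k).
(* The homogenization of dz - \sum_j (y_j dx_j - x_j dy_j).                   *)
Definition om (v w : V) : (C R)^o :=
  v 0 0 * coord_z (tl w) - w 0 0 * coord_z (tl v)
  - \sum_(j < m) (coord_y (tl v) j * coord_x (tl w) j - coord_x (tl v) j * coord_y (tl w) j).
Lemma om_lin v : linear (om v).
Proof.
move=> a u w; rewrite /om /coord_x /coord_y /coord_z.
rewrite !mxE /GRing.scale /=.
under eq_bigr do rewrite !mxE.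
have E : forall F G H : 'I_m -> C R, (forall j, F j = a * G j + H j) ->
   \sum_j F j = a * (\sum_j G j) + \sum_j H j.
  by move=> F G H h; rewrite mulr_sumr -big_split; exact: eq_bigr.
rewrite (E _ (fun j => coord_y (tl v) j * coord_x (tl u) j - coord_x (tl v) j * coord_y (tl u) j)
 (fun j => coord_y (tl v) j * coord_x (tl w) j - coord_x (tl v) j * coord_y (tl w) j)).
  by ring.
by move=> j; rewrite /coord_x /coord_y !mxE; ring.
Qed.
HB.instance Definition _ v := GRing.isLinear.Build _ _ _ _ (om v) (om_lin v).
Lemma omZr v a w : om v (a *: w) = a * om v w.
Proof. exact: (linearZ_LR (om v)). Qed.
Lemma omC v w : om v w = - om w v.
Proof.
rewrite /om.
have -> : \sum_(j < m) (coord_y (tl v) j * coord_x (tl w) j - coord_x (tl v) j * coord_y (tl w) j) = - \sum_(j < m) (coord_y (tl w) j * coord_x (tl v) j - coord_x (tl w) j * coord_y (tl v) j).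
  by rewrite -sumrN; apply: eq_bigr => j _; ring.
by ring.
Qed.

Lemma om_eq0Zl a v w : a != 0 -> (om (a *: v) w == 0) = (om v w == 0).
Proof. by move=> a0; rewrite omC omZr oppr_eq0 mulf_eq0 (negbTE a0) /= [in RHS]omC oppr_eq0. Qed.
Lemma om_nn v : om v v = 0.
Proof. by apply/eqP; have /eqP := omC v v; rewrite -addr_eq0 -mulr2n mulrn_eq0. Qed.
Lemma om_nondeg v : (forall w, om v w = 0) -> v = 0.
Proof.
move=> H; apply/rowP => k; rewrite [RHS]mxE.
pose t (k : 'I_(2 * m).+1) : V := delta_mx 0 (lift ord0 k).
have tt l q : tl (t l) 0 q = (q == l)%:R by rewrite !mxE eqxx /= (inj_eq lift_inj).
have Ht (l : 'I_(2 * m).+1) : v 0 0 * (ord_max == l)%:R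
  - \sum_(j < m) (coord_y (tl v) j * (inord (2 * j) == l)%:R - coord_x (tl v) j * (inord (2 * j).+1 == l)%:R) = 0.
  rewrite -[RHS](H (t l)) /om; congr (_ - _).
    by rewrite /coord_z tt [t l 0 0]mxE /= mul0r subr0.
  by apply: eq_bigr => j _; rewrite /coord_x /coord_y !tt.
have ne (a b : nat) : (a <= 2 * m)%N -> (b <= 2 * m)%N -> a != b ->
  (inord a == inord b :> 'I_(2 * m).+1) = false.
  by move=> ha hb hab; apply/eqP => /(congr1 val) /=; rewrite !inordK //; apply/eqP.
have mx : ord_max = inord (2 * m) :> 'I_(2 * m).+1 by apply/val_inj; rewrite /= inordK.
have h0 : v 0 0 = 0.
  have := Ht ord_max; rewrite eqxx (mulr1 (v 0 0)) big1 ?subr0 // => j _.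
  by have hj := ltn_ord j; rewrite mx !ne ?mulr0 ?subrr //; lia.
have hz : coord_z (tl v) = 0.
  have := H (delta_mx 0 0); rewrite omC /om h0 mul0r subr0.
  rewrite [delta_mx 0 0 0 0]mxE eqxx mul1r big1 ?subr0 => [/eqP|j _].
    by rewrite oppr_eq0 => /eqP.
  by rewrite /coord_x /coord_y !mxE /= !mul0r subrr.
have hy j : coord_y (tl v) j = 0.
  have := Ht (inord (2 * j)); rewrite h0 mul0r sub0r (bigD1 j) //= eqxx mulr1.
  have hj := ltn_ord j; rewrite ne ?mulr0 ?subr0; try lia.
  rewrite big1 ?addr0 => [/eqP|i ij]; first by rewrite oppr_eq0 => /eqP.
  have hi := ltn_ord i; have ij' : (i != j :> nat) by [].
  by rewrite !ne ?mulr0 ?subr0 //; lia.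
have hx j : coord_x (tl v) j = 0.
  have := Ht (inord (2 * j).+1); rewrite h0 mul0r sub0r (bigD1 j) //= eqxx mulr1.
  have hj := ltn_ord j; rewrite ne ?mulr0 ?sub0r; try lia.
  rewrite big1 ?addr0 => [/eqP|i ij]; first by rewrite opprK => /eqP.
  have hi := ltn_ord i; have ij' : (i != j :> nat) by [].
  by rewrite !ne ?mulr0 ?subr0 //; lia.
case: (unliftP ord0 k) => [l|] -> //.
have -> : v 0 (lift ord0 l) = tl v 0 l by rewrite mxE.
have := ltn_ord l; rewrite ltnS leq_eqVlt => /orP[/eqP lm|lm].
  by rewrite -hz /coord_z; congr (tl v 0 _); apply/val_inj.
have hl : (l./2 < m)%N by lia.
have [lo|le] := boolP (odd l).
  rewrite -(hy (Ordinal hl)) /coord_y; congr (tl v 0 _); apply/val_inj => /=; rewrite inordK; lia.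
rewrite -(hx (Ordinal hl)) /coord_x; congr (tl v 0 _); apply/val_inj => /=; rewrite inordK; lia.
Qed.

Definition contact_kernel : tangent_distribution R (2 * m).+1 := fun p => lker (linfun (om (homog p))).
Lemma contact_kernel_canonical : canonical_contact contact_kernel.
Proof.
split; last first.
  move=> w u; rewrite mem_chart_fiber memv_ker lfunE /=.
  have [a a0 ->] := homog_chart (ord0 : 'I_(2 * m).+2) w.
  rewrite om_eq0Zl //.
  have tlK c x : tl (insert_entry 0 c x) = x.
    by apply/rowP => k; rewrite !mxE liftK.
  rewrite /om !tlK !mxE unlift_none mul1r mul0r subr0 subr_eq0; split=> [/eqP //|-> //].
split=> [p _|i x _].
  rewrite memv_ker lfunE /= -[_ == _]/(om _ _ == 0).
  by rewrite om_nn.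
pose al (y : 'rV[C R]_(2 * m).+1) : {linear 'rV[C R]_(2 * m).+1 -> (C R)^o} :=
  (om (insert_entry i 1 y) \o insert_entry i 0).
have al_diff y k : differentiable (fun y => al y (delta_mx 0 k) : (C R)^o) y.
  pose c j := om (insert_entry i 0 (delta_mx 0 j)) (insert_entry i 0 (delta_mx 0 k)).
  have -> : (fun y => al y (delta_mx 0 k) : (C R)^o) =
      (fun y => al 0 (delta_mx 0 k) + \sum_j (y 0 j *: c j : (C R)^o)).
    apply/funext => z; rewrite /al /=.
    have -> : insert_entry i 1 z = insert_entry i 1 0 + insert_entry i 0 z.
      by apply/rowP => j; rewrite !mxE; case: unlift => [l|]; rewrite ?mxE ?add0r ?addr0.
    rewrite omC (linearD (om _)) opprD /= -omC; congr (_ + _).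
    rewrite {1}(row_sum_delta z) linear_sum /= (linear_sum (om _)) /=.
    rewrite -sumrN; apply: eq_bigr => j _.
    by rewrite linearZ omZr /c omC /= mulrN opprK.
  apply: differentiableD; first exact: differentiable_cst.
  have -> : (fun y : 'rV[C R]_(2 * m).+1 => \sum_j (y 0 j *: c j : (C R)^o)) = \sum_j (fun y : 'rV[C R]_(2 * m).+1 => y 0 j *: c j : (C R)^o).
    by apply/funext => z; rewrite fct_sumE.
  apply: differentiable_sum => j; apply: differentiableZl; exact: differentiable_coord.
have fib y : chart_fiber contact_kernel i y = lker (linfun (al y)).
  apply/vspaceP => u; rewrite mem_chart_fiber !memv_ker !lfunE /=.
  have [a a0 ->] := homog_chart i y.
  by rewrite om_eq0Zl.
have [|U [X [oU Ux hX bX]]] := @hyper_frame R (2 * m) al al_diff x.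
  apply: contrapT => Hn.
  have al0 u : al x u = 0 by apply: contrapT => h; apply: Hn; exists u; apply/eqP.
  have : insert_entry i 1 x = 0.
    apply: om_nondeg => w.
    pose u : 'rV[C R]_(2 * m).+1 := \row_k (w 0 (lift i k) - w 0 i * x 0 k).
    have -> : w = w 0 i *: insert_entry i 1 x + insert_entry i 0 u.
      apply/rowP => j; rewrite !mxE; case: unliftP => [k ->|->]; rewrite ?mxE.
        by rewrite addrC subrK.
      by rewrite mulr1 addr0.
    by rewrite (linearD (om (insert_entry i 1 x))) /= omZr [om _ (insert_entry i 0 u)](al0 u) addr0 om_nn mulr0.
  by have := set_mem (insert_entry1_neq0 i x) => /eqP.
exists U, X; split; [exact: oU|exact: Ux|exact: hX|].
by move=> y Uy; rewrite fib; exact: bX.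
Qed.

End ContactExistence.

(* Main.v *)
(** On the affine chart consider the foliation
      [dy_j = rho(x_j) dx_j],  [dz = \sum_j (y_j dx_j - x_j dy_j)],
    with [rho(x) = \sum_l (A_l / 2) / (x - p_l)] for eight poles [p_l].  It is
    tangent to the contact distribution, and its leaves are multivalued graphs
    over the coordinates [x_j]: continuing around [p_l] in the variable [x_j]
    translates [y_j] by [pi i A_l], and [z] by [pi i A_l (x_j - 2 p_l)].  For
    residues [A_l] in [{1, sqrt 2, i, i sqrt 2}], each carried by two poles at
    distance 1, these translations generate a dense subgroup of the plane of
    [(y_j, z)], so every leaf that avoids the hyperplanes [x_j = p_l] is dense.

    In homogeneous coordinates the distribution is the intersection of the
    contact distribution with the codimension [m] foliation [dy_j = rho(x_j) dx_j].
    It extends holomorphically across the hyperplane at infinity [v_0 = 0] away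
    from the codimension 2 set where moreover some [X_j] vanishes or all the
    [Y_j] vanish. *)
From HB Require Import structures.
Require Import Defs.
From mathcomp Require Import all_boot all_order all_algebra.
From mathcomp Require Import generic_quotient complex.
From mathcomp Require Import all_classical all_reals all_analysis.
From mathcomp Require Import zify ring lra.

Set Implicit Arguments.
Unset Strict Implicit.
Unset Printing Implicit Defensive.

Import Order.TTheory GRing.Theory Num.Theory.
Import numFieldNormedType.Exports.

Local Open Scope classical_set_scope.
Local Open Scope ring_scope.

(** * Complex derivatives, exponential and logarithm *)

Section Derivatives.
Variable K : numFieldType.
Implicit Types (f g : K -> K) (a d : K).

(** The translation produced by a loop depends on [x_j], so what must be dense is the set of pairs
    formed by the sums of [A_l n_l] and of [A_l p_l n_l], for integers [n_l]. The numbers 1, sqrt 2,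
    i, i sqrt 2 generate a dense subgroup of the complex numbers. Giving each of them to two poles
    at distance 1 makes the two sums independent: a loop exchanged for one around the twin pole
    keeps the first sum and changes the second by the residue. All [y_j] can thus be corrected, and
    the single [z] with them. Leaves are chains of plaques, so continuation of the logarithms is
    expressed by chains of holomorphic discs rather than by lifting paths, and a full turn around a
    pole fits in one disc because the disc need not be injective. At infinity the slopes are
    useless. Homogeneous equations replace them, and the plane at [v] is the line of [v] plus
    explicit vectors whose coefficients satisfy one linear equation. This description gives the
    rank, the holomorphic frames and, since a form and its derivative need testing only on the
    explicit vectors, involutivity. *)

Lemma is_derive_le_eps f a d : (forall e, 0 < e ->
    \forall h \near (0 : K), `|f (h + a) - f a - d * h| <= e * `|h|) ->
  is_derive a 1 f d.
Proof.
move=> H.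
have cv : (fun h => h^-1 *: ((f \o shift a) (h *: 1) - f a)) @ 0^' --> d.
  apply/cvgrPdist_le => e e0; near=> h.
  have h0 : h != 0 by near: h; exact: nbhs_dnbhs_neq.
  have Hh : `|f (h + a) - f a - d * h| <= e * `|h|.
    by near: h; apply: nbhs_dnbhs; exact: H.
  rewrite /= {1}[h *: 1]mulr1 distrC.
  have -> : h^-1 *: (f (h + a) - f a) - d = h^-1 * (f (h + a) - f a - d * h).
    by rewrite [_ *: _]/(_ * _) mulrBr; congr (_ - _); rewrite mulrCA mulVf ?mulr1.
  by rewrite normrM normfV mulrC ler_pdivrMr ?normr_gt0.
by apply: DeriveDef; [apply/cvg_ex; exists d|exact: cvg_lim cv].
Unshelve. all: by end_near. Qed.

Lemma is_derive_eps_le f a d : is_derive a 1 f d -> forall e, 0 < e ->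
    \forall h \near (0 : K), `|f (h + a) - f a - d * h| <= e * `|h|.
Proof.
move=> [cv dE] e e0; move: cv => /cvgP; rewrite -[lim _]/(derive f a 1) dE => cv.
have /cvgrPdist_le/(_ e e0) := cv.
rewrite /dnbhs /within /= => Hn; near=> h.
have [->|h0] := eqVneq h 0; first by rewrite add0r subrr mulr0 subr0 !normr0 mulr0.
have : `|d - h^-1 *: (f (h *: 1 + a) - f a)| <= e.
  by move: h0; near: h; exact: Hn.
rewrite {1}[h *: 1]mulr1 distrC.
have -> : h^-1 *: (f (h + a) - f a) - d = h^-1 * (f (h + a) - f a - d * h).
  by rewrite [_ *: _]/(_ * _) mulrBr; congr (_ - _); rewrite mulrCA mulVf ?mulr1.
by rewrite normrM normfV mulrC ler_pdivrMr ?normr_gt0.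
Unshelve. all: by end_near. Qed.

Lemma is_derive_differentiable f a d : is_derive a 1 f d -> differentiable (f : K^o
  -> K^o) a.
Proof. by move=> [df _]; apply/derivable1_diffP. Qed.

Lemma is_derive_comp f g a d e :
  is_derive (g a) 1 f d -> is_derive a 1 g e -> is_derive a 1 (f \o g) (d * e).
Proof.
move=> df dg.
have Df := is_derive_differentiable df; have Dg := is_derive_differentiable dg.
have Dfg := differentiable_comp Dg Df.
apply: DeriveDef; first exact/derivable1_diffP.
have E1 : 'D_1 (f \o g) a = 'd f (g a) ('d g a 1).
  apply: etrans (@deriveE K K K _ a 1 Dfg) _.
  exact: (congr1 (fun h : K -> K => h 1) (diff_comp Dg Df)).
have E2 : 'd g a 1 = e.
  by rewrite -(@deriveE K K K _ a 1 Dg); exact: (@derive_val _ _ _ _ _ _ _ dg).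
have E3 : 'd f (g a) 1 = d.
  by rewrite -(@deriveE K K K _ _ 1 Df); exact: (@derive_val _ _ _ _ _ _ _ df).
apply: etrans E1 _; apply: etrans (congr1 ('d f (g a)) E2) _.
have E4 : 'd f (g a) e = e *: 'd f (g a) (1 : K^o).
  by rewrite -linearZ /=; congr ('d f _ _); rewrite [_ *: _]mulr1.
by apply: etrans E4 _; rewrite E3; exact: mulrC.
Qed.

Lemma is_derive_fun_eq f g a d : is_derive a 1 f d -> f =1 g -> is_derive a 1 g d.
Proof. by move=> df /funext <-. Qed.

End Derivatives.

Section ComplexExponential.
Variable R : realType.
Notation K := (C R).

Definition cexp (z : K) : K := Complex (expR (complex.Re z) * cos (complex.Im z))
  (expR (complex.Re z) * sin (complex.Im z)).

Lemma cexpD z w : cexp (z + w) = cexp z * cexp w.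
Proof.
case: z => a b; case: w => c d; rewrite /cexp /= expRD cosD sinD.
by congr Complex; ring.
Qed.

Lemma cexp0 : cexp 0 = 1.
Proof. by rewrite /cexp /= expR0 cos0 sin0 mulr0 mulr1. Qed.

Lemma cexp_neq0 z : cexp z != 0.
Proof.
apply/eqP => h; have := cexpD z (- z); rewrite subrr cexp0 h mul0r => /eqP.
by rewrite oner_eq0.
Qed.

Lemma normCE (x y : R) : `|Complex x y : K| = (Num.sqrt (x ^+ 2 + y ^+ 2))%:C%C.
Proof. exact: normc_def. Qed.

Lemma norm_cexp z : `|cexp z| = (expR (complex.Re z))%:C%C.
Proof.
case: z => a b; rewrite /cexp /= normCE; congr (_%:C%C).
rewrite !exprMn -mulrDr cos2Dsin2 mulr1 sqrtr_sqr ger0_norm // expR_ge0.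
Qed.

Lemma Re_le_norm (x y e : R) : `|Complex x y : K| <= e%:C%C -> `|x| <= e /\ `|y| <= e.
Proof.
rewrite normCE lecR => h; split; apply: le_trans h; rewrite -sqrtr_sqr ler_wsqrtr //.
  by rewrite lerDl sqr_ge0.
by rewrite lerDr sqr_ge0.
Qed.

Lemma norm_le_ReIm (x y e : R) : `|x| + `|y| <= e -> `|Complex x y : K| <= e%:C%C.
Proof.
move=> h; rewrite normCE lecR; apply: le_trans h.
rewrite -[leRHS]ger0_norm ?addr_ge0 // -sqrtr_sqr ler_wsqrtr //.
rewrite sqrrD !real_normK ?num_real // -addrA lerD2l lerDr.
by rewrite mulrn_wge0 // mulr_ge0.
Qed.

(** Replaces complex neighbourhoods by squares with a real side, so that real estimates for [expR],
    [cos] and [sin] apply. *)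
Lemma near0_complex (P : K -> Prop) : (\forall z \near (0 : K), P z) <->
  exists2 d : R, 0 < d & forall x y : R, `|x| < d -> `|y| < d -> P (Complex x y).
Proof.
split=> [/nbhs_normP [e /= e0 H]|[d d0 H]].
  have [ei er] : complex.Im e = 0 /\ 0 < complex.Re e.
    by move: e0; rewrite ltcE /= => /andP[/eqP].
  exists (complex.Re e / 4) => [|x y hx hy]; first by rewrite divr_gt0.
  apply: H => /=; rewrite sub0r normrN.
  apply: (@le_lt_trans _ _ ((complex.Re e / 2)%:C%C)).
    by apply: norm_le_ReIm; lra.
  by rewrite ltcE /= ei eqxx /=; lra.
apply/nbhs_normP; exists (d%:C%C); first by rewrite /= ltcR.
case=> x y /=; rewrite sub0r normrN => h.
have [hx hy] : `|x| < d /\ `|y| < d.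
  move: h; rewrite normCE ltcR => h; split; apply: le_lt_trans h;
    rewrite -sqrtr_sqr ler_wsqrtr //.
    by rewrite lerDl sqr_ge0.
  by rewrite lerDr sqr_ge0.
exact: H.
Qed.

Lemma eps_real (e : K) : 0 < e -> exists2 r : R, 0 < r & e = r%:C%C.
Proof.
by case: e => a b; rewrite ltcE /= => /andP[/eqP -> h]; exists a.
Qed.

Lemma real_near0 (f : R -> R) d e : is_derive (0 : R) 1 f d -> 0 < e ->
  exists2 D : R, 0 < D & forall x, `|x| < D -> `|f x - f 0 - d * x| <= e * `|x|.
Proof.
move=> df e0; have /nbhs_normP [D /= D0 H] := is_derive_eps_le df e0.
exists D => // x hx; have := H x; rewrite /= addr0; apply.
by rewrite sub0r normrN.
Qed.

Lemma is_derive_cexp0 : is_derive (0 : K) 1 cexp 1.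
Proof.
apply: is_derive_le_eps => e e0; have [r r0 ->] := eps_real e0.
(* The four error terms below add up to at most [7 * t * M], whence [r / 8]; the bound [1 / 2] keeps
   [1 + x] and [E] at most 2. *)
pose t := Num.min (r / 8) (1 / 2).
have t0 : 0 < t by rewrite lt_min; apply/andP; split; [rewrite divr_gt0|lra].
have hr : t <= r / 8 by rewrite ge_min lexx.
have h2 : t <= 1/2 by rewrite ge_min lexx orbT.
clearbody t.
have [D1 D10 H1] := @real_near0 expR 1 t (is_derive_eq (is_derive_expR 0) (expR0 R)) t0.
have [D2 D20 H2] := @real_near0 cos 0 t (is_derive_eq (is_derive_cos 0) (etrans
  (congr1 -%R (sin0 R)) (oppr0 R))) t0.
have [D3 D30 H3] := @real_near0 sin 1 t (is_derive_eq (is_derive_sin 0) (cos0 R)) t0.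
apply/near0_complex.
exists (Num.min t (Num.min D1 (Num.min D2 D3))); first by rewrite !lt_min t0 D10 D20.
move=> x y; rewrite !lt_min => /and4P[xt x1 x2 x3] /and4P[yt y1 y2 y3].
have := H1 x x1; have := H2 y y2; have := H3 y y3.
rewrite addr0 cexp0 /cexp /= expR0 cos0 sin0 !mul1r mul0r !subr0.
set c := cos y; set s := sin y; set E := expR x => hs hc hE.
set n := `|_ : K|; set N := `|_ : K|.
have -> : N = (Num.sqrt (x ^+ 2 + y ^+ 2))%:C%C by rewrite /N normCE.
set M := Num.sqrt _.
have [xM yM] : `|x| <= M /\ `|y| <= M by apply: (@Re_le_norm x y); rewrite normCE lecR.
have -> : n = `|Complex (E * c - 1 - x) (E * s - y) : K|.
  rewrite /n; congr (`| _ |); apply/eqP; rewrite eq_complex /=; apply/andP; split;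
    apply/eqP; ring.
rewrite -[_ * M%:C%C]/(r%:C%C * M%:C%C) -rmorphM /=; apply: norm_le_ReIm.
have c1 : `|c| <= 1 by rewrite ler_norml; apply/andP; split;
  [exact: cos_geN1|exact: cos_le1].
have -> : E * c - 1 - x = (E - 1 - x) * c + (1 + x) * (c - 1) by ring.
have -> : E * s - y = E * (s - y) + (E - 1) * y by ring.
have hM0 : 0 <= M by exact: sqrtr_ge0.
have tM : t * `|x| <= t * M by rewrite ler_wpM2l // ltW.
have tM' : t * `|y| <= t * M by rewrite ler_wpM2l // ltW.
have B1 : `|(E - 1 - x) * c| <= t * M.
  rewrite normrM -[leRHS]mulr1; apply: ler_pM => //; exact: le_trans hE _.
have B2 : `|(1 + x) * (c - 1)| <= 2 * (t * M).
  rewrite normrM; apply: ler_pM => //; last exact: le_trans hc _.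
  by have := ler_normD 1 x; rewrite normr1; lra.
have E1 : `|E - 1| <= 2 * t.
  have : `|E - 1| <= `|E - 1 - x| + `|x| by have := ler_normD (E - 1 - x) x;
    rewrite subrK.
  by have : t * `|x| <= 1 * `|x| by [rewrite ler_wpM2r //; lra]; lra.
have B3 : `|E * (s - y)| <= 2 * (t * M).
  rewrite normrM; apply: ler_pM => //; last exact: le_trans hs _.
  by have := ler_normD (E - 1) 1; rewrite normr1 subrK; lra.
have B4 : `|(E - 1) * y| <= 2 * t * M by rewrite normrM; apply: ler_pM.
have := ler_normD ((E - 1 - x) * c) ((1 + x) * (c - 1)).
have := ler_normD (E * (s - y)) ((E - 1) * y).
have : t * M <= r / 8 * M by rewrite ler_wpM2r.
have : 0 <= t * M by rewrite mulr_ge0 // ltW.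
nra.
Qed.

(** The addition formula carries the expansion at 0 to [z], at the cost of a factor [cexp z]. *)
Lemma is_derive_cexp z : is_derive (z : K) 1 cexp (cexp z).
Proof.
have n0 : 0 < `|cexp z| by rewrite normr_gt0 cexp_neq0.
apply: is_derive_le_eps => e e0.
have := is_derive_eps_le is_derive_cexp0 (divr_gt0 e0 n0).
apply: filterS => w; rewrite !addr0 cexp0 mul1r cexpD.
have -> : cexp w * cexp z - cexp z - cexp z * w = cexp z * (cexp w - 1 - w) by ring.
by rewrite normrM -(ler_pM2l n0) [_ / _]mulrC !mulrA mulfV ?gt_eqF // mul1r.
Qed.

Lemma cexp_2pi : cexp (Complex 0 (pi *+ 2)) = 1.
Proof. by rewrite /cexp /= expR0 cos2pi sin2pi mulr0 mulr1. Qed.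

(** The principal branch, but only on the right half-plane, where [atan] of the quotient is the
    argument. *)
Definition clog (z : K) : K :=
  Complex (ln (Num.sqrt (complex.Re z ^+ 2 + complex.Im z ^+ 2)))
          (atan (complex.Im z / complex.Re z)).

Lemma clogK z : 0 < complex.Re z -> cexp (clog z) = z.
Proof.
case: z => x y /= x0; rewrite /clog /cexp /=.
set r := Num.sqrt _.
have r0 : 0 < r by rewrite sqrtr_gt0 ltr_wpDr ?sqr_ge0 // exprn_gt0.
have [at_ge at_le] : - (pi / 2) < atan (y / x) /\ atan (y / x) < pi / 2.
  by split; [exact: atan_gtNpi2|exact: atan_ltpi2].
have c0 : cos (atan (y / x)) != 0.
  by rewrite cos_atan invr_eq0 sqrtr_eq0 -ltNge ltr_pwDl // sqr_ge0.
have Hc : r * cos (atan (y / x)) = x.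
  rewrite cos_atan.
  have -> : 1 + (y / x) ^+ 2 = (x ^+ 2 + y ^+ 2) / x ^+ 2 by field; rewrite gt_eqF.
  rewrite sqrtrM ?addr_ge0 ?sqr_ge0 // sqrtrV ?sqr_ge0 // sqrtr_sqr gtr0_norm //.
  by rewrite invfM invrK mulrA mulfV ?gt_eqF // mul1r.
rewrite lnK ?posrE // Hc; congr Complex.
have : tan (atan (y / x)) = y / x by rewrite atanK.
rewrite /tan => /(congr1 ( *%R^~ (cos (atan (y / x))))); rewrite divfK // => ->.
by rewrite mulrCA Hc divfK ?gt_eqF.
Qed.

Lemma norm_lt_ReIm (z : K) (e : R) : `|z| < e%:C%C -> `|complex.Re z| < e /\
  `|complex.Im z| < e.
Proof.
case: z => x y /=; rewrite normCE ltcR => h.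
by split; apply: le_lt_trans h; rewrite -sqrtr_sqr ler_wsqrtr // ?lerDl ?lerDr sqr_ge0.
Qed.

Lemma cvg_Re (a : K) : (fun z : K => complex.Re z) @ a --> complex.Re a.
Proof.
apply/(@cvgrPdist_lt _ R _ (nbhs (a : K^o))) => e e0.
apply/nbhs_normP; exists e%:C%C; first by rewrite /= ltcR.
by case: a => a b; case=> x y /= /norm_lt_ReIm[].
Qed.

Lemma cvg_Im (a : K) : (fun z : K => complex.Im z) @ a --> complex.Im a.
Proof.
apply/(@cvgrPdist_lt _ R _ (nbhs (a : K^o))) => e e0.
apply/nbhs_normP; exists e%:C%C; first by rewrite /= ltcR.
by case: a => a b; case=> x y /= /norm_lt_ReIm[].
Qed.

Lemma clog_cvg (a : K) : 0 < complex.Re a -> clog z @[z --> a] --> clog a.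
Proof.
move=> a0; set u := ln (Num.sqrt (complex.Re a ^+ 2 + complex.Im a ^+ 2)).
set v := atan (complex.Im a / complex.Re a).
have cu : ln (Num.sqrt (complex.Re z ^+ 2 + complex.Im z ^+ 2)) @[z --> a] --> u.
  apply: (@cvg_comp _ _ _ (fun z : K => Num.sqrt (complex.Re z ^+ 2 + complex.Im z ^+
    2)) (@ln R)); last first.
    by apply: continuous_ln; rewrite sqrtr_gt0 ltr_wpDr ?sqr_ge0 // exprn_gt0.
  apply: (@cvg_comp _ _ _ (fun z : K => complex.Re z ^+ 2 + complex.Im z ^+ 2)
    (@Num.sqrt R)); last exact: sqrt_continuous.
  have hr : complex.Re z ^+ 2 @[z --> a] --> complex.Re a ^+ 2.
    by under eq_fun do rewrite expr2; rewrite expr2;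
      exact: cvgM (@cvg_Re a) (@cvg_Re a).
  have hi : complex.Im z ^+ 2 @[z --> a] --> complex.Im a ^+ 2.
    by under eq_fun do rewrite expr2; rewrite expr2;
      exact: cvgM (@cvg_Im a) (@cvg_Im a).
  exact: cvgD hr hi.
have cv : atan (complex.Im z / complex.Re z) @[z --> a] --> v.
  apply: (@cvg_comp _ _ _ (fun z : K => complex.Im z / complex.Re z) (@atan R));
    last exact: continuous_atan.
  apply: (cvgM (@cvg_Im a)); apply: cvgV (@cvg_Re a); by rewrite gt_eqF.
apply/(@cvgrPdist_le _ K _ (nbhs (a : K^o))) => e /eps_real[r r0 ->].
have r2 : 0 < r / 2 by rewrite divr_gt0.
move/(@cvgrPdist_le _ R _ (nbhs (a : K^o))) : cu => /(_ _ r2);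
  move/(@cvgrPdist_le _ R _ (nbhs (a : K^o))) : cv => /(_ _ r2).
apply: filterS2 => z hv hu; rewrite /clog -/u -/v.
by apply: norm_le_ReIm; rewrite [r]splitr; apply: lerD.
Qed.

(** The expansion of [cexp] at [clog a] is inverted: if [w] is the increment of [clog], then [h]
    equals [a * w] up to [q * |w|]. *)
Lemma is_derive_clog (a : K) : 0 < complex.Re a -> is_derive (a : K) 1 clog a^-1.
Proof.
move=> a0; have ca := clogK a0.
have an : 0 < `|a| by rewrite -ca normr_gt0 cexp_neq0.
apply: is_derive_le_eps => e e0.
have [r r0 Er] := eps_real (mulr_gt0 e0 an).
have a2 : 0 < `|a| / 2 by rewrite divr_gt0.
(* The bound [|a| / 2] gives [|w| <= 2 / |a| * |h|]; with it the bound by [|a| / 2 * (e * |a|)]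
   makes the error at most [e * |a| * |h|]. *)
pose q : K := `|a| / 2 * (Num.min 1 r)%:C%C.
have q0 : 0 < q by rewrite mulr_gt0 // ltcR lt_min ltr01.
have q1 : q <= `|a| / 2 by rewrite -[leRHS]mulr1 ler_pM2l // lecR ge_min lexx.
have q2 : q <= `|a| / 2 * (e * `|a|) by rewrite ler_pM2l // Er lecR ge_min lexx orbT.
have := is_derive_eps_le (is_derive_cexp (clog a)) q0 => Hexp.
have ca0 : h + a @[h --> (0 : K)] --> a.
  have h0 : (h : K) @[h --> (0 : K)] --> (0 : K) by exact: cvg_id.
  have h1 : (fun _ : K => a) @ (0 : K) --> a
    by exact: (@cvg_cst K^o a K (nbhs (0 : K^o)) _).
  have h2 : h + a @[h --> (0 : K)] --> 0 + a by exact: cvgD h0 h1.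
  by rewrite -[X in _ --> X](add0r a).
have cl1 : clog (h + a) @[h --> (0 : K)] --> clog a.
  exact: (@cvg_comp _ _ _ (fun h : K => h + a) clog _ _ _ ca0 (clog_cvg a0)).
have cl : clog (h + a) - clog a @[h --> (0 : K)] --> (0 : K).
  have h1 : (fun _ : K => clog a) @ (0 : K) --> clog a
    by exact: (@cvg_cst K^o (clog a) K (nbhs (0 : K^o)) _).
  have h2 : clog (h + a) - clog a @[h --> (0 : K)] --> clog a - clog a
    by exact: cvgB cl1 h1.
  by rewrite -[X in _ --> X](subrr (clog a)).
have Hl := cl _ Hexp.
have Hre : \forall h \near (0 : K), 0 < complex.Re (h + a).
  have cr : complex.Re (h + a) @[h --> (0 : K)] --> complex.Re a.
    exact: (@cvg_comp _ _ _ (fun h : K => h + a) (fun z : K => complex.Re z) _ _ _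
      ca0 (@cvg_Re a)).
  have /(@cvgrPdist_lt _ R _ (nbhs (0 : K^o)))/(_ _ a0) := cr; apply: filterS => h.
  by rewrite ltr_norml => /andP[_]; rewrite ltrBlDr ltrDl.
near=> h.
have hr : 0 < complex.Re (h + a) by near: h.
have : `|cexp ((clog (h + a) - clog a) + clog a) - cexp (clog a) - cexp (clog a) *
  (clog (h + a) - clog a)| <= q * `|clog (h + a) - clog a|.
  by near: h.
rewrite subrK ca clogK // addrK; set w := clog (h + a) - clog a => Hw.
have Hw2 : `|w| <= 2 / `|a| * `|h|.
  have : `|a * w| <= `|h| + `|a| / 2 * `|w|.
    have -> : a * w = h - (h - a * w) by ring.
    apply: le_trans (ler_normB _ _) _; rewrite lerD2l.
    by apply: le_trans Hw _; rewrite ler_wpM2r.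
  rewrite normrM -lerBlDr -mulrBl.
  have -> : `|a| - `|a| / 2 = `|a| / 2 by rewrite {1}[`|a|]splitr addrK.
  by rewrite -ler_pdivlMl ?divr_gt0 // invf_div.
have -> : w - a^-1 * h = - (a^-1 * (h - a * w)).
  by rewrite mulrBr mulKf -?normr_gt0 // opprB.
rewrite normrN normrM normfV ler_pdivrMl //.
apply: le_trans Hw _; apply: le_trans (ler_wpM2r (normr_ge0 _) q2) _.
apply: le_trans (ler_wpM2l _ Hw2) _; first by rewrite !mulr_ge0 ?invr_ge0 // ltW.
suff -> : `|a| / 2 * (e * `|a|) * (2 / `|a| * `|h|) = `|a| * (e * `|h|) by [].
by field; rewrite gt_eqF.
Unshelve. all: by end_near. Qed.

End ComplexExponential.

(** * Residues with dense periods *)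

Local Notation poles := ('I_4 * bool)%type.

Section Residues.
Variable R : realType.
Notation K := (C R).
Let r2 : R := Num.sqrt 2.

Lemma sqrt2_power n : exists a b : int, (r2 - 1) ^+ n = a%:~R + b%:~R * r2.
Proof.
have h2 : r2 * r2 = 2 by rewrite -expr2 sqr_sqrtr.
elim: n => [|n [a [b IH]]]; first by exists 1, 0; rewrite expr0 mul0r addr0.
exists (2 * b - a), (a - b); rewrite exprS IH !rmorphB rmorphM /=.
have -> : (r2 - 1) * (a%:~R + b%:~R * r2) = a%:~R * r2 - a%:~R + b%:~R * (r2 * r2) -
  b%:~R * r2 by ring.
by rewrite h2; ring.
Qed.

(** The powers of [sqrt 2 - 1] are positive elements of [Z + Z sqrt 2] tending to 0, and the integer
    multiples of such an element form a net of that mesh. *)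
Lemma sqrt2_dense (x e : R) : 0 < e ->
  exists a b : int, `|a%:~R + b%:~R * r2 - x| < e.
Proof.
move=> e0.
have h2 : r2 * r2 = 2 by rewrite -expr2 sqr_sqrtr.
have r20 : 0 <= r2 by exact: sqrtr_ge0.
have s0 : 0 < r2 - 1 by nra.
have s1 : r2 - 1 < 1 by nra.
have [n Hn] : exists n, (r2 - 1) ^+ n < e.
  have : (fun n => (r2 - 1) ^+ n) @ \oo --> (0 : R) by apply: cvg_expr;
    rewrite gtr0_norm.
  move=> /cvgrPdist_lt/(_ _ e0) [N _ HN]; exists N.
  by have := HN N (leqnn N); rewrite sub0r normrN; apply: le_lt_trans; rewrite ler_norm.
have q0 : 0 < (r2 - 1) ^+ n by rewrite exprn_gt0.
have [a [b Hab]] := sqrt2_power n.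
pose k := Num.floor (x / (r2 - 1) ^+ n).
exists (k * a), (k * b); rewrite !rmorphM /= -mulrA -mulrDr -Hab.
apply: le_lt_trans Hn.
have /andP[h1 h3] := Num.Theory.floor_itv (x / (r2 - 1) ^+ n).
move: h1 h3; rewrite -/k ler_pdivlMr // ltr_pdivrMr // rmorphD /= mulrDl mul1r => h1 h3.
by rewrite ler_norml; apply/andP; split; lra.
Qed.

(** The generators 1, sqrt 2, i, i sqrt 2, in this order. *)
Definition gaussian_sqrt2 (k : 'I_4) : K :=
  ((if odd k then r2 else 1)%:C * (if (2 <= k)%N then 'i else 1))%C.

Lemma gaussian_sqrt2_dense (z e : K) : 0 < e ->
  exists n : 'I_4 -> int, `|\sum_k gaussian_sqrt2 k * (n k)%:~R - z| < e.
Proof.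
move=> /eps_real[r r0 ->]; case: z => x y.
have r4 : 0 < r / 4 by rewrite divr_gt0.
have [a [b ab]] := sqrt2_dense x r4; have [c [d cd]] := sqrt2_dense y r4.
exists (fun k => nth 0 [:: a; b; c; d] k).
rewrite !big_ord_recl big_ord0 /gaussian_sqrt2 /=.
have Ez (j : int) : (j%:~R : K) = Complex (j%:~R) 0
  by rewrite -(rmorph_int (real_complex R)).
rewrite !Ez.
set w := _ - _.
have -> : w = Complex (a%:~R + b%:~R * r2 - x) (c%:~R + d%:~R * r2 - y).
  by apply/eqP; rewrite eq_complex /=; apply/andP; split; apply/eqP; ring.
apply: (@le_lt_trans _ _ (r / 2)%:C%C); last by rewrite ltcR; lra.
by apply: norm_le_ReIm; lra.
Qed.

(* The shift by 2 keeps 1 away from the poles. *)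
Definition pole (l : poles) : K := (2 * l.1 + l.2 + 2)%N%:R.
Definition residue (l : poles) : K := gaussian_sqrt2 l.1.

Lemma residue_neq0 l : residue l != 0.
Proof.
rewrite /residue /gaussian_sqrt2 mulf_neq0 //.
  by case: ifP => _; [rewrite (inj_eq (@complexI R) _ 0) sqrtr_eq0 -ltNge|exact:
    oner_neq0].
by case: ifP => _; rewrite ?oner_neq0 // eq_complex /= oner_eq0 andbF.
Qed.

Lemma pole_inj : injective pole.
Proof.
move=> [k b] [l c] /eqP; rewrite eqr_nat /= => /eqP h.
have kl : k = l :> nat by case: b c h => [] []; lia.
by rewrite (val_inj kl); congr pair; case: b c h => [] []; lia.
Qed.

Lemma norm_pole_sub l l' : l != l' -> 1 <= `|pole l - pole l'|.
Proof.
move=> ll'; rewrite /pole; set a := (_ + 2)%N; set b := (_ + 2)%N.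
have ab : a != b by apply: contra_neq ll' => h; apply: pole_inj; congr _%:R.
wlog h : a b ab / (a < b)%N.
  by move=> W; move: ab; rewrite neq_ltn => /orP[|] h; [|rewrite distrC];
    apply: W => //; rewrite neq_ltn h ?orbT.
rewrite distrC -natrB ?(ltnW h) // normr_nat ler1n subn_gt0 //.
Qed.

Lemma pole_neq1 l : pole l != 1.
Proof. by rewrite /pole -[1]/(1%:R) eqr_nat; apply/eqP; lia. Qed.

Lemma residues_dense (z w e : K) : 0 < e -> exists n : poles -> int,
  `|\sum_l residue l * (n l)%:~R - z| < e /\
  `|\sum_l residue l * pole l * (n l)%:~R - w| < e.
Proof.
move=> e0; have [N HN] := gaussian_sqrt2_dense z e0.
pose g := gaussian_sqrt2.
have [M HM] := gaussian_sqrt2_dense (w - \sum_k g k * (2 * k + 2)%:R * (N k)%:~R) e0.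
(* Each pair of twin poles receives [N k] in total, which settles the first sum; the share [M k] of
   the farther pole adds [g k * M k] to the second. *)
exists (fun l => if l.2 then M l.1 else N l.1 - M l.1).
have sumP (F : poles -> K) : \sum_l F l = \sum_k (F (k, true) + F (k, false)).
  transitivity (\sum_(l : poles) F (l.1, l.2)); first by apply: eq_bigr => -[].
  rewrite -(pair_bigA _ (fun k b => F (k, b))) /=.
  by apply: eq_bigr => k _; rewrite big_bool.
split.
  rewrite sumP; apply: le_lt_trans HN; rewrite le_eqVlt; apply/orP; left; apply/eqP.
  congr (`| _ - _|); apply: eq_bigr => k _; rewrite /residue /= rmorphB /=; ring.
rewrite sumP; apply: le_lt_trans HM; rewrite le_eqVlt; apply/orP; left; apply/eqP.
rewrite opprD opprK addrA addrAC -big_split /=; congr (`| _ - _|);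
  apply: eq_bigr => k _.
by rewrite /residue /pole /= /g rmorphB /= !natrD; ring.
Qed.

End Residues.

(** * Monodromy of the logarithms *)

Section Monodromy.
Variable R : realType.
Notation K := (C R).
Implicit Types (x : K) (lam : poles -> K).

(** An immersed disc in the [x]-line off the poles, with primitives of [dx / (x - p_l)] along it.
    Only the derivatives of the [Lam l] are prescribed, so their constants stay free. *)
Definition log_lift (f f' : K -> K) (Lam : poles -> K -> K) : Prop :=
  forall t : K, `|t| < 1 -> [/\ is_derive t 1 f (f' t), f' t != 0,
    (forall l, f t != pole R l) &
    forall l, is_derive t 1 (Lam l) (f' t / (f t - pole R l))].

Definition log_step (s s' : K * (poles -> K)) : Prop :=
  exists f f' Lam t t', [/\ log_lift f f' Lam, `|t| < 1, `|t'| < 1,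
    s = (f t, Lam^~ t) & s' = (f t', Lam^~ t')].

Inductive log_reach (s : K * (poles -> K)) : K * (poles -> K) -> Prop :=
| log_reach_refl : log_reach s s
| log_reach_step s1 s2 : log_reach s s1 -> log_step s1 s2 -> log_reach s s2.

Lemma log_reach_trans s1 s2 s3 : log_reach s1 s2 -> log_reach s2 s3 -> log_reach s1 s3.
Proof. by move=> h; elim=> // s s' _ IH st; apply: log_reach_step IH st. Qed.

Lemma log_reach1 s s' : log_step s s' -> log_reach s s'.
Proof. by apply: log_reach_step; exact: log_reach_refl. Qed.

Lemma log_step_sym s s' : log_step s s' -> log_step s' s.
Proof. by move=> [f [f' [Lam [t [t' [? ? ? ? ?]]]]]]; exists f, f', Lam, t', t. Qed.

Lemma log_reach_sym s s' : log_reach s s' -> log_reach s' s.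
Proof.
elim=> [|s1 s2 _ IH /log_step_sym st]; first exact: log_reach_refl.
by apply: log_reach_trans IH; exact: log_reach1.
Qed.

(** Continuation commutes with adding constants to the logarithms; this is what makes the monodromy
    act by translations. *)
Lemma log_step_shift mu x lam x' lam' : log_step (x, lam) (x', lam') ->
  log_step (x, fun l => lam l + mu l) (x', fun l => lam' l + mu l).
Proof.
move=> [f [f' [Lam [t [t' [H t1 t'1 [-> ->] [-> ->]]]]]]].
exists f, f', (fun l s => Lam l s + mu l), t, t'; split => // s /H[? ? ? h];
  split => // l.
by apply: is_derive_eq (is_deriveD (h l) (is_derive_cst (mu l) s 1)) _; rewrite addr0.
Qed.

Lemma log_reach_shift mu x lam x' lam' : log_reach (x, lam) (x', lam') ->
  log_reach (x, fun l => lam l + mu l) (x', fun l => lam' l + mu l).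
Proof.
pose sh (s : K * (poles -> K)) := (s.1, fun l => s.2 l + mu l).
suff W s s' : log_reach s s' -> log_reach (sh s) (sh s') by move/W.
elim=> [|[x1 l1] [x2 l2] _ IH st]; first exact: log_reach_refl.
by apply: log_reach_step IH _; exact: log_step_shift.
Qed.

Lemma Re_gt0 (w : K) : `|w - 1| < 1 -> 0 < complex.Re w.
Proof.
rewrite -[ltRHS]/(1%:C%C) => /norm_lt_ReIm[]; case: w => a b /=.
by rewrite ltr_norml => /andP[h _] _; lra.
Qed.

Lemma is_derive_affine (a b t : K) : is_derive t 1 (fun s : K => a + b * s) b.
Proof.
apply: is_derive_le_eps => e e0; apply/near0_complex; exists 1 => // u v _ _.
set h : K := Complex u v.
have -> : a + b * (h + t) - (a + b * t) - b * h = 0 by ring.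
by rewrite normr0 mulr_ge0 // ltW.
Qed.

(** As long as [f] is closer to [c] than [p] is, the quotient is within 1 of 1, hence in the
    half-plane where [clog] is holomorphic. *)
Lemma log_branch (f : K -> K) (t d c p : K) : is_derive t 1 f d -> `|f t - c| < `|c -
  p| ->
  is_derive t 1 (fun s => clog ((f s - p) / (c - p))) (d / (f t - p)).
Proof.
move=> df h; have cp : c - p != 0 by rewrite -normr_gt0; exact: le_lt_trans h.
have w1 : (f t - p) / (c - p) - 1 = (f t - c) / (c - p) by field.
have Rw : 0 < complex.Re ((f t - p) / (c - p)).
  by apply: Re_gt0; rewrite w1 normrM normfV ltr_pdivrMr ?mul1r // normr_gt0.
have w0 : (f t - p) / (c - p) != 0 by apply: contraTneq Rw => ->; rewrite ltxx.
pose g (s : K) := - p / (c - p) + (c - p)^-1 * s.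
have Eg s : g s = (s - p) / (c - p) by rewrite /g; ring.
have dg := is_derive_comp (is_derive_affine (- p / (c - p)) (c - p)^-1 (f t)) df.
have dl : is_derive ((g \o f) t) 1 (@clog R) ((f t - p) / (c - p))^-1.
  by rewrite /= Eg; exact: is_derive_clog.
apply: (@is_derive_fun_eq _ (@clog R \o (g \o f))); last by move=> s /=; rewrite Eg.
apply: is_derive_eq (is_derive_comp dl dg) _.
have fp : f t - p != 0 by apply: contra_neq w0 => ->; rewrite mul0r.
by field; rewrite ?cp ?fp.
Qed.

Lemma log_lift_disc (c r : K) lam : r != 0 -> (forall l, `|r| <= `|c - pole R l|) ->
  log_lift (fun t => c + r * t) (fun=> r)
    (fun l t => lam l + clog ((c + r * t - pole R l) / (c - pole R l))).
Proof.
move=> r0 hr t t1.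
have ht l : `|c + r * t - c| < `|c - pole R l|.
  apply: lt_le_trans (hr l); have -> : c + r * t - c = r * t by ring.
  by rewrite normrM -[ltRHS]mulr1 ltr_pM2l // normr_gt0.
split; [exact: is_derive_affine|by []|move=> l|move=> l].
  apply: contraTneq (ht l) => ->; by rewrite distrC ltxx.
apply: is_derive_eq; first exact: (is_deriveD (is_derive_cst _ _ _) (log_branch
  (is_derive_affine c r t) (ht l))).
by rewrite add0r.
Qed.

Lemma log_step_disc (c r x x' : K) lam : `|x - c| < `|r| -> `|x' - c| < `|r| ->
  (forall l, `|r| <= `|c - pole R l|) -> exists lam', log_step (x, lam) (x', lam').
Proof.
move=> hx hx' hr; have r0 : r != 0 by rewrite -normr_gt0; exact: le_lt_trans hx.
pose Lg l t := clog ((c + r * t - pole R l) / (c - pole R l)).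
pose t := (x - c) / r; pose t' := (x' - c) / r.
have E : c + r * t = x by rewrite /t; field.
have E' : c + r * t' = x' by rewrite /t'; field.
exists (fun l => lam l - Lg l t + Lg l t'), (fun t => c + r * t), (fun=> r),
  (fun l s => lam l - Lg l t + Lg l s), t, t'.
split; [exact: log_lift_disc| | | |by rewrite E'].
- by rewrite normrM normfV ltr_pdivrMr ?mul1r // normr_gt0.
- by rewrite normrM normfV ltr_pdivrMr ?mul1r // normr_gt0.
- by rewrite E; congr pair; apply/funext => l; rewrite subrK.
Qed.

Lemma pole_real l : pole R l = ((2 * l.1 + l.2 + 2)%N%:R)%:C%C.
Proof. by rewrite rmorph_nat. Qed.

(** The poles are real, so the disc with centre [i s r] and radius [r] contains none of them. It
    contains [u + i v] once [u^2 + v^2 < 2 r s v], so a large [r] serves any two points of the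
    half-plane selected by the sign [s]. *)
Lemma log_connect_half (s a b a' b' : R) lam : s ^+ 2 = 1 -> 0 < s * b -> 0 < s * b' ->
  exists lam', log_step (Complex a b, lam) (Complex a' b', lam').
Proof.
move=> s1 sb sb'.
pose r := (a ^+ 2 + b ^+ 2) / (s * b) + (a' ^+ 2 + b' ^+ 2) / (s * b').
have h1 : 0 <= (a ^+ 2 + b ^+ 2) / (s * b)
  by rewrite divr_ge0 ?addr_ge0 ?sqr_ge0 // ltW.
have h2 : 0 <= (a' ^+ 2 + b' ^+ 2) / (s * b')
  by rewrite divr_ge0 ?addr_ge0 ?sqr_ge0 // ltW.
have r0 : 0 <= r by rewrite addr_ge0.
have nr : `|Complex 0 (s * r) : K| = r%:C%C.
  by rewrite normCE expr0n add0r exprMn s1 mul1r sqrtr_sqr ger0_norm.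
have key (u v : R) : 0 < s * v -> (u ^+ 2 + v ^+ 2) / (s * v) <= r ->
    `|Complex u v - Complex 0 (s * r) : K| < r%:C%C.
  move=> sv; rewrite ler_pdivrMr // => hr.
  have -> : Complex u v - Complex 0 (s * r) = Complex u (v - s * r) :> K.
    by apply/eqP; rewrite eq_complex /= subr0 !eqxx.
  rewrite normCE ltcR -[ltRHS]ger0_norm // -sqrtr_sqr ltr_sqrt.
    have v0 : 0 < v ^+ 2 by rewrite exprn_even_gt0 //=; apply: contraTneq sv => ->;
      rewrite mulr0 ltxx.
    have E : (v - s * r) ^+ 2 = v ^+ 2 - 2 * (r * (s * v)) + s ^+ 2 * r ^+ 2 by ring.
    by rewrite E s1; have := sqr_ge0 u; lra.
  have v0 : 0 < v ^+ 2 by rewrite exprn_even_gt0 //=; apply: contraTneq sv => ->;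
    rewrite mulr0 ltxx.
  rewrite exprn_even_gt0 //= gt_eqF // lt_neqAle r0 andbT.
  apply: contraTneq hr => <-; rewrite mul0r -ltNge; have := sqr_ge0 u; lra.
apply: (@log_step_disc (Complex 0 (s * r)) (Complex 0 (s * r))); rewrite ?nr.
- by apply: key => //; rewrite lerDl.
- by apply: key => //; rewrite lerDr.
- move=> l; rewrite pole_real.
  set p : R := _%:R.
  have -> : Complex 0 (s * r) - p%:C%C = Complex (- p) (s * r) :> K.
    by apply/eqP; rewrite eq_complex /= sub0r subr0 !eqxx.
  rewrite normCE lecR -[leLHS]ger0_norm // -sqrtr_sqr ler_wsqrtr //.
  by rewrite exprMn s1 mul1r lerDr sqr_ge0.
Qed.

Lemma pole_dist x : (forall l, x != pole R l) ->
  exists2 d : R, 0 < d & forall l, d%:C%C <= `|x - pole R l|.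
Proof.
move=> hx; pose g l : R := complex.Re `|x - pole R l|.
have Eg l : `|x - pole R l| = (g l)%:C%C.
  by have [r _ E] : exists2 r : R, 0 < r & `|x - pole R l| = r%:C%C
     by [apply: eps_real; rewrite normr_gt0 subr_eq0]; rewrite /g E.
have g0 l : 0 < g l by have := hx l; rewrite -subr_eq0 -normr_gt0 Eg ltcR.
exists (\big[Num.min/1]_l g l); last by move=> l; rewrite Eg lecR bigmin_le.
by elim/big_ind: _ => // a b ha hb; rewrite lt_min ha.
Qed.

(** The real axis is crossed at 1: the poles are at least 2, so the disc of radius 1 around 1 is
    free of them. A real point is pushed upwards inside a small disc. *)
Lemma log_connect_upper x lam : (forall l, x != pole R l) ->
  exists a b lam', 0 < b /\ log_reach (x, lam) (Complex a b, lam').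
Proof.
case: x => a b hx; have [b0|b0|b0] := ltgtP b 0.
- have [lam1 h1] : exists lam', log_step (Complex a b, lam) (Complex 1 (- (1 / 2)),
  lam').
    by apply: (@log_connect_half (-1)); rewrite ?sqrrN ?expr1n //; lra.
  have half_norm (u : R) : u ^+ 2 = 1 -> `|Complex 1 (u / 2) - 1 : K| < `|1 : K|.
    move=> hu; have -> : Complex 1 (u / 2) - 1 = Complex 0 (u / 2) :> K.
      by apply/eqP; rewrite eq_complex /= subrr subr0 !eqxx.
    rewrite normCE normr1 -[ltRHS]/(1%:C%C) ltcR expr0n add0r exprMn hu mul1r sqrtr_sqr.
    by rewrite ger0_norm; lra.
  have [|||lam2 h2] := @log_step_disc 1 1 (Complex 1 (- (1 / 2))) (Complex 1 (1 / 2))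
    lam1.
  + by rewrite -mulNr; apply: half_norm; rewrite sqrrN expr1n.
  + by apply: half_norm; rewrite expr1n.
  + move=> l; rewrite normr1 distrC /pole -[X in _ - X]/(1%:R) -natrB; last by lia.
    by rewrite normr_nat ler1n; lia.
  exists 1, (1 / 2), lam2; split; first lra.
  by apply: log_reach_step h2; exact: log_reach1.
- by exists a, b, lam; split; [|exact: log_reach_refl].
- have [d d0 hd] := pole_dist hx.
  have [|||lam1 h1] := @log_step_disc (Complex a b) d%:C%C (Complex a b) (Complex a
    (b + d / 2)) lam.
  + by rewrite subrr normr0 normr_gt0 (inj_eq (@complexI R) _ 0) gt_eqF.
  + have -> : Complex a (b + d / 2) - Complex a b = Complex 0 (d / 2) :> K.
      by apply/eqP; rewrite eq_complex /= subrr addrAC subrr add0r !eqxx.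
    rewrite !normCE ltcR !expr0n add0r addr0 !sqrtr_sqr !ger0_norm; lra.
  + by move=> l; apply: le_trans (hd l);
    rewrite normCE expr0n addr0 sqrtr_sqr gtr0_norm.
  by exists a, (b + d / 2), lam1; split; [rewrite b0; lra|exact: log_reach1].
Qed.

Lemma log_connect x x' lam : (forall l, x != pole R l) -> (forall l, x' != pole R l) ->
  exists lam', log_reach (x, lam) (x', lam').
Proof.
move=> hx hx'.
have [a [b [lam1 [b0 h1]]]] := log_connect_upper lam hx.
have [a' [b' [lam2 [b'0 h2]]]] := log_connect_upper lam hx'.
have [lam3 h3] : exists lam', log_step (Complex a b, lam1) (Complex a' b', lam').
  by apply: (@log_connect_half 1); rewrite ?expr1n ?mul1r.
have := log_reach_shift (fun l => lam3 l - lam2 l) (log_reach_sym h2).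
have -> : (fun l => lam2 l + (lam3 l - lam2 l)) = lam3 by apply/funext => l;
  rewrite addrC subrK.
move=> h4; exists (fun l => lam l + (lam3 l - lam2 l)).
exact: log_reach_trans (log_reach_step h1 h3) h4.
Qed.

(* The factor 9 exceeds 2 pi, so that s |-> exp (9 s) winds around 0 inside the
   unit disc; the radius exp (- 9) / 2 keeps the loop at distance less than 1 of
   its pole. *)
Definition loop_point l0 : K := pole R l0 + (expR (- 9) / 2)%:C%C.

Definition loop_path l0 (t : K) : K := pole R l0 + (expR (- 9) / 2)%:C%C * cexp (9 * t).

(** Along the loop, [9 * t] is the logarithm of [x - p_l0] up to a constant: it depends on the
    parameter and not only on the point reached. *)
Definition loop_log l0 l (t : K) : K := if l == l0 then 9 * t else
  clog ((loop_path l0 t - pole R l) / (pole R l0 - pole R l)).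

(** Distinct poles are at distance at least 1, so the loop avoids the other poles and a single
    principal branch handles each of their logarithms. *)
Lemma log_lift_loop l0 : log_lift (loop_path l0)
  (fun t => (expR (- 9) / 2)%:C%C * cexp (9 * t) * 9) (loop_log l0).
Proof.
move=> t t1; set e : K := (expR (- 9) / 2)%:C%C; set f := loop_path l0.
have ne : `|e| = e by rewrite ger0_norm // ler0c divr_ge0 // expR_ge0.
have e0 : e != 0 by rewrite (inj_eq (@complexI R) _ 0) mulf_neq0 // ?invr_eq0 ?gt_eqF
  ?expR_gt0.
have ft : f t - pole R l0 = e * cexp (9 * t) by rewrite /f /loop_path -/e addrC addKr.
have small : `|f t - pole R l0| < 1.
  rewrite ft normrM ne norm_cexp -[ltRHS]/(1%:C%C) /e -rmorphM ltcR.
  have h : complex.Re (9 * t) <= 9.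
    have : `|9 * t| < 9%:C%C.
      by rewrite rmorph_nat normrM normr_nat -[ltRHS]mulr1 ltr_pM2l.
    by move=> /norm_lt_ReIm[]; rewrite ltr_norml => /andP[_ /ltW].
  have : expR (- 9) * expR (complex.Re (9 * t)) <= 1.
    by rewrite -expRD expR_le1 addrC subr_le0.
  lra.
have df : is_derive t 1 f (e * cexp (9 * t) * 9).
  pose g (s : K) := 0 + 9 * s.
  have dc : is_derive (g t) 1 (@cexp R) (cexp (9 * t)).
    by rewrite /g add0r; exact: is_derive_cexp.
  have dcg : is_derive t 1 (@cexp R \o g) (cexp (9 * t) * 9).
    exact: is_derive_comp dc (is_derive_affine 0 9 t).
  pose k (s : K) := pole R l0 + e * s.
  have dk : is_derive ((@cexp R \o g) t) 1 k e by exact: is_derive_affine.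
  have <- : k \o (@cexp R \o g) = f by apply/funext => s;
    rewrite /= /f /loop_path -/e /k /g add0r.
  by have := is_derive_comp dk dcg; rewrite mulrA.
have d9 : is_derive t 1 (fun s : K => 9 * s) 9.
  have <- : (fun s : K => 0 + 9 * s) = (fun s => 9 * s) by apply/funext => s;
    rewrite add0r.
  exact: is_derive_affine.
split; first exact: df.
- by rewrite !mulf_neq0 // cexp_neq0.
- move=> l; have [<-|ll] := eqVneq l0 l.
    by rewrite -subr_eq0 ft mulf_neq0 // cexp_neq0.
  apply/eqP => E; have h : `|pole R l0 - pole R l| < 1 by rewrite distrC -E.
  by have := le_lt_trans (norm_pole_sub R ll) h; rewrite ltxx.
- move=> l; rewrite /loop_log; have [->|ll] := eqVneq l l0.
    rewrite ft mulrAC mulfV ?mul1r; last by rewrite mulf_neq0 // cexp_neq0.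
    exact: d9.
  apply: log_branch => //; apply: lt_le_trans small _.
  by rewrite norm_pole_sub // eq_sym.
Qed.

Definition two_pi_i : K := Complex 0 (pi *+ 2).

Lemma two_pi_i_lt9 : `|two_pi_i / 9| < 1.
Proof.
rewrite normrM normfV normr_nat ltr_pdivrMr ?ltr0n // mul1r -[ltRHS](rmorph_nat
  (real_complex R)).
rewrite normCE ltcR expr0n add0r sqrtr_sqr ger0_norm; last by apply: mulrn_wge0;
  exact: pi_ge0.
by have := @pihalf_lt2 R; rewrite [pi *+ 2]mulr2n; lra.
Qed.

(** The loop based at [loop_point l0] is conjugated by a path from [x]; shift invariance makes the
    way back undo exactly what the way out did. *)
Lemma log_loop x lam l0 : (forall l, x != pole R l) ->
  log_reach (x, lam) (x, fun l => lam l + (l == l0)%:R * two_pi_i).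
Proof.
move=> hx.
have t1 := two_pi_i_lt9.
have t0 : `|0 : K| < 1 by rewrite normr0.
have E : 9 * (two_pi_i / 9) = two_pi_i by field.
have P0 : loop_path l0 0 = loop_point l0 by rewrite /loop_path mulr0 cexp0 mulr1.
have P1 : loop_path l0 (two_pi_i / 9) = loop_point l0
  by rewrite /loop_path E cexp_2pi mulr1.
pose mu0 l := loop_log l0 l 0; pose mu1 l := loop_log l0 l (two_pi_i / 9).
have L0 : log_step (loop_point l0, mu0) (loop_point l0, mu1).
  exists (loop_path l0), (fun t => (expR (- 9) / 2)%:C%C * cexp (9 * t) * 9),
    (loop_log l0), 0, (two_pi_i / 9).
  by split; [exact: log_lift_loop|by []|by []|rewrite P0|rewrite P1].
have hL : forall l, loop_point l0 != pole R l.
  by move=> l; rewrite -P0; have [_ _ /(_ l)] := log_lift_loop l0 t0.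
have [lam1 h1] := log_connect lam hx hL.
have h2 := log_reach_shift (fun l => lam1 l - mu0 l) (log_reach1 L0).
have E0 : (fun l => mu0 l + (lam1 l - mu0 l)) = lam1 by apply/funext => l;
  rewrite addrC subrK.
(* For [l] other than [l0] the value of [loop_log] depends only on the point of the path, which is
   the same at both ends. *)
have E1 : (fun l => mu1 l + (lam1 l - mu0 l)) = (fun l => lam1 l + (l == l0)%:R *
  two_pi_i).
  by apply/funext => l; rewrite /mu0 /mu1 /loop_log P0 P1 E; case: ifP => _ /=; ring.
rewrite E0 E1 in h2.
have h3 := log_reach_shift (fun l => (l == l0)%:R * two_pi_i) (log_reach_sym h1).
exact: log_reach_trans h1 (log_reach_trans h2 h3).
Qed.

(** Translations add up, and a loop run backwards accounts for a negative multiplicity. *)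
Lemma log_loops x lam (n : poles -> int) : (forall l, x != pole R l) ->
  log_reach (x, lam) (x, fun l => lam l + (n l)%:~R * two_pi_i).
Proof.
move=> hx.
have N1 l0 (k : nat) mu : log_reach (x, mu) (x, fun l => mu l + (l == l0)%:R * (k%:R
  * two_pi_i)).
  elim: k => [|k IH].
    have -> : (fun l => mu l + (l == l0)%:R * (0%:R * two_pi_i)) = mu
      by apply/funext => l; ring.
    exact: log_reach_refl.
  apply: log_reach_trans IH _.
  have := log_loop (fun l => mu l + (l == l0)%:R * (k%:R * two_pi_i)) l0 hx.
  congr log_reach; congr pair; apply/funext => l; rewrite -[k.+1]addn1 natrD; ring.
have Z1 l0 (k : int) mu : log_reach (x, mu) (x, fun l => mu l + (l == l0)%:R * (k%:~R
  * two_pi_i)).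
  case: k => k; first exact: N1.
  have := log_reach_sym (N1 l0 k.+1 (fun l => mu l + (l == l0)%:R * ((Negz k)%:~R *
    two_pi_i))).
  congr log_reach; congr pair; apply/funext => l.
  by rewrite NegzE rmorphN /=; ring.
suff W (r : seq poles) mu : uniq r -> log_reach (x, mu)
    (x, fun l => mu l + (l \in r)%:R * ((n l)%:~R * two_pi_i)).
  have := W (enum {: poles}) lam (enum_uniq _).
  by congr log_reach; congr pair; apply/funext => l; rewrite mem_enum mul1r.
elim: r mu => [|l0 r IH] mu.
  move=> _; have -> : (fun l => mu l + (l \in [::])%:R * ((n l)%:~R * two_pi_i)) = mu.
    by apply/funext => l; rewrite mul0r addr0.
  exact: log_reach_refl.
move=> /= /andP[l0r /IH{}IH]; apply: log_reach_trans (IH mu) _.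
have := Z1 l0 (n l0) (fun l => mu l + (l \in r)%:R * ((n l)%:~R * two_pi_i)).
congr log_reach; congr pair; apply/funext => l; rewrite inE.
by have [->|_] := eqVneq l l0; rewrite ?(negbTE l0r) /=; ring.
Qed.

End Monodromy.

(** * The distribution *)

Section Differentiability.
Variables (K : numFieldType) (U : normedModType K).
Implicit Types f g : U -> K.

Lemma differentiable_bigsum (I : Type) (r : seq I) (P : pred I) (V : normedModType K)
  (f : I -> U -> V) (v : U) :
  (forall i, differentiable (f i) v) -> differentiable (fun u => \sum_(i <- r | P i)
    f i u) v.
Proof.
move=> h; elim: r => [|i r IH].
  by under eq_fun do rewrite big_nil; exact: differentiable_cst.
under eq_fun do rewrite big_cons; case: (P i) => //.
exact: (differentiableD (h i) IH).
Qed.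

Lemma differentiable_bigprod (I : Type) (r : seq I) (P : pred I) (f : I -> U -> K) (v
  : U) :
  (forall i, differentiable (f i) v) -> differentiable (fun u => \prod_(i <- r | P i)
    f i u) v.
Proof.
move=> h; elim: r => [|i r IH].
  by under eq_fun do rewrite big_nil; exact: differentiable_cst.
under eq_fun do rewrite big_cons; case: (P i) => //.
exact: (differentiableM (h i) IH).
Qed.

Lemma differentiable_rV d (f : U -> 'rV[K]_d) (v : U) :
  (forall k, differentiable (fun u => f u 0 k : K) v) -> differentiable f v.
Proof.
move=> h.
have -> : f = (fun u => \sum_k f u 0 k *: delta_mx 0 k) by apply/funext => u;
  rewrite -row_sum_delta.
by apply: differentiable_bigsum => k; apply: differentiableZl.
Qed.

Lemma open_neq0_fun f : (forall v, differentiable f v) -> open [set v | f v != 0].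
Proof.
move=> h; have /continuousP c : continuous f.
  by move=> v; apply: differentiable_continuous.
exact: (c [set z | z != 0]) (@open_neq0 K).
Qed.

End Differentiability.

(** * Homogeneous coordinates and the polynomials [Q_j], [P_j] *)

Section Coordinates.
Variables (R : realType) (m : nat).
Notation K := (C R).
Notation V := 'rV[C R]_(2 * m).+2.

Definition ix (j : 'I_m) : 'I_(2 * m).+2 := lift ord0 (inord (2 * j)).
Definition iy (j : 'I_m) : 'I_(2 * m).+2 := lift ord0 (inord (2 * j).+1).
Definition iz : 'I_(2 * m).+2 := lift ord0 ord_max.

Lemma val_ix j : ix j = (2 * j).+1 :> nat.
Proof. by have := ltn_ord j; rewrite /ix /= => ?; rewrite /bump /= inordK; lia. Qed.
Lemma val_iy j : iy j = (2 * j).+2 :> nat.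
Proof. by have := ltn_ord j; rewrite /iy /= => ?; rewrite /bump /= inordK; lia. Qed.
Lemma val_iz : iz = (2 * m).+1 :> nat.
Proof. by rewrite /iz /= /bump /=; lia. Qed.

Lemma index_eqE :
  (forall j k, (ix j == ix k) = (j == k)) * (forall j k, (iy j == iy k) = (j == k)) *
  (forall j k, (ix j == iy k) = false) * (forall j k, (iy j == ix k) = false) *
  (forall j, (ix j == iz) = false) * (forall j, (iz == ix j) = false) *
  (forall j, (iy j == iz) = false) * (forall j, (iz == iy j) = false) *
  (forall j, (ord0 == ix j) = false) * (forall j, (ix j == ord0) = false) *
  (forall j, (ord0 == iy j) = false) * (forall j, (iy j == ord0) = false) *
  ((ord0 == iz) = false) * ((iz == ord0) = false).
Proof.
have F (a b : 'I_(2 * m).+2) : (a : nat) <> b -> (a == b) = false.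
  by move=> h; apply/eqP => E; apply: h; rewrite E.
have L := fun j : 'I_m => ltn_ord j.
(repeat apply: pair); last 12 first.
- by move=> j k; apply: F; rewrite val_ix val_iy; lia.
- by move=> j k; apply: F; rewrite val_ix val_iy; lia.
- by move=> j; apply: F; rewrite val_ix val_iz; have := L j; lia.
- by move=> j; apply: F; rewrite val_ix val_iz; have := L j; lia.
- by move=> j; apply: F; rewrite val_iy val_iz; have := L j; lia.
- by move=> j; apply: F; rewrite val_iy val_iz; have := L j; lia.
- by move=> j; apply: F; rewrite val_ix.
- by move=> j; apply: F; rewrite val_ix.
- by move=> j; apply: F; rewrite val_iy.
- by move=> j; apply: F; rewrite val_iy.
- by apply: F; rewrite val_iz.
- by apply: F; rewrite val_iz.
- move=> j k; apply/eqP/eqP => [/(congr1 (@nat_of_ord _))|-> //].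
  by rewrite !val_ix => h; apply: val_inj => /=; lia.
- move=> j k; apply/eqP/eqP => [/(congr1 (@nat_of_ord _))|-> //].
  by rewrite !val_iy => h; apply: val_inj => /=; lia.
Qed.

Lemma index_cases (P : 'I_(2 * m).+2 -> Prop) :
  P ord0 -> (forall j, P (ix j)) -> (forall j, P (iy j)) -> P iz -> forall k, P k.
Proof.
move=> P0 Px Py Pz k.
have [k0|k0] := eqVneq (k : nat) 0; first by have -> : k = ord0 by exact: val_inj.
have [kz|kz] := eqVneq (k : nat) (2 * m).+1.
  by have -> : k = iz by apply: val_inj; rewrite [LHS]kz [RHS]val_iz.
have kl := ltn_ord k.
have hj : (k.-1./2 < m)%N by lia.
have [ko|ke] := boolP (odd k).
  have -> : k = ix (Ordinal hj); last exact: Px.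
  by apply: val_inj; rewrite [RHS]val_ix /=; lia.
have -> : k = iy (Ordinal hj); last exact: Py.
by apply: val_inj; rewrite [RHS]val_iy /=; lia.
Qed.

Definition vec (t : K) (x y : 'I_m -> K) (z : K) : V :=
  t *: delta_mx 0 ord0 + \sum_j x j *: delta_mx 0 (ix j)
  + \sum_j y j *: delta_mx 0 (iy j) + z *: delta_mx 0 iz.

Lemma vecE t x y z :
  (vec t x y z 0 ord0 = t) * (forall j, vec t x y z 0 (ix j) = x j) *
  (forall j, vec t x y z 0 (iy j) = y j) * (vec t x y z 0 iz = z).
Proof.
have S0 (f : 'I_m -> K) (g : 'I_m -> 'I_(2 * m).+2) k : (forall j, (k == g j) =
  false) ->
    \sum_j (f j *: (delta_mx 0 (g j) : V)) 0 k = 0.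
  by move=> h; apply: big1 => j _; rewrite !mxE h andbF mulr0.
have S1 (f : 'I_m -> K) (g : 'I_m -> 'I_(2 * m).+2) k : (forall i j, (g i == g j) =
  (i == j)) ->
    \sum_j (f j *: (delta_mx 0 (g j) : V)) 0 (g k) = f k.
  move=> h; rewrite (bigD1 k) //= big1 ?addr0 => [|j jk].
    by rewrite !mxE h !eqxx mulr1.
  by rewrite !mxE h eq_sym (negbTE jk) andbF mulr0.
have e := index_eqE.
(repeat apply: pair) => [|j|j|]; rewrite /vec !mxE !summxE !eqxx /=.
- rewrite (S0 x ix) ?(S0 y iy); try (by move=> j; rewrite e).
  by rewrite ?e /= ?mulr1 ?mulr0 ?addr0 ?add0r.
- rewrite (S1 x ix) ?(S0 y iy); try (by move=> *; rewrite e).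
  by rewrite ?e /= ?mulr1 ?mulr0 ?addr0 ?add0r.
- rewrite (S0 x ix) ?(S1 y iy); try (by move=> *; rewrite e).
  by rewrite ?e /= ?mulr1 ?mulr0 ?addr0 ?add0r.
- rewrite (S0 x ix) ?(S0 y iy); try (by move=> *; rewrite e).
  by rewrite ?e /= ?mulr1 ?mulr0 ?addr0 ?add0r.
Qed.

Lemma vec_ext (u w : V) : u 0 ord0 = w 0 ord0 -> (forall j, u 0 (ix j) = w 0 (ix j)) ->
  (forall j, u 0 (iy j) = w 0 (iy j)) -> u 0 iz = w 0 iz -> u = w.
Proof. by move=> h0 hx hy hz; apply/rowP; exact: index_cases. Qed.

Lemma omE (v w : V) : om v w = v 0 ord0 * w 0 iz - w 0 ord0 * v 0 iz
  - \sum_j (v 0 (iy j) * w 0 (ix j) - v 0 (ix j) * w 0 (iy j)).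
Proof.
rewrite /om /coord_x /coord_y /coord_z !mxE; congr (_ - _).
by apply: eq_bigr => j _; rewrite !mxE.
Qed.

(* The homogenizations of Q(x) = \prod_l (x - p_l) and Q(x) rho(x), in the
   variable x = X_j / v_0. *)
Definition qpol (j : 'I_m) (v : V) : K := \prod_l (v 0 (ix j) - pole R l * v 0 ord0).
Definition ppol (j : 'I_m) (v : V) : K := v 0 ord0 *
  \sum_l (residue R l / 2 * \prod_(k | k != l) (v 0 (ix j) - pole R k * v 0 ord0)).

Definition deg := #|{: poles}|.

Lemma qpolZ j c v : qpol j (c *: v) = c ^+ deg * qpol j v.
Proof.
rewrite /qpol /deg -(prodr_const {: poles}) -big_split /=; apply: eq_bigr => l _;
  rewrite !mxE; ring.
Qed.

Lemma ppolZ j c v : ppol j (c *: v) = c ^+ deg * ppol j v.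
Proof.
have dE : deg = deg.-1.+1 by rewrite /deg card_prod card_ord card_bool.
have E l : \prod_(k | k != l) ((c *: v) 0 (ix j) - pole R k * (c *: v) 0 ord0) =
    c ^+ deg.-1 * \prod_(k | k != l) (v 0 (ix j) - pole R k * v 0 ord0).
  have -> : deg.-1 = #|predC1 l| by rewrite cardC1.
  rewrite -(prodr_const (predC1 l)) -big_split /=; apply: eq_bigr => k _;
    rewrite !mxE; ring.
rewrite /ppol; under eq_bigr do rewrite E mulrCA.
by rewrite -mulr_sumr mxE dE exprS; ring.
Qed.

Lemma qpol_dep j (v w : V) : v 0 ord0 = w 0 ord0 -> v 0 (ix j) = w 0 (ix j) -> qpol j
  v = qpol j w.
Proof. by rewrite /qpol => -> ->. Qed.

Lemma ppol_dep j (v w : V) : v 0 ord0 = w 0 ord0 -> v 0 (ix j) = w 0 (ix j) -> ppol j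
  v = ppol j w.
Proof. by rewrite /ppol => -> ->. Qed.

Lemma differentiable_coordV (k : 'I_(2 * m).+2) (v : V) : differentiable (fun v : V
  => v 0 k : K) v.
Proof. exact: differentiable_coord. Qed.

Lemma differentiable_factor j p (v : V) :
  differentiable (fun v : V => v 0 (ix j) - p * v 0 ord0 : K) v.
Proof.
apply: differentiableB; first exact: differentiable_coordV.
by apply: differentiableM; [exact: differentiable_cst|exact: differentiable_coordV].
Qed.

Lemma differentiable_qpol j (v : V) : differentiable (qpol j) v.
Proof. by apply: differentiable_bigprod => l; exact: differentiable_factor. Qed.

Lemma differentiable_ppol j (v : V) : differentiable (ppol j) v.
Proof.
apply: differentiableM; first exact: differentiable_coordV.
apply: differentiable_bigsum => l; apply: differentiableM;
  first exact: differentiable_cst.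
by apply: differentiable_bigprod => k; exact: differentiable_factor.
Qed.

Lemma ppol0 j (v : V) : v 0 ord0 = 0 -> ppol j v = 0.
Proof. by rewrite /ppol => ->; rewrite mul0r. Qed.

Lemma qpol0 j (v : V) : v 0 ord0 = 0 -> qpol j v = v 0 (ix j) ^+ deg.
Proof.
rewrite /qpol /deg => ->; rewrite -(prodr_const {: poles}); apply: eq_bigr => l _.
by rewrite mulr0 subr0.
Qed.

(** At a root [p_l] of [Q_j] only the summand of index [l] survives in [P_j]; it is nonzero because
    the poles are distinct and the residues nonzero. *)
Lemma pqpol_neq0 j (v : V) : v 0 ord0 != 0 -> qpol j v = 0 -> ppol j v != 0.
Proof.
move=> v0 /eqP; rewrite prodf_seq_eq0 => /hasP[l _ /=]; rewrite subr_eq0 => /eqP El.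
rewrite /ppol (bigD1 l) //= [X in _ * (_ + X)]big1 => [|k kl]; last first.
  by rewrite (bigD1 l) 1?eq_sym //= El subrr mul0r mulr0.
rewrite addr0; apply: mulf_neq0 => //; apply: mulf_neq0.
  by rewrite mulf_neq0 ?invr_eq0 ?residue_neq0 ?pnatr_eq0.
apply/prodf_neq0 => k kl; rewrite El -mulrBl mulf_neq0 // subr_eq0.
by rewrite (inj_eq (@pole_inj R)) eq_sym.
Qed.

Lemma pqpol_affine j (v : V) : v 0 ord0 = 1 -> (forall l, v 0 (ix j) != pole R l) ->
  ppol j v = qpol j v * \sum_l (residue R l / 2 / (v 0 (ix j) - pole R l)).
Proof.
move=> v1 hx; rewrite /ppol v1 mul1r mulr_sumr; apply: eq_bigr => l _.
rewrite [qpol j v](bigD1 l) //= v1 mulr1.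
have := hx l; set P := \prod_(_ | _) _; move: (pole R l) => p hp.
by field; rewrite subr_eq0.
Qed.

End Coordinates.

(** * The plane attached to a homogeneous vector *)

Section Plane.
Variables (R : realType) (m : nat).
Notation K := (C R).
Notation V := 'rV[C R]_(2 * m).+2.
Implicit Types (u v w : V) (a b : option 'I_m) (kap : 'I_m.+1 -> K).

(* The forms du_0 and Q_j dY_j - P_j dX_j cut out the span of the vectors
   Q_j d/dX_j + P_j d/dY_j and d/dZ, also where v_0 = 0; the forms theta, the
   minors of tau v u against tau v v, cut out the sum of this span and the line
   of v. *)
Definition tau a v u : K :=
  if a is Some j then qpol j v * u 0 (iy j) - ppol j v * u 0 (ix j) else u 0 ord0.

Definition theta (ab : option 'I_m * option 'I_m) v u : K^o :=
  tau ab.1 v u * tau ab.2 v v - tau ab.2 v u * tau ab.1 v v.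

Lemma tau_lin a v c u w : tau a v (c *: u + w) = c * tau a v u + tau a v w.
Proof. by case: a => [j|]; rewrite /tau !mxE //; ring. Qed.

Lemma theta_lin ab v : linear (theta ab v).
Proof. by move=> c u w; rewrite /theta !tau_lin /GRing.scale /=; ring. Qed.
HB.instance Definition _ ab v := GRing.isLinear.Build _ _ _ _ (theta ab v) (theta_lin
  ab v).

Definition plane v : {vspace V} :=
  (lker (linfun (om v)) :&: \bigcap_ab lker (linfun (theta ab v)))%VS.

Lemma mem_plane v u : u \in plane v <->
  om v u = 0 /\ forall a b, tau a v u * tau b v v = tau b v u * tau a v v.
Proof.
rewrite memv_cap memv_ker lfunE /=; split.
  move=> /andP[/eqP h  hb]; split=> // a b.
  move: hb; rewrite memvE => /subv_bigcapP/(_ (a, b) isT).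
  by rewrite -memvE memv_ker lfunE /= subr_eq0 => /eqP.
move=> [-> h]; rewrite eqxx memvE; apply/subv_bigcapP => -[a b] _.
by rewrite -memvE memv_ker lfunE /= subr_eq0; apply/eqP.
Qed.

Definition tau_deg a := if a is Some _ then deg else 0%N.

Lemma tauZ a c v u : tau a (c *: v) u = c ^+ tau_deg a * tau a v u.
Proof. by case: a => [j|] /=; rewrite ?qpolZ ?ppolZ ?mul1r //; ring. Qed.

Lemma tauZr a v c u : tau a v (c *: u) = c * tau a v u.
Proof. by have := tau_lin a v c u 0; rewrite addr0 => ->; case: a => [j|];
  rewrite /tau !mxE; ring. Qed.

Lemma mem_planeZ c v u : c != 0 -> (u \in plane (c *: v)) = (u \in plane v).
Proof.
move=> c0; apply/idP/idP => /mem_plane[h1 h2]; apply/mem_plane; split.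
- by apply/eqP; rewrite -(om_eq0Zl v u c0) h1.
- move=> a b; have := h2 a b; rewrite !tauZ !tauZr => h.
  apply: (@mulfI _ (c * c ^+ tau_deg a * c ^+ tau_deg b)).
    by rewrite !mulf_neq0 // expf_neq0.
  by apply: etrans (etrans _ h) _; ring.
- by apply/eqP; rewrite (om_eq0Zl v u c0) h1.
- move=> a b; rewrite !tauZ !tauZr.
  transitivity (c * c ^+ tau_deg a * c ^+ tau_deg b * (tau a v u * tau b v v));
    first by ring.
  by rewrite h2; ring.
Qed.

Lemma self_in_plane v : v \in plane v.
Proof. by apply/mem_plane; split=> [|a b]; [exact: om_nn|exact: mulrC]. Qed.

(** Equations of the singular set: multiplying each [Y_k] by all the [X_j] encodes the alternative
    between some [X_j = 0] and all [Y_k = 0]. *)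
Definition regularity a v : K :=
  if a is Some k then (\prod_j v 0 (ix j)) * v 0 (iy k) else v 0 ord0.

Definition regular v := [exists a, regularity a v != 0].

(** [P_j] and [Q_j] have no common zero in the affine part, and at infinity [Q_j] is a power of
    [X_j]. *)
Lemma regular_pq v j : regular v -> ppol j v = 0 -> qpol j v != 0.
Proof.
move=> /existsP[a]; have [v0|v0] := eqVneq (v 0 ord0) 0; last first.
  by move=> _ p0; apply/eqP => /(pqpol_neq0 v0); rewrite p0 eqxx.
case: a => [k|] /=; last by rewrite v0 eqxx.
rewrite mulf_eq0 negb_or => /andP[/prodf_neq0 h _] _.
by rewrite qpol0 // expf_neq0 // h.
Qed.

(** Transversality of [v] to the span described above. At infinity [tau (Some k) v v] is a power of
    [X_k] times [Y_k], so this is where some [Y_k] must be nonzero. *)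
Lemma regular_tau v : regular v -> exists a, tau a v v != 0.
Proof.
move=> rv; have := rv; move=> /existsP[a]; have [v0|v0] := eqVneq (v 0 ord0) 0;
  last by exists None.
case: a => [k|] /=; last by rewrite v0 eqxx.
rewrite mulf_eq0 negb_or => /andP[_ hk]; exists (Some k).
have p0 : ppol k v = 0 by exact: ppol0.
by rewrite /tau p0 mul0r subr0 mulf_neq0 // regular_pq.
Qed.

(** The combination, with coefficients [kap], of [d/dZ] (index 0) and of the vectors
    [Q_j d/dX_j + P_j d/dY_j]. *)
Definition slide kap v : V :=
  vec 0 (fun j => kap (lift ord0 j) * qpol j v) (fun j => kap (lift ord0 j) * ppol j
    v) (kap ord0).

(** The values of [om v] on the vectors combined in [slide]. *)
Definition phi (k : 'I_m.+1) v : K :=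
  if unlift ord0 k is Some j then - tau (Some j) v v else v 0 ord0.

Lemma tau_slide a kap v : tau a v (slide kap v) = 0.
Proof. by case: a => [j|]; rewrite /tau /slide !vecE //; ring. Qed.

Lemma om_slide kap v : om v (slide kap v) = \sum_k kap k * phi k v.
Proof.
rewrite omE /slide !vecE big_ord_recl /phi unlift_none mul0r subr0 mulrC; congr (_ + _).
rewrite -sumrN; apply: eq_bigr => j _; rewrite !vecE liftK /tau; ring.
Qed.

Lemma regular_phi v : regular v -> exists k, phi k v != 0.
Proof.
move=> /regular_tau[[j|] h]; last by exists ord0; rewrite /phi unlift_none.
by exists (lift ord0 j); rewrite /phi liftK oppr_eq0.
Qed.

Lemma slide_in_plane kap v : \sum_k kap k * phi k v = 0 -> slide kap v \in plane v.
Proof.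
move=> h; apply/mem_plane; split=> [|a b]; first by rewrite om_slide.
by rewrite !tau_slide !mul0r.
Qed.

(** Subtracting the multiple [c] of [v] makes every [tau] vanish. Each pair of coordinates is then
    proportional to [(Q_j, P_j)], and the factor is read off from whichever of the two is
    nonzero. *)
Lemma mem_plane_slide v u : regular v -> u \in plane v ->
  exists c kap, u = c *: v + slide kap v /\ \sum_k kap k * phi k v = 0.
Proof.
move=> rv /mem_plane[hom htau]; have [a ha] := regular_tau rv.
pose c := tau a v u / tau a v v; pose w := u - c *: v.
have tw b : tau b v w = 0.
  have -> : w = (- c) *: v + u by rewrite scaleNr addrC.
  rewrite tau_lin /c; apply: (mulIf ha); rewrite mul0r mulrDl (htau b a).
  by field.
pose kap (k : 'I_m.+1) := if unlift ord0 k is Some j then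
   (if qpol j v == 0 then w 0 (iy j) / ppol j v else w 0 (ix j) / qpol j v) else w 0
     (iz m).
have wE : w = slide kap v.
  apply: vec_ext => [|j|j|]; rewrite /slide !vecE /kap ?liftK ?unlift_none //.
  - exact: (tw None).
  - have := tw (Some j); rewrite /tau; case: eqP => [q0|/eqP q0]; last by rewrite divfK.
    rewrite q0 mul0r mulr0 sub0r => /eqP; rewrite oppr_eq0 mulf_eq0.
    case/orP => /eqP // p0; by have := regular_pq rv p0; rewrite q0 eqxx.
  - have := tw (Some j); rewrite /tau => /eqP; rewrite subr_eq0 => /eqP h.
    case: eqP => [q0|/eqP q0]; last by apply: (mulfI q0); rewrite h; field.
    rewrite divfK //; apply/eqP => p0; by have := regular_pq rv p0; rewrite q0 eqxx.
exists c, kap; rewrite -wE; split; first by rewrite /w addrC subrK.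
rewrite -om_slide -wE /w linearB /= hom (omZr v c v) om_nn mulr0 subr0 //.
Qed.

Lemma slide_eq0 v c kap : regular v -> c *: v + slide kap v = 0 -> c = 0 /\ forall k,
  kap k = 0.
Proof.
move=> rv h; have [a ha] := regular_tau rv.
have c0 : c = 0.
  have := congr1 (tau a v) h; rewrite tau_lin tau_slide addr0.
  have -> : tau a v 0 = 0 by case: (a) => [j|]; rewrite /tau !mxE; ring.
  by move=> /eqP; rewrite mulf_eq0 (negbTE ha) orbF => /eqP.
split=> // k; move: h; rewrite c0 scale0r add0r => h.
case: (unliftP ord0 k) => [j|] ->; last first.
  by have := congr1 (fun w : V => w 0 (iz m)) h; rewrite /slide vecE mxE.
have := congr1 (fun w : V => w 0 (ix j)) h; have := congr1 (fun w : V => w 0 (iy j)) h.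
rewrite /slide !vecE !mxE => hp /eqP; rewrite mulf_eq0 => /orP[/eqP //|/eqP q0].
move/eqP: hp; rewrite mulf_eq0 => /orP[/eqP //|/eqP p0].
by have := regular_pq rv p0; rewrite q0 eqxx.
Qed.

End Plane.

(** * Passage between affine charts and homogeneous coordinates *)

Section ChartLift.
Variables (R : realType) (n : nat).
Notation K := (C R).
Implicit Types (i : 'I_n.+1) (x u : 'rV[C R]_n) (v w : 'rV[C R]_n.+1).

Lemma insert_entryE i c u : (insert_entry i c u 0 i = c) *
  (forall k, insert_entry i c u 0 (lift i k) = u 0 k).
Proof. by split=> [|k]; rewrite mxE ?unlift_none ?liftK. Qed.

Lemma differentiable_insert_entry i c x : differentiable (@insert_entry R n i c) x.
Proof.
apply: differentiable_rV => k; case: (unliftP i k) => [l|] ->.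
  have -> : (fun u => insert_entry i c u 0 (lift i l)) = (fun u : 'rV[C R]_n => u 0 l).
    by apply/funext => u; rewrite insert_entryE.
  exact: differentiable_coord.
have -> : (fun u => insert_entry i c u 0 i) = cst c.
  by apply/funext => u; rewrite insert_entryE.
exact: differentiable_cst.
Qed.

(* The isomorphism C^(n+1)/<v> -> C^n induced by the i-th chart when v i = 1. *)
Definition project i v w : 'rV[C R]_n := \row_k (w 0 (lift i k) - w 0 i * v 0 (lift i
  k)).

Lemma projectD i v a w w' : project i v (a *: w + w') = a *: project i v w + project
  i v w'.
Proof. by apply/rowP => k; rewrite !mxE; ring. Qed.

Lemma project_sum i v (I : finType) (f : I -> K) (w : I -> 'rV[C R]_n.+1) :
  project i v (\sum_a f a *: w a) = \sum_a f a *: project i v (w a).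
Proof.
apply: (big_ind2 (fun w s => project i v w = s)) => [|x1 x2 y1 y2 <- <-|a _].
- by apply/rowP => k; rewrite !mxE mul0r subr0.
- by have := projectD i v 1 x1 y1; rewrite !scale1r.
- by rewrite -[_ *: w a]addr0 projectD [project i v 0](_ : _ = 0) ?addr0 //;
  apply/rowP => k; rewrite !mxE mul0r subr0.
Qed.

Lemma insert_project i x w :
  insert_entry i 0 (project i (insert_entry i 1 x) w) = w - w 0 i *: insert_entry i 1 x.
Proof.
apply/rowP => k; rewrite [in RHS]mxE [in RHS]mxE; case: (unliftP i k) => [l|] ->.
  by rewrite !insert_entryE mxE [in RHS]mxE !insert_entryE.
by rewrite insert_entryE mxE insert_entryE mulr1 subrr.
Qed.

Lemma project_insert i v u : project i v (insert_entry i 0 u) = u.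
Proof. by apply/rowP => k; rewrite mxE !insert_entryE mul0r subr0. Qed.

Lemma project_self i x : project i (insert_entry i 1 x) (insert_entry i 1 x) = 0.
Proof. by apply/rowP => k; rewrite !mxE unlift_none mul1r subrr. Qed.

Lemma project_eq0 i v w : v 0 i = 1 -> project i v w = 0 -> w = w 0 i *: v.
Proof.
move=> vi /rowP h; apply/rowP => k; rewrite mxE; case: (unliftP i k) => [l|] ->.
  by have := h l; rewrite !mxE => /eqP; rewrite subr_eq0 => /eqP.
by rewrite vi mulr1.
Qed.

Lemma differentiable_project (U : normedModType K) i (v w : U -> 'rV[C R]_n.+1) (t :
  U) :
  differentiable v t -> differentiable w t -> differentiable (fun s => project i (v
    s) (w s)) t.
Proof.
move=> dv dw; apply: differentiable_rV => k; under eq_fun do rewrite mxE.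
have dc (f : U -> 'rV[C R]_n.+1) j : differentiable f t -> differentiable (fun s => f
  s 0 j : K) t.
  by move=> df; exact: (differentiable_comp df (differentiable_coord _ _ _)).
by apply: differentiableB; [exact: dc|apply: differentiableM; exact: dc].
Qed.

End ChartLift.

Section Distribution.
Variables (R : realType) (m : nat).
Notation K := (C R).
Notation n := (2 * m).+1.
Notation V := 'rV[C R]_(2 * m).+2.

Definition slide_distribution : tangent_distribution R n := fun p => plane (homog p).

Definition irregular_points : set (CP R n) := [set p | ~~ regular (homog p)].

Lemma mem_slide_fiber i x u :
  (u \in chart_fiber slide_distribution i x) = (insert_entry i 0 u \in plane
    (insert_entry i 1 x)).
Proof.
rewrite mem_chart_fiber /slide_distribution; have [a a0 ->] := homog_chart i x.
exact: (mem_planeZ (insert_entry i 1 x) (insert_entry i 0 u) a0).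
Qed.

Lemma regularZ c (v : V) : c != 0 -> regular (c *: v) = regular v.
Proof.
move=> c0; apply: eq_existsb => -[k|] /=; last by rewrite mxE mulf_eq0 (negbTE c0).
rewrite mxE; under eq_bigr do rewrite mxE.
by rewrite big_split /= prodr_const !mulf_eq0 (negbTE c0) expf_eq0 (negbTE c0) andbF.
Qed.

Lemma irregular_chart i x : irregular_points (chart i x) <-> ~~ regular (insert_entry
  i 1 x).
Proof. by rewrite /irregular_points /=; have [a a0 ->] := homog_chart i x;
  rewrite (regularZ _ a0). Qed.

Lemma differentiable_regularity a (v : V) : differentiable (regularity a) v.
Proof.
case: a => [k|]; last exact: differentiable_coordV.
apply: differentiableM; last exact: differentiable_coordV.
by apply: differentiable_bigprod => j; exact: differentiable_coordV.
Qed.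

Lemma differentiable_tau_self a (v : V) : differentiable (fun v => tau a v v) v.
Proof.
case: a => [k|]; last exact: differentiable_coordV.
apply: differentiableB; apply: differentiableM; try exact: differentiable_coordV.
  exact: differentiable_qpol.
exact: differentiable_ppol.
Qed.

Lemma differentiable_phi k (v : V) : differentiable (phi k) v.
Proof.
rewrite /phi; case: (unlift ord0 k) => [j|]; last exact: differentiable_coordV.
by apply: differentiableN; exact: differentiable_tau_self.
Qed.

Lemma differentiable_slide (kap : V -> 'I_m.+1 -> K) (v : V) :
  (forall k, differentiable (fun v => kap v k) v) ->
  differentiable (fun v => slide (kap v) v) v.
Proof.
move=> h; rewrite /slide /vec.
apply: differentiableD; [apply: differentiableD; [apply: differentiableD|]|].
- exact: differentiable_cst.
- apply: differentiable_bigsum => j; apply: differentiableZl.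
  by apply: differentiableM => //; exact: differentiable_qpol.
- apply: differentiable_bigsum => j; apply: differentiableZl.
  by apply: differentiableM => //; exact: differentiable_ppol.
- exact: differentiableZl.
Qed.

Lemma irregular_analytic : analytic_subset irregular_points.
Proof.
move=> i x; exists setT, m.+1, (fun y => \row_k regularity (unlift ord0 k)
  (insert_entry i 1 y)).
split=> //; first exact: openT.
- move=> y _; apply: differentiable_rV => k; under eq_fun do rewrite mxE.
  exact: (differentiable_comp (differentiable_insert_entry i 1 y)
    (differentiable_regularity _ _)).
- move=> y _; rewrite irregular_chart; split.
    rewrite negb_exists => /forallP h; apply/rowP => k; rewrite !mxE.
    by have := h (unlift ord0 k); rewrite negbK => /eqP.
  move=> /rowP h; rewrite negb_exists; apply/forallP => -[j|].
    by have := h (lift ord0 j); rewrite !mxE liftK => ->; rewrite eqxx.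
  by have := h ord0; rewrite !mxE unlift_none => ->; rewrite eqxx.
Qed.

(** When [phi l v] is nonzero, these [m] vectors form a basis of the solutions [kap] of the equation
    that puts [slide kap v] in the contact hyperplane. *)
Definition frame_coef (l : 'I_m.+1) (a : 'I_m) (v : V) (k : 'I_m.+1) : K :=
  phi l v * (k == lift l a)%:R - phi (lift l a) v * (k == l)%:R.

Lemma frame_coef_kernel l a v : \sum_k frame_coef l a v k * phi k v = 0.
Proof.
rewrite (bigD1_ord l) //= (bigD1 a) //= big1 => [|b ba]; rewrite /frame_coef.
  by rewrite !eqxx (negbTE (neq_lift l a)) (eq_sym _ l) (negbTE (neq_lift l a)) /=;
    ring.
by rewrite (eq_sym _ l) (negbTE (neq_lift l b)) (inj_eq lift_inj) (negbTE ba) /=; ring.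
Qed.

Lemma slide_sum (I : finType) (f : I -> K) (kap : I -> 'I_m.+1 -> K) (v : V) :
  slide (fun k => \sum_a f a * kap a k) v = \sum_a f a *: slide (kap a) v.
Proof.
apply: vec_ext => [|j|j|]; rewrite summxE {1}/slide !vecE.
- by rewrite big1 // => a _; rewrite mxE /slide vecE mulr0.
- by rewrite mulr_suml; apply: eq_bigr => a _; rewrite mxE /slide vecE mulrA.
- by rewrite mulr_suml; apply: eq_bigr => a _; rewrite mxE /slide vecE mulrA.
- by apply: eq_bigr => a _; rewrite mxE /slide vecE.
Qed.

Lemma frame_coef_span l v kap : phi l v != 0 -> \sum_k kap k * phi k v = 0 ->
  kap = (fun k => \sum_a kap (lift l a) / phi l v * frame_coef l a v k).
Proof.
move=> hl hk; apply/funext => k; have [->|kl] := eqVneq k l.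
  move: hk; rewrite (bigD1_ord l) //= => /eqP; rewrite addr_eq0 => /eqP hk.
  apply: (mulIf hl); rewrite hk mulr_suml -sumrN; apply: eq_bigr => a _.
  by rewrite /frame_coef eqxx (negbTE (neq_lift l a)) /=; field.
rewrite eq_sym in kl; have [b -> _] := unlift_some kl.
rewrite (bigD1 b) //= big1 ?addr0 => [|a ab];
  rewrite /frame_coef (eq_sym _ l) (negbTE (neq_lift l b)).
  by rewrite eqxx /=; field.
by rewrite (inj_eq lift_inj) eq_sym (negbTE ab) /=; ring.
Qed.

Lemma slide_distribution_holomorphic :
  holomorphic_distribution m (~` irregular_points) slide_distribution.
Proof.
split=> [p _|i x]; first exact: self_in_plane.
move=> /irregular_chart/negP; rewrite negbK => rx.
have /existsP[a ha] := rx; have [l hl] := regular_phi rx.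
pose h : 'rV[K]_n -> V := insert_entry i 1.
pose W b (v : V) := slide (frame_coef l b v) v.
pose X b (y : 'rV[K]_n) := project i (h y) (W b (h y)).
have dh y : differentiable h y by exact: differentiable_insert_entry.
have dW b (v : V) : differentiable (W b) v.
  apply: differentiable_slide => k.
  have d1 := differentiableM (differentiable_phi l v) (differentiable_cst ((k == lift
    l b)%:R : K) v).
  have d2 := differentiableM (differentiable_phi (lift l b) v) (differentiable_cst
    ((k == l)%:R : K) v).
  exact: differentiableB d1 d2.
have dWh b (y : 'rV[K]_n) : differentiable (fun y => W b (h y)) y.
  exact: (differentiable_comp (dh y) (dW b (h y))).
(* The factor [regularity a] keeps the points regular, and [phi l] keeps the frame independent and
   spanning. *)
exists [set y | regularity a (h y) * phi l (h y) != 0], X; split.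
- apply: open_neq0_fun => y.
  have d1 := differentiable_comp (dh y) (differentiable_regularity a (h y)).
  have d2 := differentiable_comp (dh y) (differentiable_phi l (h y)).
  exact: differentiableM d1 d2.
- by rewrite /= mulf_neq0.
- by move=> b y _; exact: (differentiable_project i (dh y) (dWh b y)).
move=> y /=; rewrite mulf_eq0 negb_or => /andP[ra pl].
have ry : regular (h y) by apply/existsP; exists a.
have XF b : X b y \in chart_fiber slide_distribution i y.
  rewrite mem_slide_fiber insert_project -/(h y); apply: memvB; last by apply: memvZ;
    exact: self_in_plane.
  by apply: slide_in_plane; exact: frame_coef_kernel.
rewrite -[[seq _ | _ : _]]/(tval (mktuple (X^~ y))).
apply/andP; split; last first.
  apply/freeP => c; under eq_bigr do rewrite -tnth_nth tnth_mktuple.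
  rewrite -project_sum -slide_sum => /project_eq0 h0.
  have := h0 _; rewrite insert_entryE => /(_ erefl)/eqP;
    rewrite -subr_eq0 addrC -scaleNr => /eqP.
  move=> /(slide_eq0 ry)[_ hk] b; have := hk (lift l b).
  rewrite (bigD1 b) //= big1 ?addr0 => [|b' b'b];
    rewrite /frame_coef (eq_sym _ l) (negbTE (neq_lift l b)).
    by rewrite eqxx mulr1 mulr0 subr0 => /eqP;
      rewrite mulf_eq0 (negbTE pl) orbF => /eqP.
  by rewrite (inj_eq lift_inj) eq_sym (negbTE b'b) /=; ring.
rewrite eqEsubv; apply/andP; split; first by apply/span_subvP => _ /mapP[b _ ->].
apply/subvP => u; rewrite mem_slide_fiber => /(mem_plane_slide ry)[c [kap [E hk]]].
have -> : u = \sum_b (kap (lift l b) / phi l (h y)) *: X b y.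
  rewrite -[LHS](project_insert i (h y)) E projectD project_self scaler0 add0r.
  by rewrite {1}(frame_coef_span pl hk) slide_sum project_sum.
by apply: memv_suml => b _; apply: memvZ; apply: memv_span; apply: map_f;
  rewrite mem_enum.
Qed.

End Distribution.

(** * Involutivity *)

Section ClosedForms.
Variables (R : realType) (n : nat).
Notation K := (C R).
Notation V := 'rV[C R]_n.+1.
Variable F : V -> V -> K.
Hypothesis F_lin : forall v c u w, F v (c *: u + w) = c * F v u + F v w.
Hypothesis F_diff : forall u v, differentiable (F^~ u) v.

Lemma derive_along_line (f : V -> K) (g : 'rV[C R]_n -> V) x w u :
  (forall t : K, g (t *: w + x) = t *: u + g x) -> 'D_w (f \o g) x = 'D_u f (g x).
Proof. by move=> h; rewrite /derive /=; under eq_fun do rewrite h. Qed.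

Lemma form_sum v u : F v u = \sum_k u 0 k * F v (delta_mx 0 k).
Proof.
have F0 w : F w 0 = 0 by have := F_lin w (-1) 0 0; rewrite scaler0 addr0 mulN1r addNr.
rewrite {1}(row_sum_delta u); apply: (big_ind2 (fun u s => F v u = s)) => // [x1 x2
  y1 y2 <- <-|k _].
  by have := F_lin v 1 x1 y1; rewrite scale1r mul1r.
by have := F_lin v (u 0 k) (delta_mx 0 k) 0; rewrite !addr0 F0 addr0.
Qed.

Lemma form_derive_dir u c w1 w2 v :
  'D_(c *: w1 + w2) (F^~ u) v = c * 'D_w1 (F^~ u) v + 'D_w2 (F^~ u) v.
Proof.
have d := F_diff u v.
by rewrite (deriveE _ d) (deriveE w1 d) (deriveE w2 d) linearP.
Qed.

Lemma form_derive_arg c u1 u2 w v :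
  'D_w (F^~ (c *: u1 + u2)) v = c * 'D_w (F^~ u1) v + 'D_w (F^~ u2) v.
Proof.
have d1 : derivable (F^~ u1) v w by apply: diff_derivable; exact: F_diff.
have d2 : derivable (F^~ u2) v w by apply: diff_derivable; exact: F_diff.
have -> : F^~ (c *: u1 + u2) = c *: (F^~ u1) + F^~ u2.
  by apply/funext => y; rewrite F_lin.
by rewrite (deriveD (derivableZ d1) d2) (deriveZ _ d1).
Qed.

(** By homogeneity the values on the ray of [v] are multiples of [F v u], which is 0. *)
Lemma form_derive_radial N v u : (forall c y, F (c *: y) u = c ^+ N * F y u) ->
  F v u = 0 -> 'D_v (F^~ u) v = 0.
Proof.
move=> hN h; rewrite /derive.
have -> : (fun t : K => t^-1 *: ((F^~ u \o shift v) (t *: v) - F v u)) = cst 0.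
  apply/funext => t /=; have -> : t *: v + v = (t + 1) *: v by rewrite scalerDl scale1r.
  by rewrite hN h mulr0 subr0 scaler0.
exact: lim_cst.
Qed.

(** From [F y y = 0] at [y = t d + v] one gets [F y v = - t F y d], so the difference quotient is
    [- F y d] and tends to [- F v d = 0]. *)
Lemma form_derive_self v d : (forall y, F y y = 0) -> F v d = 0 -> 'D_d (F^~ v) v = 0.
Proof.
move=> h0 h; rewrite /derive.
have c : (fun t : K => - F (t *: d + v) d) @ (0 : K)^' --> (0 : K).
  have E0 : - F (0 *: d + v) d = 0 by rewrite scale0r add0r h oppr0.
  rewrite -[X in _ --> X]E0.
  have dl : differentiable (fun t : K => t *: d + v) 0.
    by apply: differentiableD; [apply: differentiableZl;
      exact: ex_diff|exact: differentiable_cst].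
  have ct := differentiable_continuous (differentiable_comp dl (F_diff d _)).
  rewrite -[_ \o _]/(fun t : K => F (t *: d + v) d) /= in ct.
  have c1 : (fun t : K => F (t *: d + v) d) @ (0 : K)^' --> F (0 *: d + v) d.
    apply: cvg_trans ct; apply: cvg_app; exact: cvg_within.
  exact: (cvgN c1).
apply: cvg_lim => //; apply: cvg_trans c; apply: near_eq_cvg; near=> t.
have t0 : t != 0 by near: t; exact: nbhs_dnbhs_neq.
rewrite /= h0 subr0.
have -> : F (t *: d + v) v = - (t * F (t *: d + v) d).
  apply/eqP; rewrite -addr_eq0 addrC -F_lin h0 //.
rewrite scalerN; congr (- _); first [exact: (mulKf t0)|exact: (esym (mulKf t0 _))].
Unshelve. all: by end_near. Qed.

(* By Euler's identity and F y y = 0, contracting dF with the radial field gives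
   a multiple of F, so only the components d1 and d2 contribute to dF. *)
Lemma form_closed N v c1 c2 d1 d2 :
  (forall c y u, F (c *: y) u = c ^+ N * F y u) -> (forall y, F y y = 0) ->
  F v d1 = 0 -> F v d2 = 0 -> 'D_d1 (F^~ d2) v = 'D_d2 (F^~ d1) v ->
  'D_(c1 *: v + d1) (F^~ (c2 *: v + d2)) v = 'D_(c2 *: v + d2) (F^~ (c1 *: v + d1)) v.
Proof.
move=> hN h0 F1 F2 h.
have R1 := form_derive_radial (fun c y => hN c y d1) F1.
have R2 := form_derive_radial (fun c y => hN c y d2) F2.
have Rv := form_derive_radial (fun c y => hN c y v) (h0 v).
have alg (X : K) : c2 * (c1 * 0 + 0) + (c1 * 0 + X) = c1 * (c2 * 0 + 0) + (c2 * 0 +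
  X) by ring.
have S1 := form_derive_self h0 F1; have S2 := form_derive_self h0 F2.
rewrite !form_derive_arg !form_derive_dir R1 R2 Rv S1 S2 h.
exact: alg.
Qed.

End ClosedForms.

Section Involutivity.
Variables (R : realType) (m : nat).
Notation K := (C R).
Notation n := (2 * m).+1.
Notation V := 'rV[C R]_(2 * m).+2.

Lemma differentiable_tau a (u v : V) : differentiable (fun v => tau a v u) v.
Proof.
case: a => [j|]; last exact: differentiable_cst.
have d1 := differentiableM (differentiable_qpol j v) (differentiable_cst (u 0 (iy j)
  : K) v).
have d2 := differentiableM (differentiable_ppol j v) (differentiable_cst (u 0 (ix j)
  : K) v).
exact: differentiableB d1 d2.
Qed.

Lemma differentiable_theta ab (u v : V) : differentiable (fun v => theta ab v u : K) v.
Proof.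
have d1 := differentiableM (differentiable_tau ab.1 u v) (differentiable_tau_self
  ab.2 v).
have d2 := differentiableM (differentiable_tau ab.2 u v) (differentiable_tau_self
  ab.1 v).
exact: differentiableB d1 d2.
Qed.

Lemma differentiable_om (u v : V) : differentiable (fun v => om v u : K) v.
Proof.
have -> : (fun v => om v u : K) = (fun v => \sum_k v 0 k * - om u (delta_mx 0 k)).
  apply/funext => w; rewrite omC {1}(row_sum_delta w) linear_sum /= -sumrN.
  by apply: eq_bigr => k _; rewrite omZr mulrN.
apply: differentiable_bigsum => k.
exact: differentiableM (differentiable_coordV k v) (differentiable_cst _ v).
Qed.

Lemma derive_same_coords (f : V -> K) j (v u w : V) :
  (forall v w : V, v 0 ord0 = w 0 ord0 -> v 0 (ix j) = w 0 (ix j) -> f v = f w) ->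
  u 0 ord0 = w 0 ord0 -> u 0 (ix j) = w 0 (ix j) -> 'D_u f v = 'D_w f v.
Proof.
move=> hf h0 hx; have E (t : K) : f (t *: u + v) = f (t *: w + v).
  by apply: hf; rewrite !mxE ?h0 ?hx.
by rewrite /derive /=; under eq_fun do rewrite E.
Qed.

(** The form [Q_j dY_j - P_j dX_j] involves only [v_0], [X_j] and [Y_j]. In these coordinates all
    slides at [v] are multiples of the single vector [(0, Q_j, P_j)], on which a 2-form vanishes. *)
Lemma derive_tau_slide a (v : V) kap1 kap2 :
  'D_(slide kap1 v) (fun y => tau a y (slide kap2 v)) v =
  'D_(slide kap2 v) (fun y => tau a y (slide kap1 v)) v.
Proof.
case: a => [j|]; last by rewrite /tau /slide !vecE !derive_cst.
pose e : V := delta_mx 0 (ix j).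
have D (f : V -> K) kap : differentiable f v -> (forall v w : V, v 0 ord0 = w 0 ord0
  -> v 0 (ix j) = w 0 (ix j) -> f v = f w) ->
    'D_(slide kap v) f v = kap (lift ord0 j) * qpol j v * 'D_e f v.
  move=> df hf; rewrite (@derive_same_coords f j v _ ((kap (lift ord0 j) * qpol j v)
    *: e)) //.
  - by rewrite (deriveE _ df) (deriveE e df) linearZ.
  - by rewrite /slide vecE !mxE index_eqE andbF mulr0.
  - by rewrite /slide vecE !mxE !eqxx mulr1.
have E kap kap' : 'D_(slide kap v) (fun y => tau (Some j) y (slide kap' v)) v =
    kap (lift ord0 j) * kap' (lift ord0 j) * (qpol j v * (ppol j v * 'D_e (qpol j) v
      - qpol j v * 'D_e (ppol j) v)).
  rewrite D; [|exact: differentiable_tau|by move=> y w h0 hx;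
    rewrite /tau (qpol_dep h0 hx) (ppol_dep h0 hx)].
  have dq : derivable (qpol j) v e by apply: diff_derivable; exact: differentiable_qpol.
  have dp : derivable (ppol j) v e by apply: diff_derivable; exact: differentiable_ppol.
  set x := slide kap' v 0 (ix j); set y := slide kap' v 0 (iy j).
  have -> : (fun y => tau (Some j) y (slide kap' v)) = y *: qpol j - x *: ppol j.
    by apply/funext => w; rewrite /tau -/x -/y mulrC [ppol j w * _]mulrC.
  rewrite (deriveB (derivableZ dq) (derivableZ dp)) (deriveZ _ dq) (deriveZ _ dp).
  move: ('D_e (qpol j) v) ('D_e (ppol j) v) => A B.
  have -> : y = kap' (lift ord0 j) * ppol j v by rewrite /y /slide vecE.
  have -> : x = kap' (lift ord0 j) * qpol j v by rewrite /x /slide vecE.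
  by rewrite -![_ *: _]/(_ * _); ring.
apply: etrans (E _ _) (etrans _ (esym (E _ _))).
exact: (congr1 ( *%R^~ _) (mulrC _ _)).
Qed.

Lemma deriveM_left0 (f g : V -> K) (v d : V) : derivable f v d -> derivable g v d ->
  f v = 0 -> 'D_d (f * g) v = g v * 'D_d f v.
Proof. by move=> df dg f0; rewrite (deriveM df dg) f0 scale0r add0r. Qed.

(** Since [tau] vanishes on slides, the product rule only differentiates the first factor of each
    product, which reduces the symmetry to that for [tau]. *)
Lemma derive_theta_slide ab (v : V) kap1 kap2 :
  'D_(slide kap1 v) (fun y => theta ab y (slide kap2 v) : K) v =
  'D_(slide kap2 v) (fun y => theta ab y (slide kap1 v) : K) v.
Proof.
have E kap kap' : 'D_(slide kap v) (fun y => theta ab y (slide kap' v) : K) v =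
   tau ab.2 v v * 'D_(slide kap v) (fun y => tau ab.1 y (slide kap' v)) v
   - tau ab.1 v v * 'D_(slide kap v) (fun y => tau ab.2 y (slide kap' v)) v.
  set d := slide kap v; set u := slide kap' v.
  have D a : derivable (fun y => tau a y u) v d by apply: diff_derivable;
    exact: differentiable_tau.
  have S a : derivable (fun y => tau a y y) v d by apply: diff_derivable;
    exact: differentiable_tau_self.
  have -> : (fun y => theta ab y u : K) = (fun y => tau ab.1 y u) * (fun y => tau
    ab.2 y y)
      - (fun y => tau ab.2 y u) * (fun y => tau ab.1 y y) by [].
  rewrite (deriveB (derivableM (D ab.1) (S ab.2)) (derivableM (D ab.2) (S ab.1))).
  by rewrite (deriveM_left0 (D ab.1) (S ab.2) (tau_slide _ _ _)) (deriveM_left0 (D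
    ab.2) (S ab.1) (tau_slide _ _ _)).
apply: etrans (E _ _) (etrans _ (esym (E _ _))).
exact: (congr2 (fun a b => tau ab.2 v v * a - tau ab.1 v v * b)
  (derive_tau_slide ab.1 v kap1 kap2) (derive_tau_slide ab.2 v kap1 kap2)).
Qed.

Lemma derive_om (u w v : V) : 'D_w (fun y => om y u : K) v = om w u.
Proof.
have l : linear (fun y => om y u : K^o).
  by move=> c y z; rewrite omC (linearP (om u)) opprD -scalerN -!omC.
pose f : {linear V -> K^o} := HB.pack (fun y => om y u : K^o) (GRing.isLinear.Build _
  _ _ _ _ l).
have d := @differentiable_om u v.
rewrite (deriveE _ d).
have c : continuous f by move=> y; apply: differentiable_continuous;
  exact: differentiable_om.
by have := diff_lin v c; move=> /(congr1 (fun h : V -> K => h w)).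
Qed.

(** Slides span an isotropic space: the direction [Z] is paired only with [v_0], and each plane
    [(X_j, Y_j)] contributes two proportional vectors. *)
Lemma om_slide2 (v : V) kap1 kap2 : om (slide kap1 v) (slide kap2 v) = 0.
Proof.
rewrite omE /slide !vecE !mul0r subr0 sub0r; apply/eqP; rewrite oppr_eq0; apply/eqP.
by apply: big1 => j _; rewrite !vecE; ring.
Qed.

(* The exterior derivative of the 1-form F vanishes on every regular plane. *)
Definition closed_on_plane (F : V -> V -> K) := forall v u1 u2, regular v ->
  u1 \in plane v -> u2 \in plane v -> 'D_u1 (F^~ u2) v = 'D_u2 (F^~ u1) v.

Lemma closed_of_slides (F : V -> V -> K) N :
  (forall v c u w, F v (c *: u + w) = c * F v u + F v w) ->
  (forall u v, differentiable (F^~ u) v) ->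
  (forall c y u, F (c *: y) u = c ^+ N * F y u) -> (forall y, F y y = 0) ->
  (forall v u, u \in plane v -> F v u = 0) ->
  (forall v kap1 kap2, 'D_(slide kap1 v) (F^~ (slide kap2 v)) v = 'D_(slide kap2 v)
    (F^~ (slide kap1 v)) v) ->
  closed_on_plane F.
Proof.
move=> hl hd hN h0 hp hs v u1 u2 rv /(mem_plane_slide rv)[c1 [k1 [-> e1]]].
move=> /(mem_plane_slide rv)[c2 [k2 [-> e2]]].
have F1 := hp _ _ (slide_in_plane e1); have F2 := hp _ _ (slide_in_plane e2).
exact: (form_closed hl hd c1 c2 hN h0 F1 F2 (hs v k1 k2)).
Qed.

Lemma closed_om : closed_on_plane (fun v u => om v u).
Proof.
apply: (@closed_of_slides _ 1).
- by move=> v c u w; exact: (linearP (om v)).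
- exact: differentiable_om.
- by move=> c y u; rewrite omC omZr expr1 -mulrN -omC.
- exact: om_nn.
- by move=> v u /mem_plane[].
- move=> v k1 k2.
  exact: etrans (etrans (derive_om _ _ _) (om_slide2 _ _ _)) (esym (etrans (derive_om
    _ _ _) (om_slide2 _ _ _))).
Qed.

Lemma closed_theta ab : closed_on_plane (fun v u => theta ab v u).
Proof.
apply: (@closed_of_slides _ (tau_deg ab.1 + tau_deg ab.2).+1).
- by move=> v c u w; exact: (theta_lin ab v).
- exact: differentiable_theta.
- by move=> c y u; rewrite /theta !tauZ !tauZr exprS exprD; ring.
- by move=> y; rewrite /theta mulrC subrr.
- by move=> v u /mem_plane[_ h]; rewrite /theta h subrr.
- by move=> v k1 k2; exact: derive_theta_slide.
Qed.

Lemma diff_row_coord (U : normedModType K) d (Z : U -> 'rV[K]_d) (x : U) (l : 'I_d) w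
  : differentiable Z x ->
  differentiable (fun y => Z y 0 l : K) x /\ 'd (fun y => Z y 0 l : K) x w = 'd Z x w
    0 l.
Proof.
move=> dZ.
have ln : linear (fun u : 'rV[K]_d => u 0 l : K^o) by move=> c y z; rewrite !mxE.
pose f : {linear 'rV[K]_d -> K^o} := HB.pack (fun u : 'rV[K]_d => u 0 l : K^o)
  (GRing.isLinear.Build _ _ _ _ _ ln).
have dc (u : 'rV[K]_d) : differentiable f u by exact: differentiable_coord.
have cf : continuous f by move=> u; apply: differentiable_continuous; exact: dc.
have E := diff_comp dZ (dc (Z x)); have L := diff_lin (Z x) cf.
split; first exact: differentiable_comp dZ (dc (Z x)).
apply: etrans (congr1 (fun h : U -> K => h w) E) _.
exact: (congr1 (fun h : 'rV[K]_d -> K => h ('d Z x w)) L).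
Qed.

Section Bracket.
Variable F : V -> V -> K.
Hypothesis F_lin : forall v c u w, F v (c *: u + w) = c * F v u + F v w.
Hypothesis F_diff : forall u v, differentiable (F^~ u) v.
Variable i : 'I_n.+1.

Lemma derive_insert_coord (Z : 'rV[K]_n -> 'rV[K]_n) (x w : 'rV[K]_n) k :
  differentiable Z x ->
  derivable (fun y => insert_entry i 0 (Z y) 0 k : K) x w /\
  'D_w (fun y => insert_entry i 0 (Z y) 0 k : K) x = insert_entry i 0 ('d Z x w) 0 k.
Proof.
move=> dZ; have DZ : derivable Z x w by exact: diff_derivable.
case: (unliftP i k) => [l|] ->.
  have -> : (fun y => insert_entry i 0 (Z y) 0 (lift i l) : K) = (fun y => Z y 0 l).
    by apply/funext => y; rewrite insert_entryE.
  have [d E] := diff_row_coord l w dZ.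
  by split; [exact: diff_derivable|rewrite insert_entryE (deriveE w d)].
have -> : (fun y => insert_entry i 0 (Z y) 0 i : K) = cst 0.
  by apply/funext => y; rewrite insert_entryE.
by split; [exact: derivable_cst|rewrite derive_cst insert_entryE].
Qed.

(** The Leibniz rule for the pairing of a form with a section, using that [insert_entry i 1] is
    affine with linear part [insert_entry i 0]. *)
Lemma derive_form_section (Z : 'rV[K]_n -> 'rV[K]_n) (x w : 'rV[K]_n) :
  differentiable Z x ->
  'D_w (fun y => F (insert_entry i 1 y) (insert_entry i 0 (Z y))) x =
  F (insert_entry i 1 x) (insert_entry i 0 ('d Z x w)) +
  'D_(insert_entry i 0 w) (F^~ (insert_entry i 0 (Z x))) (insert_entry i 1 x).
Proof.
move=> dZ; set h := insert_entry i 1.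
pose f k (y : 'rV[K]_n) : K := insert_entry i 0 (Z y) 0 k.
pose g k (y : 'rV[K]_n) : K := F (h y) (delta_mx 0 k).
have hl (t : K) : h (t *: w + x) = t *: insert_entry i 0 w + h x.
  by apply/rowP => k; rewrite !mxE; case: unlift => [l|]; rewrite ?mxE ?mulr0 ?add0r.
have Dg k : 'D_w (g k) x = 'D_(insert_entry i 0 w) (F^~ (delta_mx 0 k)) (h x).
  exact: derive_along_line hl.
have dg k : derivable (g k) x w.
  apply: diff_derivable.
  exact: (differentiable_comp (differentiable_insert_entry i 1 x) (F_diff (delta_mx 0
    k) (h x))).
have df k : derivable (f k) x w by have [] := derive_insert_coord w k dZ.
have Df k : 'D_w (f k) x = insert_entry i 0 ('d Z x w) 0 k.
  by have [] := derive_insert_coord w k dZ.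
have -> : (fun y => F (h y) (insert_entry i 0 (Z y))) = \sum_k (f k * g k).
  by apply/funext => y; rewrite (form_sum F_lin) fct_sumE.
rewrite derive_sum; last by move=> k; exact: derivableM.
have L := form_sum (F := fun v u => 'D_(insert_entry i 0 w) (F^~ u) v)
  (fun v c u1 u2 => form_derive_arg F_lin F_diff c u1 u2 _ v).
rewrite (form_sum F_lin) (L (h x)) -big_split /=; apply: eq_bigr => k _.
by rewrite (deriveM (df k) (dg k)) Df Dg addrC; congr (_ + _); exact: mulrC.
Qed.

(** Cartan's formula: [F(X) = 0] is differentiated along [Y] and [F(Y) = 0] along [X]. Up to sign,
    the difference equates [F] of the bracket with the exterior derivative on [X] and [Y], which
    vanishes by the last hypothesis. *)
Lemma bracket_form (U : set 'rV[K]_n) (X Y : 'rV[K]_n -> 'rV[K]_n) x : open U -> U x ->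
  differentiable X x -> differentiable Y x ->
  (forall y, U y -> F (insert_entry i 1 y) (insert_entry i 0 (X y)) = 0) ->
  (forall y, U y -> F (insert_entry i 1 y) (insert_entry i 0 (Y y)) = 0) ->
  'D_(insert_entry i 0 (X x)) (F^~ (insert_entry i 0 (Y x))) (insert_entry i 1 x) =
  'D_(insert_entry i 0 (Y x)) (F^~ (insert_entry i 0 (X x))) (insert_entry i 1 x) ->
  F (insert_entry i 1 x) (insert_entry i 0 (lie_bracket X Y x)) = 0.
Proof.
move=> oU Ux dX dY hX hY hD.
have Z0 (Z : 'rV[K]_n -> 'rV[K]_n) w : (forall y, U y -> F (insert_entry i 1 y)
  (insert_entry i 0 (Z y)) = 0) ->
    'D_w (fun y => F (insert_entry i 1 y) (insert_entry i 0 (Z y))) x = 0.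
  move=> hZ; rewrite -[RHS](derive_cst 0 x w).
  apply: near_eq_derive; near=> y; apply: hZ; near: y.
  exact: open_nbhs_nbhs.
have EX := etrans (esym (derive_form_section (Y x) dX)) (Z0 X (Y x) hX).
have EY := etrans (esym (derive_form_section (X x) dY)) (Z0 Y (X x) hY).
rewrite /lie_bracket linearB /=.
have FB u1 u2 : F (insert_entry i 1 x) (u1 - u2) = F (insert_entry i 1 x) u1 - F
  (insert_entry i 1 x) u2.
  by have := F_lin (insert_entry i 1 x) (-1) u2 u1;
    rewrite scaleN1r mulN1r addrC => ->; rewrite addrC.
rewrite FB; apply/eqP; rewrite subr_eq0; apply/eqP.
apply: (addIr ('D_(insert_entry i 0 (X x)) (F^~ (insert_entry i 0 (Y x)))
  (insert_entry i 1 x))).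
by apply: (etrans EY); rewrite hD; exact: esym EX.
Unshelve. all: by end_near. Qed.

End Bracket.

Lemma slide_distribution_involutive :
  involutive_distribution (~` @irregular_points R m) (@slide_distribution R m).
Proof.
move=> i U X Y oU hU hX hY sX sY x Ux.
have rx y : U y -> regular (insert_entry i 1 y).
  move=> Uy; have := hU _ (imageP (chart i) Uy) => /irregular_chart.
  by move/negP; rewrite negbK.
have pX y : U y -> insert_entry i 0 (X y) \in plane (insert_entry i 1 y).
  by move=> Uy; rewrite -mem_slide_fiber; exact: sX.
have pY y : U y -> insert_entry i 0 (Y y) \in plane (insert_entry i 1 y).
  by move=> Uy; rewrite -mem_slide_fiber; exact: sY.
have key (F : V -> V -> K) (F_lin : forall v c u w, F v (c *: u + w) = c * F v u + F
  v w)
    (F_diff : forall u v, differentiable (F^~ u) v) :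
    closed_on_plane F -> (forall v u, u \in plane v -> F v u = 0) ->
    F (insert_entry i 1 x) (insert_entry i 0 (lie_bracket X Y x)) = 0.
  move=> cF pF; apply: (bracket_form F_lin F_diff oU Ux (hX x Ux) (hY x Ux)).
  - by move=> y Uy; apply: pF; exact: pX.
  - by move=> y Uy; apply: pF; exact: pY.
  - by apply: cF; [exact: rx|exact: pX|exact: pY].
have om_lin2 (v : V) (c : K) (u w : V) : om v (c *: u + w) = c * om v u + om v w.
  exact: (linearP (om v)).
have om_pl (v u : V) : u \in plane v -> om v u = 0 by move=> /mem_plane[].
have om0 := key (fun v u => om v u) om_lin2 (@differentiable_om) (@closed_om) om_pl.
have th_lin ab (v : V) (c : K) (u w : V) : theta ab v (c *: u + w) = c * theta ab v u
  + theta ab v w.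
  exact: theta_lin.
have th_pl ab (v u : V) : u \in plane v -> theta ab v u = 0.
  by move=> /mem_plane[_ h]; rewrite /theta h subrr.
have th0 ab := key (fun v u => theta ab v u) (th_lin ab) (@differentiable_theta ab)
  (@closed_theta ab) (th_pl ab).
rewrite mem_slide_fiber; apply/mem_plane; split; first exact: om0.
by move=> a b; apply/eqP; rewrite -subr_eq0; apply/eqP; exact: (th0 (a, b)).
Qed.

End Involutivity.

(** * Codimension of the singular set *)

Section ProjectiveTopology.
Variables (R : realType) (n : nat).
Notation K := (C R).
Implicit Types (i k : 'I_n.+1) (p : CP R n).

Lemma homog_pi (w : @nonzero_vectors R n) :
  exists2 a : K, a != 0 & homog (\pi_(CP R n)%qT w) = a *: \val w.
Proof.
set p := \pi_(CP R n)%qT w.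
have : same_line (repr p) w.
  by apply/eqP; have := reprK p; rewrite {2}/p => /eqmodP;
    rewrite /= /same_line => /eqP.
rewrite /same_line -/(homog p) => /eqP h.
have : homog p \in <[\val w]>%VS by rewrite -h memv_line.
move=> /vlineP[a ha]; exists a => //.
by apply: contra_neq (homog_neq0 p) => a0; rewrite ha a0 scale0r.
Qed.

Lemma range_chart i p : range (chart i) p <-> homog p 0 i != 0.
Proof.
split=> [[x _ <-]|h].
  by have [a a0 ->] := homog_chart i x; rewrite mxE insert_entryE mulr1.
exists (affine_coord i p) => //.
rewrite -[RHS]reprK; apply/eqmodP => /=; rewrite /same_line /=.
have -> : insert_entry i 1 (affine_coord i p) = (homog p 0 i)^-1 *: homog p.
  apply/rowP => k; rewrite [RHS]mxE; case: (unliftP i k) => [l|] ->;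
    rewrite insert_entryE.
    by rewrite mxE mulrC.
  by rewrite mulVf.
rewrite -/(homog p); apply/eqP/eqP; rewrite eqEsubv; apply/andP; split.
  by rewrite -memvE; apply: memvZ; exact: memv_line.
rewrite -memvE; apply/vlineP; exists (homog p 0 i).
by rewrite scalerA mulfV // scale1r.
Qed.

Lemma affine_coordK i p : homog p 0 i != 0 -> chart i (affine_coord i p) = p.
Proof. by move=> /range_chart[x _ <-]; rewrite chartK. Qed.

Lemma homog_neq0_coord p : exists i, homog p 0 i != 0.
Proof.
apply: contrapT => h; have /eqP := homog_neq0 p; apply; apply/rowP => k; rewrite mxE.
by apply/eqP; apply: contrapT => /negP hk; apply: h; exists k.
Qed.

Lemma chart_continuous i : continuous (@chart R n i).
Proof.
apply/continuousP => O [B oB hB].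
have -> : chart i @^-1` O = insert_entry i 1 @^-1` B.
  apply/seteqP; split=> y /=.
    move=> Oy; have : (\pi_(CP R n)%qT @^-1` O) (SigSub (insert_entry1_neq0 i y)) by [].
    by rewrite -hB /= set_valE.
  move=> By; have : (set_val @^-1` B) (SigSub (insert_entry1_neq0 i y))
    by rewrite /= set_valE.
  by rewrite hB.
have /continuousP c : continuous (@insert_entry R n i 1).
  by move=> y; apply: differentiable_continuous; exact: differentiable_insert_entry.
exact: c.
Qed.

Lemma open_homog_neq0 k : open [set p : CP R n | homog p 0 k != 0].
Proof.
exists [set v : 'rV[K]_n.+1 | v 0 k != 0].
  by apply: open_neq0_fun => v; exact: differentiable_coord.
apply/seteqP; split=> w; rewrite /= set_valE; have [a a0 ->] := homog_pi w;
  rewrite mxE mulf_eq0 negb_or a0 //.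
Qed.

Lemma polydisc_open d : open (@polydisc R d).
Proof. exact: ball_open. Qed.

End ProjectiveTopology.

Section Codimension.
Variables (R : realType).
Notation K := (C R).

(** Deleting the two zero columns of the matrix of [f] leaves its rows independent. *)
Lemma injective_two_zero_coords d n (f : {linear 'rV[K]_d -> 'rV[K]_n}) (l1 l2 : 'I_n) :
  injective f -> l1 != l2 -> (forall u, f u 0 l1 = 0) -> (forall u, f u 0 l2 = 0) ->
  (d + 2 <= n)%N.
Proof.
move=> fi l12 h1 h2; have [l El _] := unlift_some l12.
pose M := lin1_mx f; pose A := col' l (col' l1 M).
have uM u k : (u *m M) 0 k = f u 0 k by rewrite mul_rV_lin1.
have fA : row_free A.
  apply: inj_row_free => u uA; apply: fi; rewrite linear0; apply/rowP => k; rewrite mxE.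
  case: (unliftP l1 k) => [k'|] -> //; case: (unliftP l k') => [k''|] ->; last
    by rewrite -El.
  rewrite -uM; have /rowP/(_ k'') := uA; rewrite !mxE => h; rewrite -[RHS]h.
  by apply: eq_bigr => j _; rewrite !mxE.
have := rank_leq_col A; rewrite (eqP fA) => dn.
by have := ltn_ord l1; have := ltn_ord l; lia.
Qed.

(** Nonvanishing of a homogeneous coordinate is an open condition, so at a parameter where the
    number of nonzero coordinates is largest the set of vanishing ones is locally constant. Two
    affine coordinates of [s] then vanish identically nearby, and the injective differential misses
    two directions. *)
Lemma codim_two_coords n (A : set (CP R n)) :
  (forall p, A p -> exists k1 k2 : 'I_n.+1, [/\ k1 != k2, homog p 0 k1 = 0 & homog p
    0 k2 = 0]) ->
  codim_ge 2 A.
Proof.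
move=> hA d s im sA.
pose N t := #|[set k | homog (s t) 0 k != 0]%SET|.
pose P c := `[< exists2 t, polydisc t & N t = c >].
have [t0 t0P] : exists t0 : 'rV[K]_d, polydisc t0 by exists 0; exact: ballxx.
have exP : exists c, P c by exists (N t0); apply/asboolP; exists t0.
have bP c : P c -> (c <= n.+1)%N.
  by move=> /asboolP[t _ <-]; rewrite /N -[leqRHS]card_ord max_card.
case: (ex_maxnP exP bP) => c /asboolP[t tP Nt] cmax.
have [ct sm] := im t tP.
have near_nz k : homog (s t) 0 k != 0 -> \forall u \near t, homog (s u) 0 k != 0.
  move=> hk; exact: (ct [set p | homog p 0 k != 0] (open_nbhs_nbhs (conj
    (@open_homog_neq0 R n k) hk))).
have near_all : \forall u \near t, forall k, homog (s t) 0 k != 0 -> homog (s u) 0 k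
  != 0.
  apply: (@filter_forall _ _ (fun k u => homog (s t) 0 k != 0 -> homog (s u) 0 k !=
    0) (nbhs t)) => k.
  by have [h|h] := boolP (homog (s t) 0 k != 0);
    [apply: filterS (near_nz k h)|near=> u].
have near_pd : \forall u \near t, polydisc u.
  by apply: open_nbhs_nbhs; split; [exact: polydisc_open|].
have near_eq : \forall u \near t, forall k, homog (s t) 0 k = 0 -> homog (s u) 0 k = 0.
  near=> u; have hu : forall k, homog (s t) 0 k != 0 -> homog (s u) 0 k != 0 by near: u.
  have pu : polydisc u by near: u.
  have sub : [set k | homog (s t) 0 k != 0]%SET \subset [set k | homog (s u) 0 k !=
    0]%SET.
    by apply/fintype.subsetP => k; rewrite !inE; exact: hu.
  have Nu : (N u <= N t)%N by rewrite Nt; apply: cmax; apply/asboolP; exists u.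
  have := subset_leqif_cards sub; rewrite -/(N u) -/(N t) => -[le1 eq1].
  have E : N t = N u by apply/eqP; rewrite eqn_leq Nu le1.
  move: eq1; rewrite E eqxx => /esym/eqP ES k hk.
  by have := congr1 (fun S : {set _} => k \in S) ES;
    rewrite !inE hk eqxx => /esym/negbFE/eqP.
have [k1 [k2 [k12 z1 z2]]] := hA _ (sA _ (imageP s tP)).
have [i hi] := homog_neq0_coord (s t).
have [dg ig] := sm i (proj2 (range_chart i (s t)) hi).
set g := affine_coord i \o s in dg ig.
have zero l : homog (s t) 0 (lift i l) = 0 -> forall w, 'd g t w 0 l = 0.
  move=> hl w; have [dl El] := diff_row_coord l w dg.
  rewrite -El -(deriveE w dl) -[RHS](derive_cst (0 : K) t w).
  apply: near_eq_derive; near=> u.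
  have hu : forall k, homog (s t) 0 k = 0 -> homog (s u) 0 k = 0 by near: u.
  by rewrite /g /= mxE (hu _ hl) mul0r.
have i1 : i != k1 by apply: contraNneq hi => ->; rewrite z1.
have i2 : i != k2 by apply: contraNneq hi => ->; rewrite z2.
have [l1 E1 _] := unlift_some i1; have [l2 E2 _] := unlift_some i2.
apply: (@injective_two_zero_coords d n ('d g t) l1 l2) => //.
- by apply: contra_neq k12 => E; rewrite E1 E2 E.
- by apply: zero; rewrite -E1.
- by apply: zero; rewrite -E2.
Unshelve. all: by end_near. Qed.

Lemma irregular_codim m : (1 <= m)%N -> codim_ge 2 (@irregular_points R m).
Proof.
move=> m1; apply: codim_two_coords => p;
  rewrite /irregular_points /= negb_exists => /forallP h.
have z0 : homog p 0 ord0 = 0 by have := h None; rewrite negbK => /eqP.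
have := h (Some (Ordinal m1)); rewrite negbK /= mulf_eq0 => /orP[|/eqP hy].
  move=> /eqP/eqP; rewrite prodf_seq_eq0 => /hasP[j _ /= /eqP hx].
  by exists ord0, (ix j); split => //; rewrite index_eqE.
by exists ord0, (iy (Ordinal m1)); split => //; rewrite index_eqE.
Qed.

End Codimension.

(** * Tangency to the contact distribution *)

Section ContactUniqueness.
Variables (R : realType) (m : nat).
Notation K := (C R).
Notation n := (2 * m).+1.
Notation V := 'rV[C R]_(2 * m).+2.
Variable xi : tangent_distribution R n.
Hypothesis xi_contact : canonical_contact xi.

Lemma homog_in_contact p : homog p \in xi p.
Proof. by case: xi_contact => -[h _] _; exact: h. Qed.

Lemma insert_entry1_in_contact i x : insert_entry i 1 x \in xi (chart i x).
Proof.
have := homog_in_contact (chart i x); have [a a0 ->] := homog_chart i x => h.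
have -> : insert_entry i 1 x = a^-1 *: (a *: insert_entry i 1 x)
  by rewrite scalerA mulVf // scale1r.
exact: memvZ.
Qed.

Lemma om_insert_ord0 (w u : 'rV[K]_n) : om (insert_entry ord0 1 w) (insert_entry ord0
  0 u) = 0 <->
  coord_z u = \sum_(j < m) (coord_y w j * coord_x u j - coord_x w j * coord_y u j).
Proof.
rewrite omE !insert_entryE mul1r mul0r subr0 /iz /ix /iy.
under eq_bigr do rewrite !insert_entryE.
by split=> [/eqP|h]; [rewrite subr_eq0 => /eqP|rewrite -[u 0 _]/(coord_z u) h subrr].
Qed.

Lemma contact_om_generic p u : homog p 0 ord0 != 0 -> u \in xi p -> om (homog p) u = 0.
Proof.
move=> p0 hu; set v := homog p in p0 *; set w := affine_coord ord0 p.
have Ep : chart ord0 w = p by exact: affine_coordK.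
have Ev : v = v 0 ord0 *: insert_entry ord0 1 w.
  apply/rowP => k; rewrite [RHS]mxE; case: (unliftP ord0 k) => [l|] ->;
    rewrite insert_entryE.
    by rewrite /w mxE -/v mulrC divfK.
  by rewrite mulr1.
set h := insert_entry ord0 1 w in Ev.
pose u' := project ord0 h u.
have hu' : u' \in chart_fiber xi ord0 w.
  rewrite mem_chart_fiber insert_project Ep; apply: memvB => //; apply: memvZ.
  by rewrite -Ep; exact: insert_entry1_in_contact.
have := proj1 (proj2 xi_contact w u') hu'; move/om_insert_ord0.
rewrite insert_project -/h linearB /= omZr om_nn mulr0 subr0 => h0.
by rewrite Ev; apply/eqP; rewrite om_eq0Zl // h0.
Qed.

Lemma om_homog_chart i (x : 'rV[K]_n) (u : V) : (om (homog (chart i x)) u == 0) = (om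
  (insert_entry i 1 x) u == 0).
Proof. by have [a a0 ->] := homog_chart i x; rewrite om_eq0Zl. Qed.

(** On the hyperplane at infinity the equation is obtained by continuity: the vectors of a local
    frame of [xi] satisfy it off the hyperplane, along a line through [x] transverse to it. *)
Lemma contact_fiber_om i (x u : 'rV[K]_n) : u \in chart_fiber xi i x ->
  om (insert_entry i 1 x) (insert_entry i 0 u) = 0.
Proof.
move=> hu; have [v0|v0] := eqVneq (insert_entry i 1 x 0 ord0) 0; last first.
  apply/eqP; rewrite -om_homog_chart; apply/eqP; apply: contact_om_generic.
    by have [a a0 ->] := homog_chart i x; rewrite mxE mulf_neq0.
  by rewrite -mem_chart_fiber.
have i0 : i != ord0 by apply: contra_eq_neq v0 => ->; rewrite insert_entryE oner_neq0.
have [l0 El _] := unlift_some i0.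
have [[_ /(_ i x I)[U [X [oU Ux hX bX]]]] _] := xi_contact.
suff Xom a : om (insert_entry i 1 x) (insert_entry i 0 (X a x)) = 0.
  pose f := (om (insert_entry i 1 x) \o insert_entry i 0) : {linear 'rV[K]_n -> K^o}.
  suff : (chart_fiber xi i x <= lker (linfun f))%VS.
    by move=> /subvP/(_ _ hu); rewrite memv_ker lfunE /= => /eqP.
  have /andP[/eqP <- _] := bX x Ux; apply/span_subvP => _ /mapP[a _ ->].
  by rewrite memv_ker lfunE /=; apply/eqP; exact: Xom.
(* The index [l0] is the place of [v_0] in the chart [i]; along this line [v_0 = t], so the
   hyperplane is met only at [t = 0]. *)
pose g (t : K) := x + t *: delta_mx 0 l0.
pose z (t : K) : K := om (insert_entry i 1 (g t)) (insert_entry i 0 (X a (g t))).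
have g0 : g 0 = x by rewrite /g scale0r addr0.
have dg : differentiable g 0.
  by apply: differentiableD; [exact: differentiable_cst|apply: differentiableZl;
    exact: ex_diff].
have dX : differentiable (fun t => X a (g t)) 0.
  by apply: (differentiable_comp dg); rewrite g0; exact: hX.
have dh : differentiable (fun t => insert_entry i 1 (g t)) 0.
  exact: (differentiable_comp dg (differentiable_insert_entry i 1 (g 0))).
have dk : differentiable (fun t => insert_entry i 0 (X a (g t))) 0.
  exact: (differentiable_comp dX (differentiable_insert_entry i 0 (X a (g 0)))).
have cz : {for 0, continuous z}.
  apply: differentiable_continuous.
  have -> : z = fun t => \sum_k (insert_entry i 0 (X a (g t)) 0 k * om (insert_entry
    i 1 (g t)) (delta_mx 0 k)).
    apply/funext => t; rewrite /z {1}(row_sum_delta (insert_entry i 0 (X a (g t))))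
      linear_sum.
    by apply: eq_bigr => k _; exact: omZr.
  apply: differentiable_bigsum => k.
  have d1 := differentiable_comp dk (differentiable_coordV k (insert_entry i 0 (X a
    (g 0)))).
  have d2 := differentiable_comp dh (differentiable_om (delta_mx 0 k) (insert_entry i
    1 (g 0))).
  exact: differentiableM d1 d2.
have z0 : \forall t \near (0 : K)^', z t = 0.
  have cg := differentiable_continuous dg.
  have gU : \forall t \near (0 : K), U (g t).
    by apply: (cg U); rewrite g0; exact: open_nbhs_nbhs.
  near=> t; have t0 : t != 0 by near: t; exact: nbhs_dnbhs_neq.
  have Ut : U (g t) by near: t; exact: nbhs_dnbhs.
  have h0 : insert_entry i 1 (g t) 0 ord0 = t.
    move: v0; rewrite El !insert_entryE => x0.
    by rewrite /g !mxE x0 !eqxx mulr1 add0r.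
  apply/eqP; rewrite /z -om_homog_chart; apply/eqP; apply: contact_om_generic.
    by have [b b0 ->] := homog_chart i (g t); rewrite mxE h0 mulf_neq0.
  rewrite -mem_chart_fiber.
  have /andP[/eqP <- _] := bX _ Ut; apply: memv_span; apply: map_f; exact: mem_enum.
have -> : om (insert_entry i 1 x) (insert_entry i 0 (X a x)) = z 0 by rewrite /z g0.
have l1 : z t @[t --> (0 : K)^'] --> z 0 by apply: cvg_trans cz; apply: cvg_app;
  exact: cvg_within.
have l2 : z t @[t --> (0 : K)^'] --> (0 : K).
  apply: cvg_trans (@cvg_cst K^o 0 K (0 : K)^' _); apply: near_eq_cvg.
  by apply: filterS z0 => t ->.
exact: (@cvg_unique _ (@norm_hausdorff _ _) _ _ _ _ l1 l2).
Unshelve. all: by end_near. Qed.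

(** The inclusion of [contact_fiber_om] is an equality by dimension, as [xi] and [contact_kernel]
    both have local frames of length [2 * m]. *)
Lemma contact_eq_om p u : om (homog p) u = 0 -> u \in xi p.
Proof.
move=> hu; have [i hi] := homog_neq0_coord p.
pose x := affine_coord i p; have Ep : chart i x = p by exact: affine_coordK.
have fE : chart_fiber xi i x = chart_fiber (@contact_kernel R m) i x.
  apply/eqP; rewrite eqEdim; apply/andP; split.
    apply/subvP => w /contact_fiber_om h; rewrite mem_chart_fiber memv_ker lfunE /=.
    by rewrite om_homog_chart; apply/eqP.
  have [[_ /(_ i x I)[U [X [_ Ux _ bX]]]] _] := xi_contact.
  have [[_ /(_ i x I)[U' [X' [_ Ux' _ bX']]]] _] := @contact_kernel_canonical R m.
  have dimE (W : {vspace 'rV[K]_n}) (s : seq 'rV[K]_n) : basis_of W s -> \dim W =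
    size s.
    by move=> /andP[/eqP <- /eqP].
  by rewrite (dimE _ _ (bX x Ux)) (dimE _ _ (bX' x Ux')) !size_map.
set v := insert_entry i 1 x.
have -> : u = insert_entry i 0 (project i v u) + u 0 i *: v
  by rewrite insert_project subrK.
have vxi : v \in xi p by rewrite -Ep; exact: insert_entry1_in_contact.
apply: memvD; last exact: memvZ.
rewrite -Ep -mem_chart_fiber fE mem_chart_fiber memv_ker lfunE /=.
rewrite om_homog_chart insert_project linearB /= omZr om_nn mulr0 subr0.
by rewrite -om_homog_chart Ep hu.
Qed.

Lemma slide_in_contact p : (slide_distribution (m := m) p <= xi p)%VS.
Proof. by apply/subvP => u /mem_plane[h _]; exact: contact_eq_om. Qed.

End ContactUniqueness.

(** * Plaques and leaves *)

Section Plaques.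
Variables (R : realType) (m : nat).
Hypothesis m_ge1 : (1 <= m)%N.
Notation K := (C R).
Notation n := (2 * m).+1.
Notation V := 'rV[C R]_(2 * m).+2.

Definition slide_foliation : foliation R n m :=
  Foliation (@irregular_analytic R m) (irregular_codim m_ge1)
    (@slide_distribution_holomorphic R m) (@slide_distribution_involutive R m).

Lemma polydiscP d (t : 'rV[K]_d) : polydisc t <-> forall j, `|t 0 j| < 1.
Proof.
split=> [h j|h].
  by have [_ /(_ 0 j)] := h; rewrite mxE /ball /= sub0r normrN.
by split=> // i j; rewrite mxE /ball /= sub0r normrN ord1.
Qed.

Lemma affine_coord_chart (i : 'I_n.+1) (y : 'rV[K]_n) k :
  affine_coord i (chart ord0 y) 0 k = insert_entry ord0 1 y 0 (lift i k) /
    insert_entry ord0 1 y 0 i.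
Proof.
rewrite mxE; have [a a0 ->] := homog_chart ord0 y; rewrite !mxE.
by rewrite invfM mulrACA mulfV // mul1r.
Qed.

(** A plaque is tested in every chart. By the quotient rule the differential read in the chart [i]
    lifts to [(W t 0 i)^-1] times the one of the chart 0, modulo the line of [W t], and this line
    lies in the plane. *)
Lemma plaque_of_affine (Phi : 'rV[K]_m -> 'rV[K]_n) :
  (forall t, polydisc t -> differentiable Phi t) ->
  (forall t, polydisc t -> forall u, 'd Phi t u = 0 -> u = 0) ->
  (forall t, polydisc t -> forall u,
     insert_entry ord0 0 ('d Phi t u) \in plane (insert_entry ord0 1 (Phi t))) ->
  plaque slide_foliation (chart ord0 \o Phi).
Proof.
move=> dPhi inj tan.
pose W t := insert_entry ord0 1 (Phi t).
have W0 t : W t 0 ord0 = 1 by rewrite /W insert_entryE.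
pose G (i : 'I_n.+1) := affine_coord i \o (chart ord0 \o Phi).
have GE i t k : G i t 0 k = W t 0 (lift i k) / W t 0 i by exact: affine_coord_chart.
have Wi i t : range (chart i) ((chart ord0 \o Phi) t) -> W t 0 i != 0.
  move=> /range_chart; have [a a0 /= ->] := homog_chart ord0 (Phi t).
  by rewrite mxE mulf_eq0 negb_or a0.
have dWk t k : polydisc t -> differentiable (fun t => W t 0 k : K) t.
  move=> pt; have dW := differentiable_comp (dPhi t pt) (differentiable_insert_entry
    ord0 1 (Phi t)).
  exact: (differentiable_comp dW (differentiable_coordV k (W t))).
have DWk t k u : polydisc t -> 'd (fun t => W t 0 k : K) t u = insert_entry ord0 0
  ('d Phi t u) 0 k.
  move=> pt; case: (unliftP ord0 k) => [l|] ->; rewrite insert_entryE.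
    have -> : (fun t => W t 0 (lift ord0 l) : K) = (fun t => Phi t 0 l).
      by apply/funext => s; rewrite /W insert_entryE.
    by have [] := diff_row_coord l u (dPhi t pt).
  have -> : (fun t => W t 0 ord0 : K) = cst 1 by apply/funext => s; rewrite W0.
  exact: (congr1 (fun h : 'rV[K]_m -> K => h u) (diff_cst _ _)).
have dG i t : polydisc t -> W t 0 i != 0 -> differentiable (G i) t.
  move=> pt wi; apply: differentiable_rV => k; under eq_fun do rewrite GE.
  exact: (differentiableM (dWk t (lift i k) pt) (differentiableV (dWk t i pt) wi)).
have Wline i t : W t 0 i != 0 -> insert_entry i 1 (G i t) = (W t 0 i)^-1 *: W t.
  move=> wi; apply/rowP => k; rewrite [RHS]mxE; case: (unliftP i k) => [l|] ->;
    rewrite insert_entryE.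
    by rewrite GE mulrC.
  by rewrite mulVf.
have DG i t u : polydisc t -> W t 0 i != 0 ->
    insert_entry i 0 ('d (G i) t u) = (W t 0 i)^-1 *: (insert_entry ord0 0 ('d Phi t u)
      - insert_entry ord0 0 ('d Phi t u) 0 i *: insert_entry i 1 (G i t)).
  move=> pt wi; set D := insert_entry ord0 0 ('d Phi t u).
  have hD k : 'd (fun t => W t 0 k : K) t u = D 0 k by exact: DWk.
  clearbody D; have dg := dG i t pt wi.
  have main l : 'd (G i) t u 0 l = (W t 0 i)^-1 * (D 0 (lift i l) - D 0 i * G i t 0 l).
    have [dgl Eg] := diff_row_coord l u dg.
    have hi : {for t, continuous (fun t => W t 0 i : K)}.
      by apply: differentiable_continuous; exact: dWk.
    have nz : \forall s \near t, W s 0 i != 0.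
      by apply: (hi [set z | z != 0]); apply: open_nbhs_nbhs; split;
        [exact: (@open_neq0 K)|].
    have E : 'D_u (fun s => W s 0 (lift i l) : K) t = 'D_u ((fun s => W s 0 i : K) *
      (fun s => G i s 0 l : K)) t.
      apply: near_eq_derive; apply: filterS nz => s ws.
      apply: (@etrans _ _ (W s 0 i * G i s 0 l)); last by [].
      by rewrite GE mulrCA mulfV ?mulr1.
    have dw := diff_derivable (v := u) (dWk t i pt);
      have dgu := diff_derivable (v := u) dgl.
    have E1 := etrans (esym (hD (lift i l))) (etrans (esym (deriveE u (dWk t (lift i
      l) pt))) (etrans E (deriveM dw dgu))).
    have E2 := etrans (deriveE u (dWk t i pt)) (hD i).
    have E3 := etrans (deriveE u dgl) Eg.
    rewrite E1 E2 E3 -![_ *: _]/(_ * _) [G i t 0 l * _]mulrC addrK mulKf //.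
  apply/rowP => k; rewrite [RHS]mxE [X in _ = _ * X]mxE [X in _ = _ * (_ + X)]mxE [X
    in _ = _ * (_ - X)]mxE.
  case: (unliftP i k) => [l|] ->; first by rewrite !(insert_entryE i _ _).2 main.
  by rewrite !(insert_entryE i _ _).1 mulr1 subrr mulr0.
split.
- move=> t pt; split.
    by apply: continuous_comp; [exact: differentiable_continuous (dPhi t pt)|exact:
      chart_continuous].
  move=> i /Wi wi; split; first exact: dG.
  suff ker0 u : 'd (G i) t u = 0 -> u = 0.
    move=> u1 u2 h; apply/eqP; rewrite -subr_eq0; apply/eqP; apply: ker0.
    by rewrite linearB /=; apply/eqP; rewrite subr_eq0; apply/eqP.
  move=> h; have E0 : insert_entry i 0 ('d (G i) t u) = 0.
    by apply: etrans (congr1 (insert_entry i 0) h) _; exact: linear0.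
  have := etrans (esym (DG i t u pt wi)) E0; rewrite (Wline i t wi).
  set D := insert_entry ord0 0 ('d Phi t u).
  have D0 : D 0 ord0 = 0 by rewrite /D insert_entryE.
  have DE : D = 0 -> u = 0.
    move=> h0; apply: (inj t pt); apply: etrans (esym (project_insert ord0 0 _)) _.
    by rewrite -/D h0; apply/rowP => k; rewrite !mxE mul0r subr0.
  clearbody D => /eqP; rewrite scaler_eq0 invr_eq0 (negbTE wi) /= scalerA => /eqP E.
  (* A kernel vector makes [D] a multiple of [W t]; the multiple is 0 because at index 0 the entries
     are 0 for [D] and 1 for [W t]. *)
  have c0 : D 0 i / W t 0 i = 0.
    have := congr1 (fun v : V => v 0 ord0) E; rewrite !mxE.
    have w0 := W0 t; rewrite /W mxE in w0; rewrite w0 D0 mulr1 sub0r => /eqP.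
    by rewrite oppr_eq0 => /eqP.
  by apply: DE; move: E; rewrite c0 scale0r subr0.
- move=> _ [t pt <-] /= /irregular_chart/negP; apply.
  by apply/existsP; exists None; rewrite /= insert_entryE oner_neq0.
- move=> t i pt /Wi wi u; rewrite mem_slide_fiber -[affine_coord i _]/(G i t) DG //
  Wline //.
  rewrite mem_planeZ ?invr_eq0 //; apply: memvZ; apply: memvB; first exact: tan.
  by do 2 apply: memvZ; exact: self_in_plane.
Qed.

End Plaques.

(** * Calculus for functions of a single coordinate of the polydisc *)

Section Calculus.
Variable K : numFieldType.
Implicit Types (f g : K -> K) (a df dg : K).

Lemma is_derive_add f g a df dg : is_derive a 1 f df -> is_derive a 1 g dg ->
  is_derive a 1 (fun s => f s + g s) (df + dg).
Proof. exact: is_deriveD. Qed.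

Lemma is_derive_sub f g a df dg : is_derive a 1 f df -> is_derive a 1 g dg ->
  is_derive a 1 (fun s => f s - g s) (df - dg).
Proof. exact: is_deriveB. Qed.

Lemma is_derive_mul f g a df dg : is_derive a 1 f df -> is_derive a 1 g dg ->
  is_derive a 1 (fun s => f s * g s) (df * g a + f a * dg).
Proof.
move=> hf hg; apply: is_derive_eq (is_deriveM hf hg) _.
by rewrite addrC; congr (_ + _); exact: mulrC.
Qed.

Lemma is_derive_const a (c : K) : is_derive a 1 (fun _ : K => c) 0.
Proof. exact: is_derive_cst. Qed.

Lemma is_derive_scale f a df (c : K) : is_derive a 1 f df -> is_derive a 1 (fun s =>
  c * f s) (c * df).
Proof.
by move=> hf; apply: is_derive_eq (is_derive_mul (is_derive_const a c) hf) _;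
  rewrite mul0r add0r.
Qed.

Lemma is_derive_bigsum (I : finType) (f : I -> K -> K) (d : I -> K) a :
  (forall i, is_derive a 1 (f i) (d i)) -> is_derive a 1 (fun s => \sum_i f i s)
    (\sum_i d i).
Proof.
move=> h; elim: (index_enum I) => [|i r IH].
  by under eq_fun do rewrite big_nil; rewrite big_nil; exact: is_derive_const.
by under eq_fun do rewrite big_cons; rewrite big_cons; exact: is_derive_add.
Qed.

Lemma is_derive_diff f a df (h : K) : is_derive a 1 f df -> 'd f a h = df * h.
Proof.
move=> hf; have Df := is_derive_differentiable hf.
have E1 : 'd f a 1 = df.
  by rewrite -(@deriveE K K K _ _ 1 Df); exact: (@derive_val _ _ _ _ _ _ _ hf).
have E4 : 'd f a h = h *: 'd f a (1 : K^o).
  by rewrite -linearZ /=; congr ('d f _ _); rewrite [_ *: _]mulr1.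
by apply: etrans E4 _; rewrite E1; exact: mulrC.
Qed.

End Calculus.

Section CoordinateFunctions.
Variables (R : realType) (d : nat).
Notation K := (C R).

Lemma diff_coord_fun (f : K -> K) (t : 'rV[K]_d) j df : is_derive (t 0 j) 1 f df ->
  differentiable (fun s : 'rV[K]_d => f (s 0 j)) t /\
  forall u, 'd (fun s : 'rV[K]_d => f (s 0 j)) t u = df * u 0 j.
Proof.
move=> hf; have Df := is_derive_differentiable hf.
have did : differentiable (fun s : 'rV[K]_d => s) t by exact: ex_diff.
have [dc _] := diff_row_coord j 0 did.
split; first exact: (differentiable_comp dc Df).
move=> u; have E := diff_comp dc Df.
apply: etrans (congr1 (fun h : 'rV[K]_d -> K => h u) E) _.
apply: etrans (is_derive_diff _ hf) _; congr (_ * _).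
have [_ Eu] := diff_row_coord j u did; apply: etrans Eu _.
have Eid : 'd (fun s : 'rV[K]_d => s) t = id :> ('rV[K]_d -> 'rV[K]_d)
  by exact: diff_val.
exact: (congr1 (fun h : 'rV[K]_d -> 'rV[K]_d => h u 0 j) Eid).
Qed.

Lemma diff_sum_coord_fun (f : 'I_d -> K -> K) (t : 'rV[K]_d) (df : 'I_d -> K) c0 :
  (forall j, is_derive (t 0 j) 1 (f j) (df j)) ->
  differentiable (fun s : 'rV[K]_d => c0 + \sum_j f j (s 0 j)) t /\
  forall u, 'd (fun s : 'rV[K]_d => c0 + \sum_j f j (s 0 j)) t u = \sum_j df j * u 0 j.
Proof.
move=> hf; have dj j := (diff_coord_fun (hf j)).1;
  have Ej j := (diff_coord_fun (hf j)).2.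
have dS : differentiable (fun s : 'rV[K]_d => \sum_j f j (s 0 j)) t
  by exact: differentiable_bigsum.
have dT : differentiable (fun s : 'rV[K]_d => c0 + \sum_j f j (s 0 j)) t.
  exact: (differentiableD (differentiable_cst c0 t) dS).
split=> // u.
have DS : 'D_u (\sum_j (fun s : 'rV[K]_d => f j (s 0 j))) t = \sum_j 'D_u (fun s :
  'rV[K]_d => f j (s 0 j)) t.
  by apply: derive_sum => j; exact: diff_derivable.
have ES : \sum_j (fun s : 'rV[K]_d => f j (s 0 j)) = (fun s : 'rV[K]_d => \sum_j f j
  (s 0 j)).
  by apply/funext => s; rewrite fct_sumE.
rewrite ES in DS.
have D1 := deriveD (derivable_cst c0 t u) (diff_derivable (v := u) dS).
apply: etrans (esym (deriveE u dT)) _; apply: etrans D1 _.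
apply: etrans (congr2 +%R (derive_cst c0 t u) DS) _.
rewrite add0r; apply: eq_bigr => j _.
exact: etrans (deriveE u (dj j)) (Ej j u).
Qed.

End CoordinateFunctions.

(** * Plaques built from discs in the variables [x_j] *)

Section LeafArcs.
Variables (R : realType) (m : nat).
Hypothesis m_ge1 : (1 <= m)%N.
Notation K := (C R).
Notation n := (2 * m).+1.
Notation V := 'rV[C R]_(2 * m).+2.
Notation F := (slide_foliation R m_ge1).

Definition affine_point (x y : 'I_m -> K) (z : K) : 'rV[K]_n :=
  \row_k vec 1 x y z 0 (lift ord0 k).

Lemma insert_affine_point x y z : insert_entry ord0 1 (affine_point x y z) = vec 1 x
  y z.
Proof.
apply/rowP => k; case: (unliftP ord0 k) => [l|] ->; rewrite insert_entryE.
  by rewrite mxE.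
by rewrite vecE.
Qed.

Lemma diff_affine_point (x y z : 'I_m -> K -> K) (x' y' z' : 'I_m -> K) c0 (t :
  'rV[K]_m) :
  (forall j, is_derive (t 0 j) 1 (x j) (x' j)) ->
  (forall j, is_derive (t 0 j) 1 (y j) (y' j)) ->
  (forall j, is_derive (t 0 j) 1 (z j) (z' j)) ->
  let Phi := fun s : 'rV[K]_m => affine_point (fun j => x j (s 0 j)) (fun j => y j (s
    0 j))
     (c0 + \sum_j z j (s 0 j)) in
  differentiable Phi t /\ forall u, insert_entry ord0 0 ('d Phi t u) =
    vec 0 (fun j => x' j * u 0 j) (fun j => y' j * u 0 j) (\sum_j z' j * u 0 j).
Proof.
move=> hx hy hz Phi.
have dk : forall k : 'I_n.+1, differentiable (fun s => insert_entry ord0 1 (Phi s) 0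
  k : K) t.
  apply: index_cases => [|j|j|]; rewrite /Phi;
    under eq_fun do rewrite insert_affine_point vecE.
  - exact: differentiable_cst.
  - exact: (diff_coord_fun (hx j)).1.
  - exact: (diff_coord_fun (hy j)).1.
  - exact: (diff_sum_coord_fun c0 hz).1.
have dPhi : differentiable Phi t.
  apply: differentiable_rV => l; have := dk (lift ord0 l).
  by under eq_fun do rewrite insert_entryE.
split=> // u.
have E k : k != ord0 -> insert_entry ord0 0 ('d Phi t u) 0 k = 'd (fun s =>
  insert_entry ord0 1 (Phi s) 0 k : K) t u.
  rewrite eq_sym => k0; have [l -> _] := unlift_some k0; rewrite insert_entryE.
  have -> : (fun s => insert_entry ord0 1 (Phi s) 0 (lift ord0 l) : K) = (fun s =>
    Phi s 0 l).
    by apply/funext => s; rewrite insert_entryE.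
  by have [_ ->] := diff_row_coord l u dPhi.
apply: vec_ext => [|j|j|]; rewrite vecE.
- by rewrite insert_entryE.
- rewrite E ?index_eqE //.
  have -> : (fun s => insert_entry ord0 1 (Phi s) 0 (ix j) : K) = (fun s : 'rV[K]_m
    => x j (s 0 j)).
    by apply/funext => s; rewrite /Phi insert_affine_point vecE.
  exact: (diff_coord_fun (hx j)).2.
- rewrite E ?index_eqE //.
  have -> : (fun s => insert_entry ord0 1 (Phi s) 0 (iy j) : K) = (fun s : 'rV[K]_m
    => y j (s 0 j)).
    by apply/funext => s; rewrite /Phi insert_affine_point vecE.
  exact: (diff_coord_fun (hy j)).2.
- rewrite E ?index_eqE //.
  have -> : (fun s => insert_entry ord0 1 (Phi s) 0 (iz m) : K) = (fun s : 'rV[K]_m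
    => c0 + \sum_j z j (s 0 j)).
    by apply/funext => s; rewrite /Phi insert_affine_point vecE.
  exact: (diff_sum_coord_fun c0 hz).2.
Qed.

(* With lam l = log (x - p_l), the solutions y of dy = rho dx, and z of
   dz = y dx - x dy, as functions of x. *)
Definition log_sum (c : K) (lam : poles -> K) : K := c + \sum_l residue R l / 2 * lam l.

Definition log_height (c x : K) (lam : poles -> K) : K :=
  2 * (c * x + \sum_l residue R l / 2 * ((x - pole R l) * lam l - x)) - x * log_sum c
    lam.

Definition slope (x : K) : K := \sum_l residue R l / 2 / (x - pole R l).

Lemma is_derive_log_sum (f f' : K -> K) Lam (c t : K) : log_lift f f' Lam -> `|t| < 1 ->
  is_derive t 1 (fun s => log_sum c (Lam^~ s)) (slope (f t) * f' t).
Proof.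
move=> H /H[_ _ _ hL].
have := is_derive_add (is_derive_const t c) (is_derive_bigsum (fun l =>
  is_derive_scale (residue R l / 2) (hL l))).
move/is_derive_eq; apply; rewrite add0r /slope mulr_suml; apply: eq_bigr => l _.
by rewrite mulrA mulrAC.
Qed.

(** Integration by parts: a primitive of [y dx - x dy] is twice a primitive of [y dx], minus [x y];
    and [(x - p) lam - x] is a primitive of [lam dx] when [lam] is a logarithm of [x - p]. *)
Lemma is_derive_log_height (f f' : K -> K) Lam (c t : K) : log_lift f f' Lam -> `|t|
  < 1 ->
  is_derive t 1 (fun s => log_height c (f s) (Lam^~ s))
    (log_sum c (Lam^~ t) * f' t - f t * (slope (f t) * f' t)).
Proof.
move=> H t1; have hg := is_derive_log_sum c H t1; have [hf _ np hL] := H t t1.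
have h1 l := is_derive_sub (is_derive_mul (is_derive_sub hf (is_derive_const t (pole
  R l))) (hL l)) hf.
have h2 := is_derive_bigsum (fun l => is_derive_scale (residue R l / 2) (h1 l)).
have h3 := is_derive_scale 2 (is_derive_add (is_derive_scale c hf) h2).
apply: is_derive_eq (is_derive_sub h3 (is_derive_mul hf hg)) _.
have -> : \sum_l residue R l / 2 * ((f' t - 0) * Lam l t + (f t - pole R l) * (f' t /
  (f t - pole R l)) - f' t)
   = f' t * \sum_l residue R l / 2 * Lam l t.
  rewrite mulr_sumr; apply: eq_bigr => l _.
  by rewrite [_ * (f' t / _)]mulrC divfK ?subr_eq0 // subr0 addrK mulrCA mulrA.
by rewrite /log_sum; ring.
Qed.

(** The multivalued parametrization of the leaf with integration constants [c] and [c0], made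
    single-valued by recording the logarithms in the state [S j]. *)
Definition leaf_point (c : 'I_m -> K) c0 (S : 'I_m -> K * (poles -> K)) : 'rV[K]_n :=
  affine_point (fun j => (S j).1) (fun j => log_sum (c j) (S j).2)
    (c0 + \sum_j log_height (c j) (S j).1 (S j).2).

(** The product of [m] discs, one for each variable [x_j], parametrizes a single plaque; it is
    immersed because no [f'] vanishes. *)
Lemma leaf_log_step p c c0 S S' : (forall j, log_step (S j) (S' j)) ->
  leaf F p (chart ord0 (leaf_point c c0 S)) -> leaf F p (chart ord0 (leaf_point c c0
    S')).
Proof.
move=> st.
have /choice[A HA] : forall j, exists A : ((K -> K) * (K -> K) * (poles -> K -> K) *
  K * K),
   let: (f, f', Lam, t, t') := A in [/\ log_lift f f' Lam, `|t| < 1, `|t'| < 1,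
    S j = (f t, Lam^~ t) & S' j = (f t', Lam^~ t')].
  by move=> j; have [f [f' [Lam [t [t' h]]]]] := st j; exists (f, f', Lam, t, t').
pose f j := (A j).1.1.1.1; pose f' j := (A j).1.1.1.2; pose Lam j := (A j).1.1.2.
pose t := \row_j (A j).1.2; pose t' := \row_j (A j).2.
have {}HA j : [/\ log_lift (f j) (f' j) (Lam j), `|t 0 j| < 1, `|t' 0 j| < 1,
    S j = (f j (t 0 j), (Lam j)^~ (t 0 j)) & S' j = (f j (t' 0 j), (Lam j)^~ (t' 0 j))].
  by have := HA j; rewrite /f /f' /Lam !mxE; case: (A j) => [[[[? ?] ?] ?] ?].
pose g j s := log_sum (c j) (Lam j ^~ s).
pose h j s := log_height (c j) (f j s) (Lam j ^~ s).
pose Phi := fun s : 'rV[K]_m => affine_point (fun j => f j (s 0 j)) (fun j => g j (s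
  0 j)) (c0 + \sum_j h j (s 0 j)).
have PhiE (s : 'rV[K]_m) (S0 : 'I_m -> K * (poles -> K)) :
    (forall j, S0 j = (f j (s 0 j), (Lam j)^~ (s 0 j))) -> leaf_point c c0 S0 = Phi s.
  move=> hS; rewrite /leaf_point /Phi; congr affine_point.
  - by apply/funext => j; rewrite hS.
  - by apply/funext => j; rewrite hS.
  - by congr (_ + _); apply: eq_bigr => j _; rewrite hS.
have hL j : log_lift (f j) (f' j) (Lam j) by have [] := HA j.
have dPhi s : polydisc s -> differentiable Phi s /\ forall u, insert_entry ord0 0 ('d
  Phi s u) =
    vec 0 (fun j => f' j (s 0 j) * u 0 j) (fun j => slope (f j (s 0 j)) * f' j (s 0
      j) * u 0 j)
      (\sum_j (g j (s 0 j) * f' j (s 0 j) - f j (s 0 j) * (slope (f j (s 0 j)) * f' j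
        (s 0 j))) * u 0 j).
  move=> /polydiscP ps; apply: diff_affine_point => j.
  - by have [] := hL j _ (ps j).
  - exact: is_derive_log_sum (hL j) (ps j).
  - exact: is_derive_log_height (hL j) (ps j).
have pl : plaque F (chart ord0 \o Phi).
  apply: plaque_of_affine => s ps; have [dP EP] := dPhi s ps; first by [].
    move=> u hu; apply/rowP => j; rewrite mxE.
    have := EP u; rewrite hu linear0 => /(congr1 (fun v : V => v 0 (ix j)));
      rewrite vecE mxE => /esym/eqP.
    have /polydiscP/(_ j) sj := ps; have [_ nz _ _] := hL j _ sj.
    by rewrite mulf_eq0 (negbTE nz) => /eqP.
  move=> u; rewrite EP insert_affine_point; set v := vec 1 _ _ _; set w := vec 0 _ _ _.
  (* Off the poles the slope of [y_j] is [P_j / Q_j], so tangent vectors are killed by every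
     [tau]. *)
  have tw a : tau a v w = 0.
    case: a => [j|]; rewrite /tau; last by rewrite vecE.
    have /polydiscP/(_ j) sj := ps; have [_ _ np _] := hL j _ sj.
    rewrite pqpol_affine; [|by rewrite vecE|by move=> l; rewrite vecE].
    by rewrite !vecE -/(slope _); ring.
  apply/mem_plane; split=> [|a b]; last by rewrite !tw !mul0r.
  rewrite omE !vecE mul1r mul0r subr0; apply/eqP; rewrite subr_eq0; apply/eqP.
  by apply: eq_bigr => j _; rewrite !vecE; ring.
rewrite (PhiE t) ?(PhiE t'); [|by move=> j; have [] := HA j|by move=> j;
  have [] := HA j].
apply: leaf_step pl _ _; apply/polydiscP => j; by have [] := HA j.
Qed.

End LeafArcs.

(** * Density of the generic leaf *)

Section Density.
Variables (R : realType) (m : nat).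
Hypothesis m_ge1 : (1 <= m)%N.
Notation K := (C R).
Notation n := (2 * m).+1.
Notation V := 'rV[C R]_(2 * m).+2.
Notation F := (slide_foliation R m_ge1).

(** A variable at rest still has to move on some immersed disc, since a plaque needs all [m]
    dimensions; a small disc around its point is used. *)
Lemma log_step_refl (x : K) lam : (forall l, x != pole R l) -> log_step (x, lam) (x,
  lam).
Proof.
move=> hx; have [d d0 hd] := pole_dist hx.
have nd : `|d%:C%C : K| = d%:C%C by rewrite normCE expr0n addr0 sqrtr_sqr gtr0_norm.
have [|||lam' [f [f' [Lam [t [t' [H t1 _ E _]]]]]]] := @log_step_disc R x d%:C%C x x
  lam.
- by rewrite subrr normr0 nd ltcR.
- by rewrite subrr normr0 nd ltcR.
- by move=> l; rewrite nd.
by exists f, f', Lam, t, t.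
Qed.

Lemma leaf_log_reach1 p c c0 (S : 'I_m -> K * (poles -> K)) j0 s' :
  (forall j l, (S j).1 != pole R l) -> log_reach (S j0) s' ->
  leaf F p (chart ord0 (leaf_point c c0 S)) ->
  leaf F p (chart ord0 (leaf_point c c0 (fun j => if j == j0 then s' else S j))).
Proof.
move=> hS; elim=> [|s1 s2 _ IH st] h.
  have -> : (fun j => if j == j0 then S j0 else S j) = S; last by [].
  by apply/funext => j; case: eqP => [->|].
apply: leaf_log_step (IH h) => j; case: eqP => // _.
by have := @log_step_refl (S j).1 (S j).2 (hS j); case: (S j).
Qed.

(** The chains of the different variables need not have the same length, so the variables are moved
    one after the other. *)
Lemma leaf_log_reach p c c0 (S S' : 'I_m -> K * (poles -> K)) :
  (forall j l, (S j).1 != pole R l) -> (forall j l, (S' j).1 != pole R l) ->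
  (forall j, log_reach (S j) (S' j)) ->
  leaf F p (chart ord0 (leaf_point c c0 S)) -> leaf F p (chart ord0 (leaf_point c c0
    S')).
Proof.
move=> hS hS' hr h.
suff W (r : seq 'I_m) : uniq r ->
    leaf F p (chart ord0 (leaf_point c c0 (fun j => if j \in r then S' j else S j))).
  have := W (enum 'I_m) (enum_uniq _).
  by have -> : (fun j => if j \in enum 'I_m then S' j else S j) = S'
    by apply/funext => j; rewrite mem_enum.
elim: r => [|j0 r IH] /=; first by [].
move=> /andP[j0r /IH{}IH].
pose T j := if j \in r then S' j else S j.
have hT j l : (T j).1 != pole R l by rewrite /T; case: ifP.
have Tj0 : log_reach (T j0) (S' j0) by rewrite /T (negbTE j0r).
have := leaf_log_reach1 hT Tj0 IH.
have -> : (fun j => if j == j0 then S' j0 else T j) = (fun j => if j \in j0 :: r then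
  S' j else S j).
  by apply/funext => j; rewrite inE /T; case: eqP => [->|].
by [].
Qed.

Lemma log_sum_loops c lam (k : poles -> int) :
  log_sum c (fun l => lam l + (k l)%:~R * two_pi_i R) =
  log_sum c lam + two_pi_i R / 2 * \sum_l residue R l * (k l)%:~R.
Proof.
rewrite /log_sum -addrA mulr_sumr -big_split /=; congr (_ + _); apply: eq_bigr => l _.
by move: (residue R l) (two_pi_i R) => r w; field.
Qed.

Lemma log_height_loops c x lam (k : poles -> int) :
  log_height c x (fun l => lam l + (k l)%:~R * two_pi_i R) =
  log_height c x lam + two_pi_i R / 2 *
    (x * \sum_l residue R l * (k l)%:~R - 2 * \sum_l residue R l * pole R l * (k
      l)%:~R).
Proof.
rewrite /log_height log_sum_loops.
have -> : \sum_l residue R l / 2 * ((x - pole R l) * (lam l + (k l)%:~R * two_pi_i R)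
  - x) =
   \sum_l residue R l / 2 * ((x - pole R l) * lam l - x) + two_pi_i R / 2 *
   (x * \sum_l residue R l * (k l)%:~R - \sum_l residue R l * pole R l * (k l)%:~R).
  rewrite [x * _]mulr_sumr -sumrB mulr_sumr -big_split /=; apply: eq_bigr => l _.
  by move: (residue R l) (pole R l) (two_pi_i R) => r p w; field.
by ring.
Qed.

Lemma two_pi_i_neq0 : two_pi_i R / 2 != 0.
Proof.
by rewrite mulf_neq0 ?invr_eq0 ?pnatr_eq0 // eq_complex /= eqxx mulrn_eq0 /= gt_eqF
  // pi_gt0.
Qed.

(* The target values of the two period sums are chosen so that the loops in the
   variable x_j correct y_j, and those in the first variable also correct z. *)
Lemma leaf_near p (x y x' y' : 'I_m -> K) (z z' e : K) : 0 < e ->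
  (forall j l, x j != pole R l) -> (forall j l, x' j != pole R l) ->
  leaf F p (chart ord0 (affine_point x y z)) ->
  exists y'' z'', [/\ leaf F p (chart ord0 (affine_point x' y'' z'')),
    forall j, `|y'' j - y' j| < e & `|z'' - z'| < e].
Proof.
move=> e0 hx hx' hleaf.
have /choice[lam1 hlam1] : forall j, exists lam', log_reach (x j, fun=> 0) (x' j, lam').
  by move=> j; exact: log_connect.
pose om0 := two_pi_i R / 2; have om0_neq0 : om0 != 0 by exact: two_pi_i_neq0.
pose c0 := z - \sum_j log_height (y j) (x j) (fun=> 0).
pose Y j := log_sum (y j) (lam1 j); pose H j := log_height (y j) (x' j) (lam1 j).
pose T (j : 'I_m) := if j == Ordinal m_ge1 then z' - c0 - \sum_j H j else 0.
(* These solve [Y j + om0 * s1 j = y' j] and [om0 * (x' j * s1 j - 2 * s2 j) = T j], where [om0] is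
   pi i. *)
pose s1 j := (y' j - Y j) / om0; pose s2 j := (x' j * s1 j - T j / om0) / 2.
(* The error on [z] is at most the sum of [|om0| * e1 * (|x' j| + 2)]; the added 1 makes it strictly
   less than [e] and makes [M >= 1], as needed for [y]. *)
pose M := 1 + \sum_j (`|x' j| + 2).
have M1 : 1 <= M by rewrite lerDl sumr_ge0 // => j _; rewrite addr_ge0.
have M0 : 0 < M by exact: lt_le_trans M1.
have w0 : 0 < `|om0| by rewrite normr_gt0.
pose e1 := e / (`|om0| * M).
have e10 : 0 < e1 by rewrite divr_gt0 // mulr_gt0.
have /choice[k hk] : forall j, exists k : poles -> int,
    `|\sum_l residue R l * (k l)%:~R - s1 j| < e1 /\
    `|\sum_l residue R l * pole R l * (k l)%:~R - s2 j| < e1.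
  by move=> j; exact: residues_dense.
pose S j : K * (poles -> K) := (x j, fun=> 0).
pose S' j : K * (poles -> K) := (x' j, fun l => lam1 j l + (k j l)%:~R * two_pi_i R).
have hSS' j : log_reach (S j) (S' j) by apply: log_reach_trans (hlam1 j) _;
  exact: log_loops.
have LS : leaf_point y c0 S = affine_point x y z.
  rewrite /leaf_point; congr affine_point; last by rewrite subrK.
  by apply/funext => j; rewrite /log_sum big1 ?addr0 // => l _; rewrite mulr0.
rewrite -LS in hleaf.
have := leaf_log_reach (S := S) (S' := S') hx hx' hSS' hleaf.
pose k1 j := \sum_l residue R l * (k j l)%:~R.
pose k2 j := \sum_l residue R l * pole R l * (k j l)%:~R.
have omM : `|om0| * e1 * M = e by rewrite /e1; field; rewrite !gt_eqF.
move=> hl; exists (fun j => Y j + om0 * k1 j), (c0 + \sum_j (H j + om0 * (x' j * k1 j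
  - 2 * k2 j))).
split.
- congr (leaf F p (chart ord0 _)): hl; rewrite /leaf_point; congr affine_point.
    by apply/funext => j; exact: log_sum_loops.
  by congr (_ + _); apply: eq_bigr => j _; exact: log_height_loops.
- move=> j; have -> : Y j + om0 * k1 j - y' j = om0 * (k1 j - s1 j) by rewrite /s1;
  field.
  rewrite normrM; apply: (@lt_le_trans _ _ (`|om0| * e1)); first
    by rewrite ltr_pM2l // (hk j).1.
  by rewrite -omM ler_peMr // mulr_ge0 // ltW.
have -> : c0 + \sum_j (H j + om0 * (x' j * k1 j - 2 * k2 j)) - z' =
    \sum_j om0 * (x' j * (k1 j - s1 j) - 2 * (k2 j - s2 j)).
  have ET : \sum_j T j = z' - c0 - \sum_j H j.
    rewrite (bigD1 (Ordinal m_ge1)) //= big1 ?addr0 /T ?eqxx // => j /negbTE h;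
      by rewrite /T h.
  have -> : \sum_j om0 * (x' j * (k1 j - s1 j) - 2 * (k2 j - s2 j)) =
      \sum_j (om0 * (x' j * k1 j - 2 * k2 j)) - \sum_j T j.
    by rewrite -sumrB; apply: eq_bigr => j _; rewrite /s2; field.
  by rewrite ET big_split /=; ring.
apply: le_lt_trans (ler_norm_sum _ _ _) _.
apply: (@le_lt_trans _ _ (\sum_j `|om0| * e1 * (`|x' j| + 2))).
  apply: ler_sum => j _; rewrite normrM -mulrA ler_pM2l //.
  apply: le_trans (ler_normB _ _) _; rewrite !normrM normr_nat mulrDr mulrC.
  by apply: lerD; rewrite ?[e1 * _]mulrC; [rewrite mulrC|]; apply: ler_wpM2l => //;
    apply: ltW; have [] := hk j.
have SM : \sum_j (`|x' j| + 2) < M by rewrite /M ltrDr.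
have w1 : 0 < `|om0| * e1 by rewrite mulr_gt0.
by rewrite -mulr_sumr -[ltRHS]omM ltr_pM2l.
Qed.

Definition generic_poly (v : V) : K := v 0 ord0 * \prod_j qpol j v.

Definition special_points : set (CP R n) := [set p | generic_poly (homog p) = 0].

Lemma generic_polyZ c v : c != 0 -> (generic_poly (c *: v) == 0) = (generic_poly v ==
  0).
Proof.
move=> c0; rewrite /generic_poly mxE; under eq_bigr do rewrite qpolZ.
by rewrite big_split /= !mulf_eq0 (negbTE c0) prodr_const !expf_eq0 (negbTE c0) !andbF.
Qed.

Lemma special_chart i x : special_points (chart i x) <-> generic_poly (insert_entry i
  1 x) = 0.
Proof.
rewrite /special_points /=; have [a a0 ->] := homog_chart i x.
by split=> [/eqP|h]; [rewrite (generic_polyZ _ a0) => /eqP|apply/eqP;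
  rewrite (generic_polyZ _ a0) h].
Qed.

Lemma generic_poly_neq0 v : generic_poly v != 0 <->
  v 0 ord0 != 0 /\ forall j l, v 0 (ix j) != pole R l * v 0 ord0.
Proof.
rewrite /generic_poly mulf_eq0 negb_or; split=> [/andP[v0 /prodf_neq0 h]|[v0 h]].
  by split=> // j l; have /prodf_neq0/(_ l isT) := h j isT; rewrite subr_eq0.
rewrite v0; apply/prodf_neq0 => j _; apply/prodf_neq0 => l _; rewrite subr_eq0;
  exact: h.
Qed.

Lemma special_analytic : analytic_subset special_points.
Proof.
move=> i x; exists setT, 1%N, (fun y => \row_(_ < 1) generic_poly (insert_entry i 1 y)).
split=> //; first exact: openT.
  move=> y _; apply: differentiable_rV => k; under eq_fun do rewrite mxE.
  have dq v : differentiable generic_poly v.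
    apply: differentiableM (differentiable_coordV _ v) _.
    by apply: differentiable_bigprod => j; exact: differentiable_qpol.
  exact: (differentiable_comp (differentiable_insert_entry i 1 y) (dq _)).
move=> y _; rewrite special_chart; split=> [h|/rowP/(_ 0)]; last by rewrite !mxE.
by apply/rowP => k; rewrite !mxE.
Qed.

Lemma special_neqT : special_points <> setT.
Proof.
move=> E; have : special_points (chart ord0 (\row__ 1)) by rewrite E.
apply/special_chart/eqP/generic_poly_neq0.
have E1 k : insert_entry ord0 1 (\row__ 1 : 'rV[K]_n) 0 k = 1.
  by rewrite mxE; case: unlift => [l|] //; rewrite mxE.
rewrite E1; split=> [|j l]; first exact: oner_neq0.
by rewrite E1 mulr1 eq_sym pole_neq1.
Qed.

Lemma generic_affine p : ~ special_points p -> exists x y z,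
  p = chart ord0 (affine_point x y z) /\ forall j l, x j != pole R l.
Proof.
move/eqP/generic_poly_neq0 => [v0 h]; set v := homog p in v0 h.
exists (fun j => v 0 (ix j) / v 0 ord0), (fun j => v 0 (iy j) / v 0 ord0), (v 0 (iz
  m) / v 0 ord0).
split; last by move=> j l; apply: contra_neq (h j l) => <-; rewrite divfK.
rewrite -[LHS](affine_coordK v0); congr chart; apply/rowP => k;
  rewrite [LHS]mxE [RHS]mxE -/v.
have E : forall i : 'I_n.+1, v 0 i / v 0 ord0 = vec 1 (fun j => v 0 (ix j) / v 0 ord0)
    (fun j => v 0 (iy j) / v 0 ord0) (v 0 (iz m) / v 0 ord0) 0 i.
  by apply: index_cases => [|j|j|]; rewrite vecE // mulfV.
exact: E.
Qed.

(** On the segment towards the point whose homogeneous coordinates are all 1, each factor of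
    [generic_poly] is affine in [t] and nonzero at [t = 1], because 1 is not a pole. It is therefore
    nonzero for all small [t] other than 0. *)
Lemma open_generic (O : set (CP R n)) : open O -> O !=set0 -> exists q, O q /\ ~
  special_points q.
Proof.
move=> oO [q Oq]; have [i hi] := homog_neq0_coord q.
pose x := affine_coord i q; have Eq : chart i x = q by exact: affine_coordK.
pose one : 'rV[K]_n := \row__ 1.
pose g (t : K) := x + t *: (one - x).
have g0 : g 0 = x by rewrite /g scale0r addr0.
have dg : differentiable g 0.
  by apply: differentiableD; [exact: differentiable_cst|apply: differentiableZl;
    exact: ex_diff].
have cg := differentiable_continuous dg.
have gO : \forall t \near (0 : K), O (chart i (g t)).
  apply: (cg (chart i @^-1` O)); rewrite g0;
    apply: (chart_continuous (i := i) (x := x)).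
  by apply: open_nbhs_nbhs; rewrite Eq.
pose v t := insert_entry i 1 (g t).
have vE t k : v t 0 k = (1 - t) * insert_entry i 1 x 0 k + t.
  rewrite /v /g /one; case: (unliftP i k) => [l|] ->; rewrite !insert_entryE; last
    by ring.
  by rewrite !mxE; ring.
have near_affine (a b : K) : b != 0 -> \forall t \near (0 : K)^', (1 - t) * a + t * b
  != 0.
  move=> b0; have [->|a0] := eqVneq a 0.
    near=> t; have t0 : t != 0 by near: t; exact: nbhs_dnbhs_neq.
    by rewrite mulr0 add0r mulf_neq0.
  have dh : differentiable (fun t : K => (1 - t) * a + t * b) 0.
    have did : differentiable (fun t : K => t) 0 by exact: ex_diff.
    have d1 := differentiableM (differentiableB (differentiable_cst (1 : K) (0 : K))
      did) (differentiable_cst a (0 : K)).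
    exact: differentiableD d1 (differentiableM did (differentiable_cst b (0 : K))).
  have ch := differentiable_continuous dh.
  have hz : (1 - 0) * a + 0 * b != 0 by rewrite subr0 mul1r mul0r addr0.
  have h0 : \forall t \near (0 : K), (1 - t) * a + t * b != 0.
    by apply: (ch [set z | z != 0]); apply: open_nbhs_nbhs; split;
      [exact: (@open_neq0 K)|exact: hz].
  exact: nbhs_dnbhs h0.
have near0 : \forall t \near (0 : K)^', v t 0 ord0 != 0.
  have := near_affine (insert_entry i 1 x 0 ord0) 1 (oner_neq0 _).
  by apply: filterS => t; rewrite vE mulr1.
have nearx : \forall t \near (0 : K)^', forall j, forall l, v t 0 (ix j) != pole R l
  * v t 0 ord0.
  apply: (@filter_forall _ _ (fun j t => forall l, v t 0 (ix j) != pole R l * v t 0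
    ord0) ((0 : K)^')) => j.
  apply: (@filter_forall _ _ (fun l t => v t 0 (ix j) != pole R l * v t 0 ord0) ((0 :
    K)^')) => l.
  have p1 : 1 - pole R l != 0 by rewrite subr_eq0 eq_sym pole_neq1.
  have := near_affine (insert_entry i 1 x 0 (ix j) - pole R l * insert_entry i 1 x 0
    ord0) _ p1.
  apply: filterS => t; apply: contra_neq => E.
  have := E; rewrite !vE => E'.
  transitivity ((1 - t) * insert_entry i 1 x 0 (ix j) + t - pole R l * ((1 - t) *
    insert_entry i 1 x 0 ord0 + t)).
    by ring.
  by rewrite E' subrr.
have gO' : \forall t \near (0 : K)^', O (chart i (g t)) by exact: nbhs_dnbhs.
near ((0 : K)^') => t.
exists (chart i (g t)); split; first by near: t.
apply/special_chart/eqP/generic_poly_neq0; split; first by near: t.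
by near: t.
Unshelve. all: by end_near. Qed.

(** Any open set contains a generic point to aim at; its coordinates [x_j] are reached exactly, and
    only the [y_j] and [z] are approximated. *)
Lemma generic_leaf : generic_leaf_dense F.
Proof.
exists special_points; split; [exact: special_analytic|exact: special_neqT|].
move=> p hp _ O O0 oO.
have [q [Oq hq]] := open_generic oO O0.
have [x [y [z [Ep hx]]]] := generic_affine hp.
have [x' [y' [z' [Eq hx']]]] := generic_affine hq.
have Oc : nbhs (affine_point x' y' z') (chart ord0 @^-1` O).
  apply: (chart_continuous (i := ord0) (x := affine_point x' y' z')).
  by apply: open_nbhs_nbhs; rewrite -Eq.
have /nbhs_ballP[e /= e0 he] := Oc.
have hl : leaf F p (chart ord0 (affine_point x y z)) by rewrite -Ep; exact: leaf_refl.
have [y'' [z'' [hl' hy hz]]] := leaf_near y' z' e0 hx hx' hl.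
exists (chart ord0 (affine_point x' y'' z'')); split => //.
apply: he; split => // a k.
rewrite (ord1 a) [affine_point x' y' z' _ _]mxE [affine_point x' y'' z'' _ _]mxE.
have : forall k0 : 'I_n.+1, `|vec 1 x' y' z' 0 k0 - vec 1 x' y'' z'' 0 k0| < e.
  apply: index_cases => [|j|j|]; rewrite !vecE; rewrite ?subrr ?normr0 //;
    rewrite distrC //.
by move=> /(_ (lift ord0 k)).
Qed.

End Density.

Theorem theorem7 (R : realType) (m : nat) (m_ge1 : (1 <= m)%N)
    (xi : tangent_distribution R (2 * m).+1) (xi_contact : canonical_contact xi) :
  exists F : foliation R (2 * m).+1 m, legendrian F xi /\ generic_leaf_dense F.
Proof.
exists (slide_foliation R m_ge1); split; last exact: generic_leaf.
by move=> p _; exact: slide_in_contact.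
Qed.
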